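(* Let $s\ge 3$ and let $\theta_s=\theta(a_1,\dots,a_s)$ be an $s$-bridge graph. Then $\chi_{la}(\theta_s)=2$ if and only if either (i) $\theta_s=K_{2,s}$ with $s\ge 4$ even, or (ii) the size (number of edges) $m$ of $\theta_s$ is greater than $2s+2$ and $\theta_s$ is one of the following graphs, where $l$ and $t$ denote integers: 1. $\theta\bigl((4l)^{[3l+2]},(4l+2)^{[l]}\bigr)$ with $l\ge 1$; 2a. $\theta\bigl(2l-2,(4l-2)^{[3l-1]}\bigr)$ with $l\ge 2$; 2b. $\theta(2,4^{[3]},6)$; $\theta(4,8^{[5]},10^{[2]})$; $\theta(6,12^{[7]},14^{[3]})$; 3a. $\theta\bigl(4l-2-2t,\,2t,\,(4l-4)^{[l]},\,(4l-2)^{[l-2]}\bigr)$ with $2\le l\le t\le \frac{5l-2}{4}$; 3b. $\theta\bigl(4l-2-2t,\,2t-2,\,(4l-4)^{[l-1]},\,(4l-2)^{[l-1]}\bigr)$ with $2\le l\le t\le \frac{5l}{4}$; 4. $\theta\bigl(2t,\,4s-6-2t,\,2s-4,\,(4s-6)^{[s-3]}\bigr)$ with $\frac{2s-3}{8}\le t\le \frac{6s-5}{8}$ and $s\ge 4$.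
   Context: An $s$-bridge graph $\theta(a_1,\dots,a_s)$, where $s\ge 2$ and $a_1,\dots,a_s$ are positive integers, is the graph consisting of $s$ paths of lengths (numbers of edges) $a_1,\dots,a_s$ joining two fixed distinct vertices $u$ and $v$, the paths being pairwise disjoint except at the common end vertices $u,v$. The order in which the lengths $a_i$ are listed is irrelevant. Equality of graphs means isomorphism. The notation $a^{[n]}$ stands for a sequence of $n$ terms all equal to $a$ (so $a^{[1]}$ is the single term $a$ and $a^{[0]}$ is the empty sequence). For a connected graph $G=(V,E)$ of order at least 3, a local antimagic labeling is a bijection $f:E\to\{1,\dots,|E|\}$ such that the induced vertex labels $f^+(x)=\sum f(e)$, with $e$ ranging over all edges incident to $x$, satisfy $f^+(x)\ne f^+(y)$ for every pair of adjacent vertices $x,y$. The local antimagic chromatic number $\chi_{la}(G)$ is the minimum number of distinct induced vertex labels over all local antimagic labelings $f$ of $G$. $K_{2,s}$ denotes the complete bipartite graph with parts of sizes $2$ and $s$. *)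

(* Defs.v *)
From mathcomp Require Import all_boot.

Set Implicit Arguments.
Unset Strict Implicit.
Unset Printing Implicit Defensive.

(* Finite loopless graphs given by vertices, edges and end points.  Simple
   graphs are those with [ends] injective.  Parallel edges are tolerated only
   because theta(a_1, ..., a_s) has them when several a_i are equal to 1. *)
Record graph := Graph {
  vertex : finType;
  edge : finType;
  ends : edge -> {set vertex};
  card_ends : forall e, #|ends e| = 2 }.

Definition adjacent (G : graph) (x y : vertex G) : Prop :=
  exists e : edge G, ends e = [set x; y].

Definition iso (G H : graph) : Prop :=
  exists (phi : vertex G -> vertex H) (psi : edge G -> edge H),
    [/\ bijective phi, bijective psi
      & forall e, ends (psi e) = phi @: ends e].

(* A bijection E -> {1, ..., |E|} is encoded as a bijection f : E -> 'I_#|E|,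
   the label of the edge e being (f e).+1. *)
Definition vertex_label (G : graph) (f : edge G -> 'I_#|edge G|)
    (x : vertex G) : nat :=
  \sum_(e : edge G | x \in ends e) (f e).+1.

Definition local_antimagic (G : graph) (f : edge G -> 'I_#|edge G|) : Prop :=
  bijective f /\
  forall x y : vertex G, adjacent x y -> vertex_label f x <> vertex_label f y.

Definition num_labels (G : graph) (f : edge G -> 'I_#|edge G|) : nat :=
  size (undup (codom (vertex_label f))).

(* [chi_la G k] is "chi_la(G) = k"; it is a relation because the minimum is
   undefined when G has no local antimagic labeling. *)
Definition chi_la (G : graph) (k : nat) : Prop :=
  (exists f : edge G -> 'I_#|edge G|, local_antimagic f /\ num_labels f = k) /\
  (forall f : edge G -> 'I_#|edge G|, local_antimagic f -> k <= num_labels f).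

Section Theta.
Variable a : seq nat.

(* [inl false] is u, [inl true] is v, and [inr (Tagged _ j)] with tag i is the
   internal vertex of the i-th path at distance j + 1 from u. *)
Definition theta_vertex : finType :=
  (bool + {i : 'I_(size a) & 'I_(nth 0 a i).-1})%type.

Definition theta_edge : finType := {i : 'I_(size a) & 'I_(nth 0 a i)}.

(* The vertex of the i-th path at distance k from u, for k <= a_i; the partial
   injection [insub] into 'I_(a_i).-1 fails exactly when k reaches a_i. *)
Definition theta_point (i : 'I_(size a)) (k : nat) : theta_vertex :=
  if k is k'.+1 then
    if (insub k' : option 'I_(nth 0 a i).-1) is Some j
    then inr (Tagged (fun i : 'I_(size a) => 'I_(nth 0 a i).-1) j)
    else inl true
  else inl false.

Definition theta_ends (e : theta_edge) : {set theta_vertex} :=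
  [set theta_point (tag e) (tagged e); theta_point (tag e) (tagged e).+1].

Lemma card_theta_ends e : #|theta_ends e| = 2.
Proof.
rewrite cards2; case: e => i [k ltk] /=.
suff -> : theta_point i k != theta_point i k.+1 by [].
case: k ltk => [|k] ltk /=; first by case: insubP.
have ltk' : k < (nth 0 a i).-1 by case: (nth 0 a i) ltk.
rewrite insubT; case: insubP => [j _ ej|//].
apply/eqP => -[] /eqP; rewrite -tag_eqE /tag_eq /= eqxx tagged_asE.
by move/eqP/(congr1 val); rewrite /= ej => /n_Sn.
Qed.

Definition theta : graph := Graph card_theta_ends.

End Theta.

Section CompleteBipartite.
Variables p q : nat.

Definition Kbip_ends (e : 'I_p * 'I_q) : {set 'I_p + 'I_q} :=
  [set inl e.1; inr e.2].

Lemma card_Kbip_ends e : #|Kbip_ends e| = 2.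
Proof. by rewrite cards2. Qed.

Definition Kbip : graph := Graph card_Kbip_ends.

End CompleteBipartite.

(* Main.v *)
Require Import Defs.
From mathcomp Require Import all_boot.
From mathcomp Require Import order ssralg ssrnum ssrint zify.

Set Implicit Arguments.
Unset Strict Implicit.
Unset Printing Implicit Defensive.

Import GRing.Theory Num.Theory.

(** Let [m] be the number of edges of the graph. The two vertex labels of a
    labeling that attains 2 form a proper colouring of a connected graph, so
    the label of a vertex is determined by the parity of its distance to [u].
    Either colour class partitions the edges, so its label times its size is
    the sum of all edge labels. This shows that odd bridges are impossible,
    and that for even bridges the colour class without [u] and [v] has the
    label [N = m + 1]. So the edges of a bridge form consecutive pairs of sum
    [N], and the first labels of these pairs are an arithmetic progression,
    whose difference [d] is the same for all bridges: [N + d] is the label of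
    [u] and [v]. A labeling is thus a system of [s] progressions of
    difference [d], called chains here, which together with their mirror
    images under [x -> N - x] partition the numbers from 1 to [m]; the labels
    at [u] and [v] say that the starts of the chains, and also the starts of
    their mirror images, have the sum [N + d]. Lemmas [labeling_balanced] and
    [balanced_chi_la] translate between labelings and such systems.

    If all chains are single numbers the graph is [K_{2,s}] and the condition
    is that [s] is even.  Otherwise [d < N], and each of [1, ..., d] starts one
    of the [2 s] chains and mirror images.  A count gives [d = 2 s - 4 + q] with
    [1 <= q <= 4] and [q (m / 2 - s + 2) = (s - 2) (2 s - 3)]
    ([balanced_cases]), so that only [4 - q] starts are larger than [d].  These
    late starts have a known sum and are stable under [z -> N + d - z].  Hence
    every residue class modulo [d] is a single chain, up to at most three cuts
    at controlled places, and this determines the lengths up to the parameters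
    [l] and [t] ([late_none], [late_one_middle], [late_one_even], [late_two],
    [late_three]).

    The bounds on [l] and [t] come from the remaining balance: choosing
    which of two mirror images belongs to the system means choosing the sign
    of the difference of their starts, and the signed differences must
    cancel. An uncut class contributes a small number, its distance to its
    mirror class, while a cut class contributes almost a multiple of [d],
    and these large numbers have to cancel nearly ([offset_bound]).
    Conversely the small numbers are runs of odd numbers, whose subset sums
    miss only 2 and its complement ([subset_sum_odds]), so the signs exist
    whenever the bounds hold ([classes_chi_la]). Finitely many graphs, most
    of them cases in which another class has to be cut, are left to a
    computation ([classes_okP]). *)

(** * Isomorphism of graphs and the local antimagic chromatic number *)

Lemma iso_sym (G H : graph) : iso G H -> iso H G.
Proof.
move=> [phi [psi [bphi [psi' psiK psi'K] ends_psi]]].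
have [phi' phiK phi'K] := bphi.
exists phi', psi'; split; [by exists phi | by exists psi |] => e.
rewrite -{2}[e]psi'K ends_psi -imset_comp.
rewrite (eq_imset _ (_ : phi' \o phi =1 id)) ?imset_id //.
Qed.

(** A labeling is pulled back along an isomorphism, with the same vertex
    labels at corresponding vertices. *)
Lemma iso_pullback (G H : graph) (f : edge H -> 'I_#|edge H|) :
  iso G H -> local_antimagic f ->
  exists2 g : edge G -> 'I_#|edge G|,
    local_antimagic g & num_labels g = num_labels f.
Proof.
move=> [phi [psi [bphi bpsi ends_psi]]] [bf antif].
have eqGH : #|edge H| = #|edge G| by rewrite (bij_eq_card bpsi).
pose g e := cast_ord eqGH (f (psi e)).
have injphi := bij_inj bphi.
have labg x : vertex_label g x = vertex_label f (phi x).
  rewrite /vertex_label [RHS](reindex psi) /=; last exact: onW_bij.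
  by apply: eq_bigl => e; rewrite ends_psi mem_imset.
exists g.
  split=> [|x y [e exy]].
    apply: inj_card_bij; last by rewrite card_ord.
    by move=> e1 e2 /cast_ord_inj /(bij_inj bf) /(bij_inj bpsi).
  rewrite !labg; apply: antif; exists (psi e).
  by rewrite ends_psi exy imsetU1 imset_set1.
apply: perm_size; apply: uniq_perm; rewrite ?undup_uniq // => n.
rewrite !mem_undup; apply/codomP/codomP=> -[x ->]; first by exists (phi x).
by have [phi' _ phi'K] := bphi; exists (phi' x); rewrite labg phi'K.
Qed.

Lemma chi_la_iso (G H : graph) k : iso G H -> chi_la G k -> chi_la H k.
Proof.
move=> isoGH [[f [laf <-]] minf].
have isoHG := iso_sym isoGH.
have [g lag ng] := iso_pullback isoHG laf.
split=> [|h lah]; first by exists g.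
by have [h' lah' <-] := iso_pullback isoGH lah; apply: minf.
Qed.

(** The ends of an edge have different labels, so the minimum is at least 2. *)
Lemma chi_la2P (G : graph) : 0 < #|edge G| ->
  chi_la G 2 <-> exists2 f : edge G -> 'I_#|edge G|,
    local_antimagic f & num_labels f = 2.
Proof.
case/card_gt0P=> e _; split=> [[[f [? ?]] _]|[f laf nf]]; first by exists f.
split=> [|g [_ lag]]; first by exists f.
have /eqP/cards2P[x [y [/eqP nexy exy]]] := card_ends e.
have /lag : adjacent x y by exists e.
move/eqP=> neq.
apply: (@uniq_leq_size _ [:: vertex_label g x; vertex_label g y]) => [|z].
  by rewrite /= inE neq.
by rewrite mem_undup !inE => /orP[]/eqP->; apply: codom_f.
Qed.

(** * Isomorphic theta graphs *)

Lemma card_sig_ord n (F : 'I_n -> nat) :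
  #|{: {i : 'I_n & 'I_(F i)}}| = \sum_(i < n) F i.
Proof.
rewrite card_tagged sumnE big_map big_enum /=.
by apply: eq_bigr => i _; rewrite card_ord.
Qed.

Section Reindex.
Variables (a b : seq nat) (sg : 'I_(size a) -> 'I_(size b)).
Hypothesis bsg : bijective sg.
Hypothesis absg : forall i, nth 0 b (sg i) = nth 0 a i.

Let eq_pred (i : 'I_(size a)) : (nth 0 a i).-1 = (nth 0 b (sg i)).-1.
Proof. by rewrite absg. Qed.

Let phi (x : theta_vertex a) : theta_vertex b :=
  match x with
  | inl c => inl c
  | inr t => inr (Tagged (fun i : 'I_(size b) => 'I_(nth 0 b i).-1)
                         (cast_ord (eq_pred (tag t)) (tagged t)))
  end.

Let psi (e : theta_edge a) : theta_edge b :=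
  Tagged (fun i : 'I_(size b) => 'I_(nth 0 b i))
         (cast_ord (esym (absg (tag e))) (tagged e)).

Let card_dep (F : nat -> nat) :
  #|{: {i : 'I_(size b) & 'I_(F (nth 0 b i))}}| =
  #|{: {i : 'I_(size a) & 'I_(F (nth 0 a i))}}|.
Proof.
rewrite !card_sig_ord (reindex sg) /=; last exact: onW_bij.
by apply: eq_bigr => i _; rewrite absg.
Qed.

Let tagged_ord_inj (F : nat -> nat)
    (E : forall i : 'I_(size a), F (nth 0 a i) = F (nth 0 b (sg i))) :
  injective (fun t : {i : 'I_(size a) & 'I_(F (nth 0 a i))} =>
    Tagged (fun i : 'I_(size b) => 'I_(F (nth 0 b i)))
           (cast_ord (E (tag t)) (tagged t))).
Proof.
move=> [i k] [j l] /= eqij.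
have /(bij_inj bsg) eij := congr1 tag eqij; rewrite /= in eij.
rewrite -{j}eij /= in l eqij *.
have ekl := eq_from_Tagged eqij.
by congr (Tagged _ _); apply: (cast_ord_inj ekl).
Qed.

(** Bridges are permuted, and the position along a bridge is kept; [eq_pred] and
    [absg] transport the dependent ordinals. *)
Lemma theta_reindex : iso (theta a) (theta b).
Proof.
exists phi, psi; split.
- apply: inj_card_bij; last first.
    by rewrite !card_sum leq_add2l (card_dep (fun n => n.-1)).
  move=> [x|x] [y|y] //=; first by case=> ->.
  move=> exy; congr inr; apply: (@tagged_ord_inj predn eq_pred).
  exact: inr_inj exy.
- apply: inj_card_bij; last by rewrite (card_dep id).
  exact: (@tagged_ord_inj id (fun i => esym (absg i))).
have point i k : theta_point (sg i) k = phi (theta_point i k).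
  case: k => [|k] //=.
  case: insubP => [j ltj ej|]; case: insubP => [j' ltj' ej'|] //=.
  - by congr (inr (Tagged _ _)); apply: val_inj; rewrite /= ej ej'.
  - by move: ltj; rewrite absg => ->.
  - by move=> /negP[]; rewrite absg.
move=> e; rewrite [LHS]/= /theta_ends !point.
by rewrite -[ends e]/(theta_ends e) imsetU1 imset_set1.
Qed.

End Reindex.

Lemma theta_perm a b : perm_eq a b -> iso (theta a) (theta b).
Proof.
move=> pab; have szab := perm_size pab.
have /(perm_iotaP 0)[Is pIs eab] := pab.
have szIs : size Is = size a by rewrite (perm_size pIs) size_iota szab.
have ltIs (i : 'I_(size a)) : nth 0 Is i < size b.
  have : nth 0 Is i \in Is by rewrite mem_nth // szIs.
  by rewrite (perm_mem pIs) mem_iota.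
apply: (@theta_reindex a b (fun i => Ordinal (ltIs i))).
  apply: inj_card_bij; last by rewrite !card_ord szab.
  move=> i j [/eqP]; rewrite nth_uniq ?szIs //.
    by move=> /eqP/val_inj.
  by rewrite (perm_uniq pIs) iota_uniq.
move=> i /=; have := congr1 (nth 0 ^~ (i : nat)) eab.
by rewrite /= (nth_map 0) ?szIs // => ->.
Qed.

Lemma theta_Kbip s : iso (theta (nseq s 2)) (Kbip 2 s).
Proof.
set a := nseq s 2.
have sza : size a = s by rewrite size_nseq.
have a2 (i : 'I_(size a)) : nth 0 a i = 2.
  by rewrite nth_nseq -[X in _ < X]sza ltn_ord.
pose phi (x : theta_vertex a) : 'I_2 + 'I_s :=
  match x with
  | inl c => inl (if c then ord_max else ord0)
  | inr t => inr (cast_ord sza (tag t))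
  end.
pose psi (e : theta_edge a) : 'I_2 * 'I_s :=
  (cast_ord (a2 (tag e)) (tagged e), cast_ord sza (tag e)).
have card_dep F : #|{: {i : 'I_(size a) & 'I_(F (nth 0 a i))}}| = s * F 2.
  rewrite card_sig_ord; under eq_bigr do rewrite a2.
  by rewrite sum_nat_const card_ord sza.
have pos1 (i : 'I_(size a)) (k : 'I_(nth 0 a i).-1) : k = 0 :> nat.
  by have := ltn_ord k; rewrite [X in _ < X.-1]a2; case: (nat_of_ord k).
exists phi, psi; split.
- apply: inj_card_bij.
    move=> [x|[i k]] [y|[j l]] //= [].
      by case: x y => [] [].
    move=> /val_inj eij; rewrite -{j}eij in l *.
    by congr inr; congr (Tagged _ _); apply: val_inj; rewrite /= !pos1.
  by rewrite !card_sum card_bool !card_ord (card_dep predn) muln1.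
- apply: inj_card_bij.
    move=> [i k] [j l] [] /= ekl /val_inj eij; rewrite -{j}eij in l ekl *.
    by congr (Tagged _ _); apply: val_inj.
  by rewrite card_prod !card_ord (card_dep id) mulnC.
move=> [i k]; rewrite /= /theta_ends /Kbip_ends imsetU1 imset_set1 /=.
have : k < 2 by rewrite -[X in _ < X](a2 i).
have szi : (nth 0 a i).-1 = 1 by rewrite a2.
case: k => -[|[|//]] lek _ /=.
  rewrite insubT ?szi //= => lt0; congr [set _; _].
    by congr inl; apply: val_inj.
rewrite insubT ?szi //= => lt0; rewrite insubN ?szi //= setUC.
by congr [set _; _]; congr inl; apply: val_inj.
Qed.

(** * Vertex labels of a theta graph *)

Section ThetaLabels.
Variable a : seq nat.
Implicit Types i j : 'I_(size a).

Lemma eq_theta_point_u i k : (inl false == theta_point i k) = (k == 0).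
Proof. by case: k => [|k] //=; case: insubP. Qed.

Lemma eq_theta_point_v i k :
  0 < nth 0 a i -> k <= nth 0 a i ->
  (inl true == theta_point i k) = (k == nth 0 a i).
Proof.
case: k => [|k] /= a_gt0 lek; first by rewrite (ltn_eqF a_gt0).
case: insubP => [j ltj _|ge].
  by transitivity false => //; lia.
by rewrite eqxx; lia.
Qed.

Lemma eq_theta_point i k j l : 0 < k < nth 0 a i ->
  (theta_point i k == theta_point j l) = (i == j) && (k == l).
Proof.
case: k => [|k] //= ltk.
case: insubP => [o _ eo|]; last by lia.
case: l => [|l] /=; first by rewrite andbF.
case: insubP => [o' lto' eo'|ge]; last first.
  symmetry; apply/negP => /andP[/eqP eij /eqP[ekl]].
  by move/negP: ge; apply; rewrite -eij -ekl; lia.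
have eqinr (T1 T2 : eqType) (x y : T2) :
  (inr x == inr y :> (T1 + T2)%type) = (x == y) by [].
rewrite eqinr -tag_eqE /tag_eq /=.
case: eqVneq => //= eij; rewrite -{j}eij in o' lto' eo' *.
by rewrite tagged_asE -val_eqE /= eo eo' eqSS.
Qed.

Lemma theta_edge_eq (e e' : theta_edge a) :
  (tag e == tag e' :> nat) && (tagged e == tagged e' :> nat) = (e == e').
Proof.
case: e e' => [i k] [j l] /=; rewrite -tag_eqE /tag_eq /= val_eqE.
case: eqVneq => //= eij; rewrite -{j}eij in l *.
by rewrite tagged_asE.
Qed.

Variable (f : edge (theta a) -> 'I_#|edge (theta a)|) (F : nat -> nat -> nat).
Hypothesis fE : forall e, (f e).+1 = F (tag e) (tagged e).
Hypothesis a_gt0 : forall i, 0 < nth 0 a i.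

(** The edge [(i, k)] joins the points [k] and [k + 1] of the bridge [i], so the
    sums over edges become double sums over natural numbers. *)
Lemma theta_label_sum x :
  vertex_label f x = \sum_(i < size a)
    \sum_(k < nth 0 a i | (x == theta_point i k) || (x == theta_point i k.+1))
      F i k.
Proof.
rewrite /vertex_label sig_big_dep.
by apply: eq_big => [e|e _]; [rewrite in_set2 | rewrite fE].
Qed.

Lemma theta_label_u : vertex_label f (inl false) = \sum_(i < size a) F i 0.
Proof.
rewrite theta_label_sum; apply: eq_bigr => i _.
under eq_bigl => k do rewrite !eq_theta_point_u orbF.
by rewrite (big_ord1_eq _ (F i)) a_gt0.
Qed.

Lemma theta_label_v :
  vertex_label f (inl true) = \sum_(i < size a) F i (nth 0 a i).-1.
Proof.
rewrite theta_label_sum; apply: eq_bigr => i _; have a0 := a_gt0 i.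
rewrite (eq_bigl (fun k : 'I_(nth 0 a i) => k == (nth 0 a i).-1 :> nat)).
  by rewrite (big_ord1_eq _ (F i)) ifT //; lia.
move=> k; have ltk := ltn_ord k.
by rewrite !eq_theta_point_v ?(ltnW ltk) //; lia.
Qed.

Lemma theta_label_in i k : 0 < k < nth 0 a i ->
  vertex_label f (theta_point i k) = F i k.-1 + F i k.
Proof.
move=> ltk; rewrite theta_label_sum (bigD1 i) // [X in _ + X = _]big1 ?addn0;
  last first.
  move=> j neij; rewrite big_pred0 // => l.
  by rewrite !eq_theta_point // eq_sym (negPf neij).
rewrite (eq_bigl (fun l : 'I_(nth 0 a i) => (l == k.-1 :> nat) || (l == k :>
  nat))).
  rewrite (bigID (fun l : 'I_(nth 0 a i) => l == k :> nat)) /= addnC.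
  congr (_ + _).
    rewrite (eq_bigl (fun l : 'I_(nth 0 a i) => l == k.-1 :> nat)).
      by rewrite (big_ord1_eq _ (F i)) ifT //; lia.
    by move=> l; lia.
  rewrite (eq_bigl (fun l : 'I_(nth 0 a i) => l == k :> nat)).
    by rewrite (big_ord1_eq _ (F i)) ifT //; lia.
  by move=> l; lia.
move=> l; rewrite !eq_theta_point // eqxx /=; lia.
Qed.

End ThetaLabels.

Lemma theta_adjacent a (x y : vertex (theta a)) : adjacent x y ->
  exists (i : 'I_(size a)) (k : 'I_(nth 0 a i)),
    x = theta_point i k /\ y = theta_point i k.+1 \/
    x = theta_point i k.+1 /\ y = theta_point i k.
Proof.
move=> [e exy]; have := card_theta_ends e.
rewrite -[theta_ends e]/(ends e) exy cards2.
case: eqVneq => // nexy _; case: e exy => i k exy; exists i, k.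
have : x \in [set x; y] by rewrite set21.
have : y \in [set x; y] by rewrite set22.
rewrite -exy !in_set2 => /orP[]/eqP ey /orP[]/eqP ex; rewrite ex ey.
- by rewrite ex ey eqxx in nexy.
- by right.
- by left.
- by rewrite ex ey eqxx in nexy.
Qed.

Lemma card_theta_edge a : #|edge (theta a)| = sumn a.
Proof.
by rewrite [LHS](card_sig_ord (fun i : 'I_(size a) => nth 0 a i)) sumnE
  (big_nth 0) big_mkord.
Qed.

Lemma theta_pointP a (x : theta_vertex a) (i0 : 'I_(size a)) :
    (forall i : 'I_(size a), 0 < nth 0 a i) ->
  exists (i : 'I_(size a)) (k : nat), k <= nth 0 a i /\ x = theta_point i k.
Proof.
move=> a_gt0; case: x => [[]|[i j]].
- by exists i0, (nth 0 a i0); split=> //; apply/eqP; rewrite eq_theta_point_v.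
- by exists i0, 0.
exists i, j.+1; split=> /=; first by have := ltn_ord j; lia.
case: insubP => [o _ eo|]; last by rewrite ltn_ord.
by congr (inr (Tagged _ _)); apply: val_inj.
Qed.

(** * Balanced systems of chains *)

(** The chain [(b, b', n)] is the progression [b, b + d, ...] of [n] terms, and
    [b'] is the start of its mirror image; keeping both makes the passage to
    the mirror image an exchange of components. *)
Definition chain := (nat * nat * nat)%type.

Implicit Types (c : chain) (C : seq chain) (d : nat).

Definition start c := c.1.1.
Definition costart c := c.1.2.
Definition len c := c.2.
Definition flip c : chain := (costart c, start c, len c).
Definition cells d c := [seq start c + k * d | k <- iota 0 (len c)].
(** The sum of a number and its mirror image, one more than the number of edges
    when the chains have half the lengths of the bridges. *)
Definition modulus C := (2 * sumn (map len C)).+1.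

(** That the chains and their mirror images are disjoint need not be stated:
    they have [modulus C - 1] cells in all, as many as there are numbers to
    cover. *)
Record balanced d C : Prop := Balanced {
  balanced_len : {in C, forall c, 0 < len c};
  balanced_mirror :
    {in C, forall c, start c + costart c + (len c).-1 * d = modulus C};
  balanced_cover : forall x, 0 < x < modulus C ->
    exists2 c, c \in C & (x \in cells d c) || (x \in cells d (flip c));
  balanced_start : \sum_(c <- C) start c = modulus C + d;
  balanced_costart : \sum_(c <- C) costart c = modulus C + d }.

Lemma cellsP d c x :
  reflect (exists2 k, k < len c & x = start c + k * d) (x \in cells d c).
Proof.
apply: (iffP mapP) => -[k ltk ->]; exists k => //.
  by rewrite mem_iota in ltk.
by rewrite mem_iota.
Qed.

(** Bridge [i] gets the chain [i] on its edges of even rank, counted from 0,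
    and the complements on the following edges. Two edges at an inner vertex
    then sum to [N] or, one step later, to [N + d]. The labeling is onto by
    [balanced_cover], hence bijective. *)
Lemma balanced_chi_la d C : 0 < d -> 0 < size C -> balanced d C ->
  chi_la (theta [seq 2 * len c | c <- C]) 2.
Proof.
move=> d_gt0 C_gt0 [lenC mirrorC coverC startC costartC].
set N := modulus C in mirrorC coverC startC costartC.
set a := map _ C.
have sza : size a = size C by rewrite size_map.
pose c_ i := nth (0, 0, 0) C i.
have Cc (i : 'I_(size a)) : c_ i \in C by rewrite mem_nth // -sza.
have na (i : 'I_(size a)) : nth 0 a i = 2 * len (c_ i).
  by rewrite (nth_map (0, 0, 0)) // -[X in _ < X]sza.
have card_e : #|edge (theta a)| = N.-1.
  rewrite card_theta_edge /N /modulus /= sumnE big_map sumnE big_map big_distrr.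
  by [].
clearbody a N.
have a_gt0 (i : 'I_(size a)) : 0 < nth 0 a i.
  by rewrite na; have := lenC _ (Cc i); lia.
pose F i k := let x := start (c_ i) + k./2 * d in if odd k then N - x else x.
have bound (i : 'I_(size a)) k : k < len (c_ i) ->
    start (c_ i) + k * d + (costart (c_ i) + ((len (c_ i)).-1 - k) * d) = N.
  move=> ltk; rewrite -(mirrorC _ (Cc i)).
  have -> : (len (c_ i)).-1 = k + ((len (c_ i)).-1 - k) by lia.
  by rewrite mulnDl; lia.
pose Fe (e : edge (theta a)) := F (tag e) (tagged e).
have cover : {subset iota 1 N.-1 <= map Fe (enum (edge (theta a)))}.
  move=> x; rewrite mem_iota => /andP[x_gt0 xltN].
  have [|c cC xc] := coverC x; first by lia.
  have lti : index c C < size a by rewrite sza index_mem.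
  pose i := Ordinal lti.
  have ci : c_ i = c by rewrite /c_ nth_index.
  clearbody i.
  suff [k ltk ->] : exists2 k, k < nth 0 a i & x = F i k.
    pose e : edge (theta a) :=
      Tagged (fun i : 'I_(size a) => 'I_(nth 0 a i)) (Ordinal ltk).
    by rewrite -[F i k]/(Fe e) map_f // mem_enum.
  case/orP: xc => /cellsP[k].
    rewrite -ci => ltk ->; exists k.*2; first by rewrite (na i); lia.
    by rewrite /F odd_double doubleK.
  rewrite -[len (flip c)]/(len c) -[start (flip c)]/(costart c) -ci => ltk ->.
  exists (((len (c_ i)).-1 - k).*2.+1); first by rewrite (na i); lia.
  rewrite /F /= odd_double uphalf_double /=.
  have := bound i ((len (c_ i)).-1 - k); rewrite subKn; last by lia.
  by lia.
have szF : size (map Fe (enum (edge (theta a)))) = N.-1.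
  by rewrite size_map -cardE.
have szle : size (map Fe (enum (edge (theta a)))) <= size (iota 1 N.-1).
  by rewrite szF size_iota.
have [_ memF] := uniq_min_size (iota_uniq _ _) cover szle.
have injF : injective Fe.
  by apply/injectiveP; apply: (leq_size_uniq (iota_uniq _ _) cover szle).
have rangeF e : 0 < Fe e < N.
  have : Fe e \in iota 1 N.-1 by rewrite memF; apply: map_f; rewrite mem_enum.
  by rewrite mem_iota; lia.
have ltF e : (Fe e).-1 < #|edge (theta a)|.
  by rewrite card_e; have := rangeF e; lia.
pose f e := Ordinal (ltF e).
have fE e : (f e).+1 = F (tag e) (tagged e).
  by rewrite /= prednK //; have := rangeF e; lia.
have sumC (G : chain -> nat) : \sum_(i < size a) G (c_ i) = \sum_(c <- C) G c.
  by rewrite (big_nth (0, 0, 0)) big_mkord sza.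
have label (i : 'I_(size a)) k : k <= nth 0 a i ->
    vertex_label f (theta_point i k) = if odd k then N else N + d.
  move=> lek; have [->|k_gt0] := posnP k.
    by rewrite (theta_label_u fE) //= -startC -sumC; apply: eq_bigr => j _;
       rewrite /F /= addn0.
  move: lek; rewrite leq_eqVlt => /orP[/eqP ek|ltk]; last first.
    rewrite (theta_label_in fE) ?k_gt0 //.
    case: k k_gt0 ltk => // k _; rewrite na => ltk.
    have ltk2 : k./2 < len (c_ i) by lia.
    move: (bound i k./2 ltk2); rewrite /F /=.
    case: ifP => oddk /=; rewrite uphalf_half oddk mulnDl ?mul1n ?mul0n;
      clear; lia.
  have -> : theta_point i k = inl true.
    by apply/esym/eqP; rewrite eq_theta_point_v ?ek.
  rewrite (theta_label_v fE) // ek na mul2n odd_double -costartC -sumC.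
  apply: eq_bigr => j _; rewrite na.
  have lj := lenC _ (Cc j).
  have -> : (2 * len (c_ j)).-1 = (len (c_ j)).-1.*2.+1 by lia.
  rewrite /F /= odd_double uphalf_double /=.
  by have := bound j (len (c_ j)).-1; rewrite subnn; lia.
have i0 : 'I_(size a) := cast_ord (esym sza) (Ordinal C_gt0).
apply/chi_la2P.
  apply/card_gt0P.
  by exists (Tagged (fun i : 'I_(size a) => 'I_(nth 0 a i)) (Ordinal (a_gt0
    i0))).
exists f.
  split=> [|x y /theta_adjacent[i [k xy]]].
    apply: inj_card_bij; last by rewrite card_ord.
    by move=> e e' /(congr1 val)/= ee'; apply: injF; have := rangeF e;
       have := rangeF e'; lia.
  have ltk := ltn_ord k.
  by case: xy => -[-> ->]; rewrite !label ?(ltnW ltk) //=; case: odd => /=; lia.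
apply/eqP; rewrite -[2]/(size [:: N; N + d]); apply/eqP/perm_size/uniq_perm.
- by rewrite undup_uniq.
- by rewrite /= inE; lia.
move=> x; rewrite mem_undup !inE.
apply/codomP/orP=> [[y ->]|].
  have [i [k [lek ->]]] := theta_pointP y i0 a_gt0.
  by rewrite label //; case: odd; rewrite eqxx; [left | right].
case=> /eqP->.
  by exists (theta_point i0 1); rewrite label.
by exists (inl false); rewrite (label i0 0).
Qed.

(** ** From a labeling to a balanced system *)

Section Alternating.
Variables (g : nat -> nat) (n c0 c1 : nat).
Hypothesis alt : forall k, 0 < k < n -> g k.-1 + g k = if odd k then c1 else c0.

Lemma alternating_sum_even m h : m = h.*2 -> m <= n ->
  \sum_(k < m) g k = h * c1.
Proof.
move=> ->; elim: h => [|h IH] leh; first by rewrite big_ord0.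
rewrite doubleS !big_ord_recr /= IH; last by lia.
have := alt (k := h.*2.+1); rewrite /= odd_double /= => <-; lia.
Qed.

(** An odd number of terms can be paired from either end. *)
Lemma alternating_sum_odd m h : m = h.*2.+1 -> m <= n ->
  \sum_(k < m) g k = g 0 + h * c0 /\ \sum_(k < m) g k = g m.-1 + h * c1.
Proof.
move=> em lem; split; last first.
  rewrite em big_ord_recr /= (@alternating_sum_even _ h) //; lia.
rewrite {m}em in lem *; elim: h lem => [|h IH] leh.
  by rewrite big_ord1 mul0n addn0.
rewrite doubleS 2!big_ord_recr /= IH; last by lia.
have := alt (k := h.*2.+2); rewrite /= odd_double /= => <-; lia.
Qed.

Lemma alternating_even_terms h : h.*2 < n -> g h.*2 + h * c1 = g 0 + h * c0.
Proof.
elim: h => [//|h IH] leh; have := IH; rewrite doubleS !mulSn.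
have := alt (k := h.*2.+2); rewrite /= odd_double /=.
have := alt (k := h.*2.+1); rewrite /= odd_double /=; lia.
Qed.

End Alternating.

Lemma sum_labels m : 2 * (\sum_(j < m) j.+1) = m * m.+1.
Proof. by elim: m => [|m IH]; rewrite ?big_ord0 // big_ord_recr /= mulnDr IH;
  lia. Qed.

Section FromLabeling.
Variables (a : seq nat) (f : edge (theta a) -> 'I_#|edge (theta a)|).
Hypothesis a_gt0 : forall i : 'I_(size a), 0 < nth 0 a i.
Hypothesis a_ge3 : 3 <= size a.
Hypothesis laf : local_antimagic f.
Hypothesis lab2 : num_labels f = 2.

Let F (i k : nat) :=
  \sum_(e : theta_edge a | (tag e == i :> nat) && (tagged e == k :> nat))
    (f e).+1.

Let fE e : (f e).+1 = F (tag e) (tagged e).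
Proof.
rewrite /F (eq_bigl (pred1 e)) ?big_pred1_eq // => e'.
by rewrite theta_edge_eq.
Qed.

Let L := vertex_label f.
Let c0 := L (inl false).

Let i0 : 'I_(size a) := Ordinal (ltnW (ltnW a_ge3)).

Let two_labels : exists c1 : nat, forall x, L x = c0 \/ L x = c1.
Proof.
have memL x : L x \in undup (codom L) by rewrite mem_undup codom_f.
move: lab2; rewrite /num_labels -/L; case: undup memL => [|p [|q []]] // memL _.
have := memL (inl false); rewrite !inE -/c0 => /orP[]/eqP ec.
  by exists q => x; have := memL x; rewrite !inE ec => /orP[]/eqP; [left|right].
by exists p => x; have := memL x; rewrite !inE ec => /orP[]/eqP; [right|left].
Qed.

Let neq_next (i : 'I_(size a)) k : k < nth 0 a i ->
  L (theta_point i k) <> L (theta_point i k.+1).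
Proof.
move=> ltk; have [_] := laf; apply.
by exists (Tagged (fun i : 'I_(size a) => 'I_(nth 0 a i)) (Ordinal ltk)).
Qed.

Let sum_edges : 2 * \sum_(i < size a) \sum_(k < nth 0 a i) F i k =
  sumn a * (sumn a).+1.
Proof.
rewrite sig_big_dep /= -card_theta_edge -sum_labels; congr (2 * _).
have [bf _] := laf.
rewrite [RHS](reindex f) /=; last exact: onW_bij.
by apply: eq_bigr => e _; rewrite fE.
Qed.

(** Double counting of the edge labels over the two colour classes: for odd
    bridges the classes have equally many vertices, so their labels would agree;
    for even bridges the class without [u] and [v] gives [c1 = m + 1].  Then
    [c0 = c1 + d], and the total of the relations along the bridges shows that
    [d] is positive. *)
Lemma labeling_balanced : exists d C,
  [/\ 0 < d, balanced d C & a = [seq 2 * len c | c <- C]].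
Proof.
have [c1 valL] := two_labels.
have alt (i : 'I_(size a)) k : k <= nth 0 a i ->
    L (theta_point i k) = if odd k then c1 else c0.
  elim: k => [|k IH] lek //=.
  have := neq_next lek; rewrite IH ?(ltnW lek) //.
  have c01 : c0 <> c1.
    have := neq_next (a_gt0 i0); rewrite -[L (theta_point i0 0)]/c0.
    by case: (valL (theta_point i0 1)) => ->.
  by case: odd; case: (valL (theta_point i k.+1)) => -> //.
have c01 : c0 <> c1.
  have := neq_next (a_gt0 i0); rewrite -[L (theta_point i0 0)]/c0.
  by rewrite alt.
have altF (i : 'I_(size a)) k : 0 < k < nth 0 a i ->
    F i k.-1 + F i k = if odd k then c1 else c0.
  move=> ltk; rewrite -(alt i k); last by lia.
  by rewrite /L (theta_label_in fE).
have sumU : \sum_(i < size a) F i 0 = c0 by rewrite -(theta_label_u fE).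
have sumV : \sum_(i < size a) F i (nth 0 a i).-1 = L (inl true).
  by rewrite -(theta_label_v fE).
have labV (i : 'I_(size a)) : L (inl true) = if odd (nth 0 a i) then c1 else c0.
  rewrite -(alt i) //; congr L; apply/eqP.
  by rewrite eq_theta_point_v.
clearbody F L.
have evenP (i : 'I_(size a)) : odd (nth 0 a i) = odd (nth 0 a i0).
  by have := labV i; rewrite (labV i0); case: odd; case: odd => //; lia.
(* Both colour classes have [1 + sum of the a_i./2] vertices. *)
have [odd0|even0] := boolP (odd (nth 0 a i0)).
  have h_ (i : 'I_(size a)) : nth 0 a i = (nth 0 a i)./2.*2.+1.
    by have := evenP i; rewrite odd0; lia.
  have eq1 : \sum_(i < size a) \sum_(k < nth 0 a i) F i k =
             \sum_(i < size a) F i 0 + \sum_(i < size a) (nth 0 a i)./2 * c0.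
    rewrite -big_split /=; apply: eq_bigr => i _.
    by have [] := alternating_sum_odd (altF i) (h_ i) (leqnn _).
  have eq2 : \sum_(i < size a) \sum_(k < nth 0 a i) F i k =
             \sum_(i < size a) F i (nth 0 a i).-1 +
             \sum_(i < size a) (nth 0 a i)./2 * c1.
    rewrite -big_split /=; apply: eq_bigr => i _.
    by have [] := alternating_sum_odd (altF i) (h_ i) (leqnn _).
  move: eq2; rewrite eq1 sumU sumV (labV i0) odd0 -!big_distrl /=.
  by move=> /eqP; rewrite -!mulSn eqn_pmul2l // => /eqP/c01.
have h_ (i : 'I_(size a)) : nth 0 a i = (nth 0 a i)./2.*2.
  by have := evenP i; rewrite (negPf even0); lia.
pose M := \sum_(i < size a) (nth 0 a i)./2.
have suma : sumn a = M.*2.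
  rewrite sumnE (big_nth 0) big_mkord -mul2n big_distrr /=.
  by apply: eq_bigr => i _; rewrite mul2n -h_.
have leM : size a <= M.
  rewrite -{1}(card_ord (size a)) -sum1_card; apply: leq_sum => i _.
  by have := h_ i; have := a_gt0 i; lia.
have c1E : c1 = M.*2.+1.
  move: sum_edges; rewrite suma.
  under eq_bigr => i _.
    rewrite (alternating_sum_even (altF i) (h_ i) (leqnn _)).
    over.
  rewrite -big_distrl /= -/M mulnA mul2n => /eqP.
  by rewrite eqn_pmul2l; [move/eqP | lia].
have even_terms (i : 'I_(size a)) k : k.*2 < nth 0 a i ->
    F i k.*2 + k * c1 = F i 0 + k * c0.
  exact: (alternating_even_terms (altF i)).
have pair_terms (i : 'I_(size a)) k : k.*2 < nth 0 a i ->
    F i k.*2 + F i k.*2.+1 = c1.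
  move=> ltk; rewrite (altF i k.*2.+1) /= ?odd_double //.
  by have := h_ i; lia.
have lastE (i : 'I_(size a)) :
    F i 0 + F i (nth 0 a i).-1 + (nth 0 a i)./2.-1 * c0 = (nth 0 a i)./2 * c1.
  have hi := h_ i; have ai := a_gt0 i.
  have := even_terms i (nth 0 a i)./2.-1;
    have := pair_terms i (nth 0 a i)./2.-1.
  have -> : (nth 0 a i)./2.-1.*2.+1 = (nth 0 a i).-1 by lia.
  have -> : (nth 0 a i)./2 * c1 = c1 + (nth 0 a i)./2.-1 * c1.
    by rewrite -mulSn; congr (_ * _); lia.
  by lia.
have sumV0 : \sum_(i < size a) F i (nth 0 a i).-1 = c0.
  by rewrite sumV (labV i0) (negPf even0).
(* [c0] is both the sum of the first and the sum of the last edge labels. *)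
have c0E : (M + 2 - size a) * c0 = M * c1.
  have : \sum_(i < size a) (F i 0 + F i (nth 0 a i).-1 + (nth 0 a i)./2.-1 *
    c0) =
         \sum_(i < size a) (nth 0 a i)./2 * c1.
    by apply: eq_bigr => i _.
  rewrite -big_distrl /= -/M !big_split /= sumU sumV0 -big_distrl /= => <-.
  have -> : M + 2 - size a = 2 + \sum_(i < size a) (nth 0 a i)./2.-1.
    have : \sum_(i < size a) ((nth 0 a i)./2.-1 + 1) = M.
      by apply: eq_bigr => i _; have := h_ i; have := a_gt0 i; lia.
    by rewrite big_split /= sum1_card card_ord; lia.
  by rewrite mulnDl mul2n addnn.
have lt10 : c1 < c0.
  rewrite -(ltn_pmul2l (_ : 0 < M + 2 - size a)); last by lia.
  rewrite c0E ltn_pmul2r; lia.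
pose d := c0 - c1.
have c0d : c0 = c1 + d by rewrite /d; lia.
pose G i : chain := (F i 0, F i (nth 0 a i).-1, (nth 0 a i)./2).
exists d, [seq G i | i <- index_iota 0 (size a)].
have modE : modulus [seq G i | i <- index_iota 0 (size a)] = c1.
  by rewrite /modulus -map_comp sumnE big_map big_mkord c1E -mul2n.
have memG c : c \in [seq G i | i <- index_iota 0 (size a)] ->
    exists i : 'I_(size a), c = G i.
  by case/mapP=> i; rewrite mem_index_iota /= => lti ->; exists (Ordinal lti).
have Gmem (i : 'I_(size a)) : G i \in [seq G i | i <- index_iota 0 (size a)].
  by rewrite map_f // mem_index_iota /= ltn_ord.
have mirrorG (i : 'I_(size a)) :
    F i 0 + F i (nth 0 a i).-1 + (nth 0 a i)./2.-1 * d = c1.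
  have := lastE i; rewrite c0d mulnDr.
  have -> : (nth 0 a i)./2 * c1 = c1 + (nth 0 a i)./2.-1 * c1.
    by rewrite -mulSn; congr (_ * _); have := h_ i; have := a_gt0 i; lia.
  by lia.
have evenG (i : 'I_(size a)) k : k.*2 < nth 0 a i -> F i k.*2 = F i 0 + k * d.
  by move=> /even_terms; rewrite c0d mulnDr; lia.
split; first by rewrite /d; lia.
- split; rewrite ?modE.
  + move=> _ /memG[i ->]; rewrite /len /=; have := h_ i; have := a_gt0 i; lia.
  + by move=> _ /memG[i ->]; exact: mirrorG.
  + move=> x; rewrite c1E => ltx; have [[f' _ f'K] _] := laf.
    have ltx' : x.-1 < #|edge (theta a)|.
      by rewrite card_theta_edge suma; lia.
    have [i [k ek]] : exists (i : 'I_(size a)) (k : 'I_(nth 0 a i)), x = F i k.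
      exists (tag (f' (Ordinal ltx'))), (tagged (f' (Ordinal ltx'))).
      by rewrite -fE f'K /=; lia.
    exists (G i) => //; rewrite {}ek.
    have ltk := ltn_ord k; have hi := h_ i; apply/orP.
    have kE := odd_double_half k; case: (odd k) kE => kE; last first.
      left; apply/cellsP; exists (k : nat)./2; rewrite /len /start /=;
        first by lia.
      by rewrite -evenG; [congr (F _ _); lia | lia].
    right; apply/cellsP; exists ((nth 0 a i)./2.-1 - (k : nat)./2).
      by rewrite /len /=; lia.
    have ltk2 : (k : nat)./2.*2 < nth 0 a i by lia.
    have := mirrorG i; have := pair_terms i _ ltk2; rewrite (evenG _ _ ltk2).
    have -> : (k : nat)./2.*2.+1 = k by lia.
    have : (nth 0 a i)./2.-1 * d =
        (k : nat)./2 * d + ((nth 0 a i)./2.-1 - (k : nat)./2) * d.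
      by rewrite -mulnDl; congr (_ * _); lia.
    by rewrite -[start _]/(F i (nth 0 a i).-1); clear; lia.
  + by rewrite (big_map G) big_mkord -c0d -[RHS]sumU.
  + by rewrite (big_map G) big_mkord -c0d -[RHS]sumV0.
apply: (@eq_from_nth _ 0) => [|i lti];
  first by rewrite !size_map size_iota subn0.
rewrite -map_comp (nth_map 0) ?size_iota ?subn0 // nth_iota ?subn0 //=.
by rewrite /len /= mul2n -(h_ (Ordinal lti)).
Qed.

End FromLabeling.

(** * Residue classes *)

Section Classes.
Variables d n0 r0 N : nat.
Hypothesis r0d : 0 < r0 <= d.
Hypothesis NE : N = n0 * d + r0.

Let d_gt0 : 0 < d.
Proof. by case/andP: r0d => /leq_trans; apply. Qed.

(** For [0 < p <= d] this is the number of [x] with [0 < x < N] in the residue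
    class of [p] modulo [d]. *)
Definition class_len p := n0 + (p < r0).

Lemma class_lenE p m : 0 < p <= d -> p + m * d < N -> N <= p + m.+1 * d ->
  m.+1 = class_len p.
Proof.
rewrite NE /class_len => pd lt1 lt2.
have [ltp|lep] := ltnP p r0.
  have : m <= n0 by rewrite -ltnS -(ltn_pmul2r d_gt0); lia.
  have : n0 < m.+1 by rewrite -(ltn_pmul2r d_gt0); lia.
  by lia.
have : m < n0 by rewrite -(ltn_pmul2r d_gt0); lia.
have : n0 <= m.+1 by rewrite -ltnS -(ltn_pmul2r d_gt0); lia.
by lia.
Qed.

(** The least positive member of the residue class of [N - p]. *)
Definition class_mirror p := (if p < r0 then r0 else r0 + d) - p.
(** What an uncut class contributes to the balance of the signs, up to sign. *)
Definition class_offset p := (p - class_mirror p) + (class_mirror p - p).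

Lemma class_mirrorP p : d < N -> 0 < p <= d ->
  [/\ 0 < class_mirror p <= d, class_len (class_mirror p) = class_len p &
      p + class_mirror p + (class_len p).-1 * d = N].
Proof.
move=> d_ltN pd; have n0_gt0 : 0 < n0.
  by move: d_ltN; rewrite NE; case: (n0) => //; lia.
rewrite /class_mirror /class_len; case: (ltnP p r0) => ltp.
  rewrite (_ : r0 - p < r0 = true) /= ?addn1 /=; last by lia.
  by split=> //; [lia | rewrite NE; lia].
rewrite (_ : r0 + d - p < r0 = false) /= ?addn0; last by lia.
split=> //; [lia | rewrite NE -{2}(prednK n0_gt0) mulSn; lia].
Qed.

Lemma count_classes P :
  count P (map class_len (iota 1 d)) = P n0.+1 * r0.-1 + P n0 * (d - r0).+1.
Proof.
have cst m s : {in s, class_len =1 fun=> m} ->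
    count P (map class_len s) = P m * size s.
  move=> sm; rewrite count_map (eq_in_count (a2 := fun=> P m)).
    by case: (P m); rewrite ?count_predT ?mul1n ?count_pred0.
  by move=> x /sm /= ->.
have ed : d = r0.-1 + (d - r0).+1 by lia.
rewrite [in iota 1 d]ed iotaD map_cat count_cat; congr (_ + _).
  rewrite (cst n0.+1) ?size_iota // => p.
  by rewrite mem_iota /class_len => pr;
    rewrite (_ : p < r0 = true) /= ?addn1 //; lia.
rewrite (cst n0) ?size_iota // => p.
by rewrite mem_iota /class_len => pr;
  rewrite (_ : p < r0 = false) /= ?addn0 //; lia.
Qed.

End Classes.

(** * Starts of the chains and of their mirror images *)

Lemma uniq_flatten_map (T U : eqType) (g : T -> seq U) (s : seq T) :
    {in s, forall x, g x != [::]} -> uniq (flatten (map g s)) ->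
  uniq s /\ {in s &, forall x y z, z \in g x -> z \in g y -> x = y}.
Proof.
elim: s => [//|x s IH] gs; rewrite /= cat_uniq => /and3P[_ /hasPn disj].
have xs y z : y \in s -> z \in g x -> z \in g y -> False.
  move=> ys zx zy; have /disj/negP[] // : z \in flatten (map g s).
  by apply/flatten_mapP; exists y.
have gs' : {in s, forall x, g x != [::]} by move=> y ys;
  rewrite gs // inE ys orbT.
case/(IH gs') => Us inj; split.
  rewrite /= Us andbT; apply/negP => /[dup] x_s /xs.
  have := gs x (mem_head _ _); case: (g x) => // z l _ /(_ z).
  by rewrite mem_head; apply.
move=> y y'; rewrite !inE => /predU1P[->|ys] /predU1P[->|y's] // z zy zy'.
- by case: (xs _ _ y's zy zy').
- by case: (xs _ _ ys zy' zy).
exact: inj zy zy'.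
Qed.

Definition signed (b : bool) (x : int) : int := if b then x else (- x)%R.

Lemma norm_signed_sum (s : seq nat) (sg : nat -> bool) (del : nat -> int)
    (w : nat -> nat) :
    {in s, forall x, `|del x|%R = Posz (w x)} ->
  (`|\sum_(x <- s) signed (sg x) (del x)| <= Posz (\sum_(x <- s) w x))%R.
Proof.
move=> dw; apply: Order.POrderTheory.le_trans (Num.Theory.ler_norm_sum _ _ _) _.
rewrite (big_morph Posz PoszD (erefl _)) big_seq [X in (_ <= X)%R]big_seq.
apply: Num.Theory.ler_sum => x /dw <-; rewrite /signed.
by case: sg; rewrite ?Num.Theory.normrN.
Qed.

Section Structure.
Variables (d : nat) (C : seq chain).
Hypothesis d_gt0 : 0 < d.
Hypothesis balC : balanced d C.

Let N := modulus C.
Let O := C ++ map flip C.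

(** [O] lists the chains and their mirror images.  The starts up to [d] are
    forced, see [early_startP]; the late ones mark the places where a residue
    class is cut. *)
Definition starts := map start O.
Definition late_starts := [seq x <- starts | d < x].

Lemma flipK : involutive flip.
Proof. by case=> [[]]. Qed.

Lemma oriented_flip c : c \in O -> flip c \in O.
Proof.
rewrite !mem_cat => /orP[cC|/mapP[c' c'C ->]]; first by rewrite map_f ?orbT.
by rewrite flipK c'C.
Qed.

Lemma oriented_len c : c \in O -> 0 < len c.
Proof.
rewrite mem_cat => /orP[|/mapP[c' c'C ->]]; first exact: (balanced_len balC).
exact: (balanced_len balC c'C).
Qed.

Lemma oriented_mirror c : c \in O -> start c + costart c + (len c).-1 * d = N.
Proof.
rewrite mem_cat => /orP[|/mapP[c' c'C ->]]; first exact: (balanced_mirror balC).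
by have := balanced_mirror balC c'C; rewrite [start c' + _]addnC.
Qed.

Lemma oriented_cover x : 0 < x < N ->
  exists c k, [/\ c \in O, k < len c & x = start c + k * d].
Proof.
move=> /(balanced_cover balC)[c cC /orP[]/cellsP[k ltk ->]].
  by exists c, k; rewrite mem_cat cC.
by exists (flip c), k; rewrite mem_cat map_f ?orbT.
Qed.

Lemma size_oriented : size O = 2 * size C.
Proof. by rewrite size_cat size_map addnn mul2n. Qed.

Let all_cells := flatten (map (cells d) O).

Let size_cells : size all_cells = N.-1.
Proof.
rewrite size_flatten /shape -map_comp (eq_map (_ : _ =1 len)); last first.
  by move=> c; rewrite /= size_map size_iota.
by rewrite map_cat sumn_cat -map_comp addnn -mul2n.
Qed.

Let cells_cover : {subset iota 1 N.-1 <= all_cells}.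
Proof.
move=> x; rewrite mem_iota => ltx.
have [|c [k [cO ltk ex]]] := @oriented_cover x; first by lia.
by apply/flatten_mapP; exists c => //; apply/cellsP; exists k.
Qed.

Let cells_eq : iota 1 N.-1 =i all_cells.
Proof.
have [|_ eqc //] := uniq_min_size (iota_uniq 1 N.-1) cells_cover.
by rewrite size_iota size_cells.
Qed.

Let uniq_cells : uniq all_cells.
Proof.
apply: (leq_size_uniq (iota_uniq 1 N.-1) cells_cover).
by rewrite size_iota size_cells.
Qed.

Let cells_neq0 : {in O, forall c, cells d c != [::]}.
Proof. by move=> c /oriented_len;
  rewrite -size_eq0 size_map size_iota lt0n. Qed.

Lemma oriented_range c k : c \in O -> k < len c -> 0 < start c + k * d < N.
Proof.
move=> cO ltk; have : start c + k * d \in iota 1 N.-1.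
  by rewrite cells_eq; apply/flatten_mapP; exists c => //; apply/cellsP;
    exists k.
by rewrite mem_iota; lia.
Qed.

(** The cells cover [N - 1] numbers and are not more, so they do not overlap. *)
Lemma oriented_inj c c' k k' : c \in O -> c' \in O -> k < len c -> k' < len c'
  ->
  start c + k * d = start c' + k' * d -> c = c' /\ k = k'.
Proof.
move=> cO c'O ltk ltk' ek;
  have [_ inj] := uniq_flatten_map cells_neq0 uniq_cells.
have ecc' : c = c'.
  apply: (inj _ _ cO c'O (start c + k * d)); apply/cellsP; first by exists k.
  by exists k'.
split=> //; move/eqP: ek; rewrite ecc' eqn_add2l eqn_pmul2r //.
by move/eqP.
Qed.

Lemma oriented_uniq : uniq O.
Proof. by have [] := uniq_flatten_map cells_neq0 uniq_cells. Qed.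

Lemma start_inj : {in O &, injective start}.
Proof.
move=> c c' cO c'O ecc'.
have [] // := @oriented_inj c c' 0 0 cO c'O; rewrite ?oriented_len //.
by rewrite ecc'.
Qed.

Lemma starts_uniq : uniq starts.
Proof. by rewrite map_inj_in_uniq ?oriented_uniq //; apply: start_inj. Qed.

Lemma sum_starts : \sum_(x <- starts) x = 2 * (N + d).
Proof.
rewrite big_map big_cat /= big_map (balanced_start balC).
by rewrite [X in _ + X](balanced_costart balC) addnn mul2n.
Qed.

(** The total of the mirror equations over the chains. *)
Lemma modulus_eq : 2 * N + (sumn (map len C) + 2 - size C) * d = size C * N.
Proof.
have leM : size C <= sumn (map len C).
  rewrite sumnE big_map -sum1_size big_seq [leqRHS]big_seq.
  by apply: leq_sum => c; apply: (balanced_len balC).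
have : \sum_(c <- C) (start c + costart c + (len c).-1 * d) = size C * N.
  rewrite (eq_big_seq (fun=> N));
    first by rewrite big_const_seq count_predT iter_addn_0 mulnC.
  exact: (balanced_mirror balC).
rewrite !big_split /= (balanced_start balC) (balanced_costart balC) -big_distrl
  /=.
have -> : sumn (map len C) + 2 - size C = \sum_(c <- C) (len c).-1 + 2.
  have : \sum_(c <- C) ((len c).-1 + 1) = sumn (map len C).
    rewrite sumnE big_map; apply: eq_big_seq => c /(balanced_len balC).
    by lia.
  by rewrite big_split /= sum1_size; lia.
by rewrite mulnDl -/N; lia.
Qed.

Lemma oriented_end_notin c k : c \in O -> 0 < k < len c ->
  start c + k * d \notin starts.
Proof.
move=> cO /andP[k_gt0 ltk]; apply/mapP => -[c' c'O ecc'].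
have [] := oriented_inj cO c'O ltk (oriented_len c'O) (k' := 0).
  by rewrite mul0n addn0.
by move=> _ k0; rewrite k0 in k_gt0.
Qed.

(** The number after the last cell lies in some chain, and it can only be the
    start of it, since otherwise its predecessor would lie in both chains. *)
Lemma oriented_end c : c \in O -> start c + len c * d < N ->
  start c + len c * d \in starts.
Proof.
move=> cO ltN; have lc := oriented_len cO.
have [|c' [[|k] [c'O ltk ex]]] := @oriented_cover (start c + len c * d).
- by have := oriented_range cO lc; lia.
- by rewrite ex mul0n addn0 map_f.
have [] := @oriented_inj c c' (len c).-1 k cO c'O.
- by lia.
- by lia.
- by move: ex; rewrite -{1}(prednK lc) !mulSn; lia.
by move=> ecc'; rewrite -ecc' in ltk; lia.
Qed.

(** Such a number has no predecessor [p - d]. *)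
Lemma early_startP p : 0 < p <= d -> p < N -> p \in starts.
Proof.
move=> pd ltN; have [|c [[|k] [cO ltk ep]]] := @oriented_cover p; first by lia.
  by rewrite ep mul0n addn0 map_f.
have := oriented_range cO (oriented_len cO); move: ep; rewrite mulSn; lia.
Qed.

Lemma start_range x : x \in starts -> 0 < x < N.
Proof.
case/mapP=> c cO ->; have := oriented_range cO (oriented_len cO).
by rewrite mul0n addn0.
Qed.

Lemma late_startP x : x \in late_starts -> d < x < N /\ x \in starts.
Proof.
by rewrite mem_filter => /andP[-> /[dup] /start_range/andP[_ ->]].
Qed.

Lemma late_starts_uniq : uniq late_starts.
Proof. exact/filter_uniq/starts_uniq. Qed.

(** The residue class is cut between [x - d] and [x], hence the mirror class is
    cut between [N - x] and [N + d - x]. *)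
Lemma late_starts_sym x : x \in late_starts -> N + d - x \in late_starts.
Proof.
move=> /late_startP[xd /mapP[c cO ex]].
rewrite mem_filter; apply/andP; split; first by lia.
have [|c' [k [c'O ltk ek]]] := @oriented_cover (x - d); first by lia.
have [lastk|ltk'] : k = (len c').-1 \/ k.+1 < len c' by lia.
  have -> : N + d - x = start (flip c').
    move: ek xd (oriented_mirror c'O).
    by rewrite -lastk -[start (flip _)]/(costart c'); clear; lia.
  exact/map_f/oriented_flip.
have [] := oriented_inj c'O cO ltk' (oriented_len cO) (k' := 0); last by [].
by rewrite mulSn; lia.
Qed.

Section LateStarts.
Hypothesis d_ltN : d < N.

Lemma perm_starts : perm_eq starts (iota 1 d ++ late_starts).
Proof.
rewrite -(perm_filterC (fun x => d < x) starts) perm_catC perm_cat2r.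
apply: uniq_perm; [exact/filter_uniq/starts_uniq | exact: iota_uniq |] => x.
rewrite mem_iota mem_filter /= -leqNgt.
apply/andP/idP => [[xd /start_range]|xd]; first by lia.
by split; [lia | apply: early_startP; lia].
Qed.

Lemma size_late_starts : size late_starts + d = 2 * size C.
Proof.
have := perm_size perm_starts.
by rewrite size_map size_oriented size_cat size_iota addnC => ->.
Qed.

Lemma sum_late_starts : 2 * \sum_(x <- late_starts) x + d * d.+1 = 4 * (N + d).
Proof.
have := sum_starts; rewrite (perm_big _ perm_starts) big_cat /=.
have : 2 * \sum_(x <- iota 1 d) x = d * d.+1.
  rewrite -sum_labels -[in iota _ _](addn0 1) iotaDl big_map.
  by rewrite -{1}(subn0 d) -/(index_iota 0 d) big_mkord.
lia.
Qed.

End LateStarts.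

(** ** Lengths of the chains *)

Variables n0 r0 : nat.
Hypothesis r0d : 0 < r0 <= d.
Hypothesis NE : N = n0 * d + r0.

Local Notation class_len := (class_len n0 r0).
Local Notation class_mirror := (class_mirror d r0).
Local Notation class_offset := (class_offset d r0).

Lemma last_len c p t : c \in O -> 0 < p <= d -> start c = p + t * d ->
    (forall u, t < u -> p + u * d \notin late_starts) ->
  len c + t = class_len p.
Proof.
move=> cO pd ec nl; have lc := oriented_len cO.
have -> : len c + t = (t + (len c).-1).+1 by lia.
apply: (class_lenE r0d NE) => //.
  have := @oriented_range c (len c).-1 cO ltac:(lia).
  by rewrite ec mulnDl addnA => /andP[].
rewrite leqNgt; apply/negP => ltN.
have eN : p + (t + (len c).-1).+1 * d = start c + len c * d.
  by rewrite -addnS prednK // ec mulnDl addnA.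
have := oriented_end cO; rewrite -eN => /(_ ltN) inS.
have /negP := nl (t + (len c).-1).+1 ltac:(lia); apply.
by rewrite mem_filter inS andbT mulSn addnA ltn_addr //; lia.
Qed.

Lemma cut_len c p t u : c \in O -> 0 < p <= d -> start c = p + t * d -> t < u ->
    p + u * d \in late_starts ->
    (forall v, t < v < u -> p + v * d \notin late_starts) ->
  len c + t = u.
Proof.
move=> cO pd ec ltu /late_startP[luN us] nl; have lc := oriented_len cO.
have [lt|lt|//] := ltngtP (len c + t) u.
  have eN : p + (t + len c) * d = start c + len c * d by rewrite ec mulnDl
    addnA.
  have le : (t + len c) * d <= u * d by rewrite leq_mul2r; lia.
  case/negP: (nl (t + len c) ltac:(lia)).
  rewrite mem_filter eN oriented_end //; last by lia.
  by have := leq_pmull d lc; have := oriented_range cO lc; lia.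
case/negP: (@oriented_end_notin c (u - t) cO ltac:(lia)).
by rewrite ec -addnA -mulnDl (_ : t + (u - t) = u) //; lia.
Qed.

(** The length of the chain that starts at [x]. *)
Definition start_len x := nth 0 (map len O) (index x starts).

Lemma start_lenE c : c \in O -> start_len (start c) = len c.
Proof.
move=> cO; have cs : start c \in starts by apply: map_f.
have lti : index (start c) starts < size O by rewrite -(size_map start)
  index_mem.
rewrite /start_len (nth_map c) //; congr len; apply: start_inj => //.
  exact: mem_nth.
by rewrite -(nth_map c 0 start) // -/starts nth_index.
Qed.

Hypothesis d_ltN : d < N.

Let early_start p : 0 < p <= d -> exists2 c, c \in O & p = start c.
Proof. by move=> pd; apply/mapP/early_startP => //; lia. Qed.

Lemma start_len_whole p : 0 < p <= d ->
  (forall u, p + u * d \notin late_starts) -> start_len p = class_len p.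
Proof.
move=> pd nl; have [c cO ec] := early_start pd.
rewrite ec start_lenE // -ec -(@last_len c p 0) ?addn0 //.
Qed.

Lemma start_len_split p t : 0 < p <= d -> p + t * d \in late_starts ->
    (forall u, p + u * d \in late_starts -> u = t) ->
  [/\ 0 < t, start_len p = t & start_len (p + t * d) + t = class_len p].
Proof.
move=> pd lt ut; have [ltN /mapP[c' c'O ec']] := late_startP lt.
have t_gt0 : 0 < t by case: (t) ltN => //; lia.
have [c cO ec] := early_start pd.
have notl u : u <> t -> p + u * d \notin late_starts.
  by move=> neq; apply/negP => /ut.
split=> //.
  rewrite {1}ec start_lenE // -(addn0 (len c)).
  by apply: (@cut_len c p 0 t) => // [|v ltv]; [rewrite addn0 | apply: notl;
    lia].
rewrite {1}ec' start_lenE //; apply: (@last_len c' p t) => // v ltv.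
by apply: notl; lia.
Qed.

Lemma perm_starts_len : perm_eq (map len C ++ map len C)
  (map start_len (iota 1 d) ++ map start_len late_starts).
Proof.
rewrite perm_sym -(map_cat start_len).
apply: perm_trans (_ : perm_eq _ (map start_len starts)) _.
  by rewrite perm_map // perm_sym perm_starts.
have -> : map start_len starts = map len O.
  by rewrite /starts -map_comp; apply/eq_in_map => c /start_lenE.
by rewrite map_cat -map_comp perm_refl.
Qed.

Section Special.

(** The classes in which the chains have to be looked at one by one. *)
Variable Sp : seq nat.
Hypothesis Sp_uniq : uniq Sp.
Hypothesis Sp_range : {in Sp, forall p, 0 < p <= d}.
Hypothesis Sp_len :
  forall p, 0 < p <= d -> p \notin Sp -> start_len p = class_len p.

Let R := [seq p <- iota 1 d | p \notin Sp].

Let perm_R : perm_eq (iota 1 d) (Sp ++ R).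
Proof.
rewrite -(perm_filterC (mem Sp)) perm_cat2r; apply: uniq_perm => // [|x].
  exact/filter_uniq/iota_uniq.
rewrite mem_filter mem_iota /=; case xSp : (x \in Sp) => //=.
by have := Sp_range xSp; lia.
Qed.

Let len_R : {in R, start_len =1 class_len}.
Proof.
move=> p; rewrite mem_filter mem_iota => /andP[pSp pd].
by apply: Sp_len => //; lia.
Qed.

(** A chain and its mirror image have the same length, whence the factor 2. The
    classes outside [Sp] are uncut, so their lengths are obtained from all the
    [class_len] by removing those of [Sp]. *)
Lemma count_lens P :
  2 * count P (map len C) + count P (map class_len Sp) =
  count P (map start_len (Sp ++ late_starts)) +
  (P n0.+1 * r0.-1 + P n0 * (d - r0).+1).
Proof.
rewrite -(count_classes r0d NE) (permP (perm_map class_len perm_R)).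
have := permP perm_starts_len P; rewrite count_cat addnn -mul2n => ->.
rewrite count_cat (permP (perm_map start_len perm_R)) !map_cat !count_cat.
have -> : map start_len R = map class_len R by apply/eq_in_map => p /len_R.
by rewrite (addnAC _ (count P (map class_len R))) -!addnA [X in _ + (_ + X) =
  _]addnC.
Qed.

(** ** Signs *)

(** The sign records which of the two mirror images of a chain starts at the
    given number. *)
Lemma signed_starts : exists2 sg : nat -> bool,
    {in O, forall c, sg (costart c) = ~~ sg (start c)} &
    (\sum_(c <- O) signed (sg (start c)) ((start c)%:Z - (costart c)%:Z) = 0)%R.
Proof.
pose sg x := x \in map start C.
have sgC c : c \in C -> sg (start c) /\ ~~ sg (costart c).
  move=> cC; split; first exact: map_f.
  have cO : c \in O by rewrite mem_cat cC.
  apply/mapP => -[c' c'C ecc'].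
  have c'O : c' \in O by rewrite mem_cat c'C.
  have efl : flip c = c' by apply: start_inj => //; apply: oriented_flip.
  have := oriented_uniq; rewrite cat_uniq => /and3P[_ /hasPn/(_ c')/= disj _].
  by case/negP: (disj ltac:(by rewrite -efl map_f)).
exists sg.
  move=> c; rewrite mem_cat => /orP[/sgC[-> /negPf->] //|/mapP[c' /sgC[s1 s2]
    ->]].
  by rewrite s1 s2.
rewrite big_cat big_map /= -big_split /= big_seq.
under eq_bigr => c cC.
  have [-> /negPf-> /=] := sgC c cC.
  rewrite opprB -[costart (flip c)]/(start c) -[start (flip c)]/(costart c).
  over.
rewrite -big_seq big_split /= sumrB.
rewrite -(big_morph Posz PoszD (erefl _)) -(big_morph Posz PoszD (erefl _)).
by rewrite (balanced_start balC) (balanced_costart balC) subrr.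
Qed.

(** [start_offset x] is [x] minus the start of the mirror image of the chain
    that starts at [x]. *)
Definition start_offset x : int :=
  ((2 * x + (start_len x).-1 * d)%N%:Z - N%:Z)%R.

Let start_offsetE c : c \in O ->
  start_offset (start c) = ((start c)%:Z - (costart c)%:Z)%R.
Proof.
move=> cO; rewrite /start_offset start_lenE //.
by have := oriented_mirror cO; lia.
Qed.

(** The starts of the chains and those of their mirror images have equal sums,
    so the signed offsets cancel ([signed_starts]), and those of the special
    classes are bounded by the total of the others. The sign at [y], the start
    of the mirror image of the chain starting at [x], is opposite to the one
    at [x]. *)
Lemma offset_bound : exists2 sg : nat -> bool,
    (forall x y, x \in starts -> x + y + (start_len x).-1 * d = N ->
      sg y = ~~ sg x) &
    (`|\sum_(x <- Sp ++ late_starts) signed (sg x) (start_offset x)| +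
     Posz (\sum_(p <- Sp) class_offset p) <=
     Posz (\sum_(p <- iota 1 d) class_offset p))%R.
Proof.
have [sg sgO sum0] := signed_starts; exists sg.
  move=> x y /mapP[c cO ->]; rewrite start_lenE // => eN.
  by rewrite -sgO //; congr sg; have := oriented_mirror cO; lia.
have : (\sum_(x <- starts) signed (sg x) (start_offset x) = 0)%R.
  rewrite big_map -[RHS]sum0; apply: eq_big_seq => c cO.
  by rewrite start_offsetE.
rewrite (perm_big _ (perm_starts d_ltN)) /= big_cat (perm_big _ perm_R) /=.
rewrite [in X in (_ <= X)%R](perm_big _ perm_R) /= !big_cat /=.
have : {in R, forall x, `|start_offset x|%R = Posz (class_offset x)}.
  move=> p pR; have lp := len_R pR; move: pR.
  rewrite mem_filter mem_iota => /andP[_ pd].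
  have [|_ _] := class_mirrorP r0d NE d_ltN (p := p); first by lia.
  by rewrite /start_offset lp /class_offset; lia.
move/norm_signed_sum => /(_ sg) leR.
rewrite PoszD [X in _ -> (X <= _)%R]addrC lerD2l addrAC => /eqP.
by rewrite addr_eq0 => /eqP ->; rewrite normrN.
Qed.

End Special.

End Structure.

(** The offsets of [K] consecutive classes around the centre of symmetry. *)
Lemma sum_centered K :
  \sum_(j < K) ((2 * j + 1 - K) + (K - (2 * j + 1))) = (K * K)./2.
Proof.
suff [] : \sum_(j < K) ((2 * j + 1 - K) + (K - (2 * j + 1))) = (K * K)./2 /\
  \sum_(j < K.+1) ((2 * j + 1 - K.+1) + (K.+1 - (2 * j + 1))) = (K.+1 *
    K.+1)./2.
  by [].
elim: K => [|K [IH1 IH2]]; first by rewrite big_ord0 big_ord1.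
split=> //; have -> : K.+2 * K.+2 = K * K + K.+1.*2.*2 by lia.
rewrite halfD odd_double andbF doubleK -IH1 big_ord_recl big_ord_recr /=.
rewrite (eq_bigr (fun j : 'I_K => (2 * j + 1 - K) + (K - (2 * j + 1)))).
  by rewrite /bump /=; lia.
by move=> j _; rewrite /bump /=; lia.
Qed.

(** The classes fall into two intervals, [p < r0] and [r0 <= p <= d], each of
    which is its own mirror image. *)
Lemma sum_class_offset d r0 : 0 < r0 <= d ->
  \sum_(p <- iota 1 d) class_offset d r0 p =
  (r0.-1 * r0.-1)./2 + ((d - r0).+1 * (d - r0).+1)./2.
Proof.
move=> r0d; have ed : d = r0.-1 + (d - r0).+1 by lia.
have shift m K : \sum_(p <- iota m K) class_offset d r0 p =
                 \sum_(j < K) class_offset d r0 (m + j).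
  by rewrite -(addn0 m) iotaDl big_map addn0 -{1}(subn0 K) -/(index_iota 0 K)
    big_mkord.
rewrite [in iota 1 d]ed iotaD big_cat !shift -!sum_centered; congr (_ + _).
  apply: eq_bigr => j _; have ltj := ltn_ord j.
  by rewrite /class_offset /class_mirror ifT; lia.
apply: eq_bigr => j _; have ltj := ltn_ord j.
by rewrite /class_offset /class_mirror ifF; lia.
Qed.

Lemma perm_of_double_count (T : eqType) (x y : seq T) :
  (forall P, 2 * count P x = 2 * count P y) -> perm_eq x y.
Proof. by move=> e; apply/permP => P; have := e P; lia. Qed.

Lemma class_inj d p p' t t' : 0 < p <= d -> 0 < p' <= d ->
  p + t * d = p' + t' * d -> p = p' /\ t = t'.
Proof.
move=> pd pd' e; suff ett : t = t' by rewrite ett in e; lia.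
have [lt|lt|//] := ltngtP t t'.
  have : t.+1 * d <= t' * d by rewrite leq_mul2r lt orbT.
  by rewrite mulSn; lia.
have : t'.+1 * d <= t * d by rewrite leq_mul2r lt orbT.
by rewrite mulSn; lia.
Qed.

(** * The lengths of the chains of a balanced system *)

Section Forward.
Variables (d : nat) (C : seq chain).
Hypothesis d_gt0 : 0 < d.
Hypothesis balC : balanced d C.
Hypothesis C_ge3 : 3 <= size C.

Let s := size C.
Let M := sumn (map len C).
Let N := modulus C.
Let E := late_starts d C.

Let leM : s <= M.
Proof.
rewrite /M sumnE big_map /s -sum1_size big_seq [leqRHS]big_seq.
by apply: leq_sum => c; apply: (balanced_len balC).
Qed.

(** If each chain is one number, every start and the start of its mirror image
    have the odd sum [N], while the total [s N] is even. *)
Lemma balanced_short : M = s -> map len C = nseq s 1 /\ ~~ odd s.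
Proof.
move=> eM; have len1 : {in C, forall c, len c = 1}.
  move=> c cC; have lc := balanced_len balC cC.
  have := perm_to_rem cC => pC.
  have : M = len c + sumn (map len (rem c C)).
    by rewrite /M !sumnE !big_map (perm_big _ pC) big_cons.
  have : size (rem c C) <= sumn (map len (rem c C)).
    rewrite sumnE big_map -sum1_size big_seq [leqRHS]big_seq.
    by apply: leq_sum => c' /mem_rem; apply: (balanced_len balC).
  rewrite size_rem //; move: eM lc C_ge3 (sumn (map len (rem c C))).
  by rewrite -/s; clear; lia.
split.
  rewrite /s -(size_map len C); apply/all_pred1P/allP => _ /mapP[c /len1 lc ->].
  by rewrite /= lc.
have : \sum_(c <- C) (start c + costart c) = \sum_(c <- C) N.
  apply: eq_big_seq => c cC; rewrite -[RHS](balanced_mirror balC cC) len1 //.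
  by rewrite mul0n addn0.
rewrite big_split /= (balanced_start balC) (balanced_costart balC).
rewrite big_const_seq count_predT iter_addn_0 -/s addnn => /(congr1 odd).
by rewrite odd_double oddM /N /modulus /= mul2n odd_double /=; case: odd.
Qed.

Hypothesis ltM : s < M.

(** Some chain contains two numbers, of difference [d]. *)
Lemma balanced_modulus_gt : d < N.
Proof.
have [/hasP[c cC lc]|/hasPn lens] := boolP (has (fun c => 1 < len c) C).
  have := oriented_range d_gt0 balC (k := 1) _ lc;
    rewrite mem_cat cC => /(_ isT).
  by rewrite -/N; lia.
have : M <= s; last by lia.
rewrite /M sumnE big_map /s -sum1_size big_seq [leqRHS]big_seq.
by apply: leq_sum => c /lens; lia.
Qed.

Let dN := balanced_modulus_gt.

(** From [modulus_eq], [d (M + 2 - s) = (s - 2) (2 M + 1)], and [q] is what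
    remains of [d] after subtracting [2 (s - 2)]; it is at most 4 because the
    [d] early starts are among the [2 s] starts. *)
Lemma balanced_cases : exists q,
  [/\ 0 < q, d + 4 = 2 * s + q, size E + q = 4 &
      q * (M + 2 - s) = (s - 2) * (2 * s - 3)].
Proof.
have szE := size_late_starts d_gt0 balC dN; rewrite -/E -/s in szE.
have eq0 := modulus_eq d_gt0 balC; rewrite -/M -/s /modulus -/M in eq0.
have {}eq0 : (M + 2 - s) * d = (s - 2) * (2 * M).+1.
  by rewrite [RHS]mulnBl -eq0 addKn.
have eqA : (M + 2 - s) * d =
    (M + 2 - s) * (2 * (s - 2)) + (s - 2) * (2 * s - 3).
  rewrite eq0 [X in _ = X + _]mulnA [X in _ = X + _]mulnC -mulnDr.
  by congr (_ * _); move: C_ge3; rewrite -/s; lia.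
have pos : 0 < (s - 2) * (2 * s - 3).
  by rewrite muln_gt0; move: C_ge3; rewrite -/s; lia.
have lt : 2 * (s - 2) < d.
  by rewrite -(ltn_pmul2l (_ : 0 < M + 2 - s)) ?eqA; [lia | move: C_ge3;
    rewrite -/s; lia].
exists (d - 2 * (s - 2)); split; first by lia.
- by move: C_ge3; rewrite -/s; lia.
- by move: C_ge3; rewrite -/s; lia.
by rewrite mulnC mulnBr eqA; lia.
Qed.

End Forward.

(** ** No late start, or one *)

Section ForwardCases.
Variables (d : nat) (C : seq chain).
Hypothesis d_gt0 : 0 < d.
Hypothesis balC : balanced d C.
Hypothesis d_ltN : d < modulus C.

(** All classes are uncut, and those of [1, ..., 2 l] are longer by one. *)
Lemma late_none l : d = 8 * l + 4 -> modulus C = 2 * l * d + (2 * l + 1) ->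
    late_starts d C = [::] ->
  perm_eq (map len C) (nseq (3 * l + 2) (2 * l) ++ nseq l (2 * l + 1)).
Proof.
move=> dE NE lateE; apply: perm_of_double_count => P.
have r0d : 0 < 2 * l + 1 <= d by lia.
have := count_lens d_gt0 balC r0d NE d_ltN (Sp := [::]) isT.
have whole p : 0 < p <= d -> p \notin [::] ->
    start_len C p = class_len (2 * l) (2 * l + 1) p.
  move=> pd _; apply: (start_len_whole d_gt0 balC r0d NE d_ltN pd) => u.
  by rewrite lateE.
have none : {in [::], forall p : nat, 0 < p <= d} by [].
move=> /(_ none whole P); rewrite lateE /= !addn0 add0n => ->.
rewrite count_cat !count_nseq [P _.+1](_ : _ = P (2 * l + 1)) ?addn1 //.
have -> : (d - (2 * l).+1).+1 = 2 * (3 * l + 2) by lia.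
rewrite /=; lia.
Qed.

(** The multiples of [d] are the self-mirrored class; the late start cuts it
    into two halves, and all other classes have the same length. *)
Lemma late_one_middle l : 2 <= l -> d = 6 * l - 1 ->
    modulus C = (2 * l - 2) * d + d -> late_starts d C = [:: l * d] ->
  perm_eq (map len C) (l.-1 :: nseq (3 * l - 1) (2 * l - 1)).
Proof.
move=> l_ge2 dE NE lateE; apply: perm_of_double_count => P.
have r0d : 0 < d <= d by lia.
have zE : l * d = d + l.-1 * d by rewrite -mulSn prednK //; lia.
have [|u|_ lend lenz] := start_len_split d_gt0 balC r0d NE d_ltN r0d (t :=
  l.-1).
- by rewrite lateE -zE mem_head.
- by rewrite lateE inE zE => /eqP/(class_inj r0d r0d)[].
have whole p : 0 < p <= d -> p \notin [:: d] ->
    start_len C p = class_len (2 * l - 2) d p.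
  rewrite inE => pd neq;
    apply: (start_len_whole d_gt0 balC r0d NE d_ltN pd) => u.
  rewrite lateE inE zE; apply/eqP => /(class_inj pd r0d)[ep _].
  by rewrite ep eqxx in neq.
have range : {in [:: d], forall p : nat, 0 < p <= d}.
  by move=> p; rewrite inE => /eqP ->.
have := count_lens d_gt0 balC r0d NE d_ltN (Sp := [:: d]) isT range whole P.
rewrite lateE /= lend -zE in lenz *.
have -> : start_len C (l * d) = l.-1.
  by move: lenz; rewrite /class_len ltnn; lia.
rewrite count_nseq /class_len ltnn addn0 subnn.
have -> : (2 * l - 2).+1 = 2 * l - 1 by lia.
have -> : d.-1 = 2 * (3 * l - 1) by lia.
lia.
Qed.

(** Again the self-mirrored class, here that of [4 l + 2], is cut into halves.
    Their offset [l d] must be balanced by the remaining classes, whose offsets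
    sum to about [5 l^2] only, and this bounds [l]. *)
Lemma late_one_even l : 1 <= l -> d = 6 * l + 3 ->
    modulus C = 2 * l * d + (2 * l + 1) ->
    late_starts d C = [:: l * d + (4 * l + 2)] ->
  l <= 3 /\
  perm_eq (map len C) (l :: nseq (2 * l + 1) (2 * l) ++ nseq l (2 * l + 1)).
Proof.
move=> l_ge1 dE NE lateE.
set p0 := 4 * l + 2 in lateE; rewrite addnC in lateE.
have r0d : 0 < 2 * l + 1 <= d by lia.
have p0d : 0 < p0 <= d by lia.
have [|u|_ lenp lenz] := start_len_split d_gt0 balC r0d NE d_ltN p0d (t := l).
- by rewrite lateE mem_head.
- by rewrite lateE inE => /eqP/(class_inj p0d p0d)[].
have whole p : 0 < p <= d -> p \notin [:: p0] ->
    start_len C p = class_len (2 * l) (2 * l + 1) p.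
  rewrite inE => pd neq;
    apply: (start_len_whole d_gt0 balC r0d NE d_ltN pd) => u.
  rewrite lateE inE; apply/eqP => /(class_inj pd p0d)[ep _].
  by rewrite ep eqxx in neq.
have range : {in [:: p0], forall p : nat, 0 < p <= d}.
  by move=> p; rewrite inE => /eqP ->.
have lenp0 : class_len (2 * l) (2 * l + 1) p0 = 2 * l.
  by rewrite /class_len; lia.
have {}lenz : start_len C (p0 + l * d) = l by rewrite lenp0 in lenz; lia.
split; last first.
  apply: perm_of_double_count => P.
  have := count_lens d_gt0 balC r0d NE d_ltN (Sp := [:: p0]) isT range whole P.
  rewrite lateE /= lenp lenz lenp0 count_cat !count_nseq.
  have -> : (2 * l).+1 = 2 * l + 1 by lia.
  have -> : (d - (2 * l + 1)).+1 = 2 * (2 * l + 1) + 1 by lia.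
  have -> : (2 * l + 1).-1 = 2 * l by lia.
  by case: (P _); case: (P _); lia.
have [sg sgP] := offset_bound d_gt0 balC r0d NE d_ltN (Sp := [:: p0]) isT range
  whole.
rewrite sum_class_offset // lateE cat1s !big_cons !big_nil.
have p0s : p0 \in starts C.
  by apply: (early_startP d_gt0 balC) => //; lia.
have := sgP p0 (p0 + l * d) p0s; rewrite lenp NE => -> //; last first.
  have : l * d = d + l.-1 * d by rewrite -mulSn prednK.
  rewrite /p0; lia.
rewrite /start_offset lenp lenz NE /class_offset /class_mirror ifF; last by lia.
have -> : (2 * l + 1).-1 = 2 * l by lia.
have -> : (d - (2 * l + 1)).+1 = 4 * l + 3 by lia.
have -> : 2 * l * (2 * l) = (2 * (l * l)).*2 by lia.
have -> : (4 * l + 3) * (4 * l + 3) = (8 * (l * l) + 12 * l + 4).*2.+1 by lia.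
rewrite doubleK /= uphalf_double.
have : l * d = d + l.-1 * d by rewrite -mulSn prednK.
have : l * d = 6 * (l * l) + 3 * l by rewrite dE; lia.
have : l <= 3 \/ 4 * l <= l * l by nia.
by rewrite /p0 /signed; case: (sg _); case => //=; lia.
Qed.

End ForwardCases.

(** ** A class and its mirror class, cut at mirror places *)

Section LatePair.
Variables (d : nat) (C : seq chain).
Hypothesis d_gt0 : 0 < d.
Hypothesis balC : balanced d C.
Hypothesis d_ltN : d < modulus C.
Variables n0 r0 : nat.
Hypothesis r0d : 0 < r0 <= d.
Hypothesis NE : modulus C = n0 * d + r0.
Variables (z1 z2 : nat) (Z : seq nat).
Hypothesis lateE : late_starts d C =i [:: z1, z2 & Z].
Hypothesis z12 : z1 + z2 = modulus C + d.

(** The representative in [1, ..., d] of the residue class of [z]. *)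
Definition first_of_class z := (z.-1 %% d).+1.

Let p1 := first_of_class z1.
Let p2 := class_mirror d r0 p1.
Let t := z1.-1 %/ d.
Let n := class_len n0 r0 p1.

Hypothesis p12 : p1 != p2.
Hypothesis Z1 : forall u, p1 + u * d \notin Z.
Hypothesis Z2 : forall u, p2 + u * d \notin Z.

(** The cut at [z1] splits its class of [n] numbers into [t] and [n - t]; the
    cut at [z2 = N + d - z1] splits the mirror class in the reverse order. *)
Lemma late_pair :
  [/\ 0 < p1 <= d, 0 < p2 <= d, 0 < t < n, z1 = p1 + t * d & z2 = p2 + (n - t)
    * d] /\
  [/\ start_len C p1 = t, start_len C p2 = n - t,
      start_len C z1 = n - t & start_len C z2 = t].
Proof.
have p1d : 0 < p1 <= d.
  by have := ltn_pmod z1.-1 d_gt0; rewrite /p1 /first_of_class; lia.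
have [p2d np2 eN] := class_mirrorP r0d NE d_ltN p1d.
rewrite -/p2 -/n in p2d np2 eN.
have z1l : z1 \in late_starts d C by rewrite lateE mem_head.
have z2l : z2 \in late_starts d C by rewrite lateE !inE eqxx orbT.
have [z1r _] := late_startP d_gt0 balC z1l.
have [z2r _] := late_startP d_gt0 balC z2l.
have z1E : z1 = p1 + t * d.
  by have := divn_eq z1.-1 d; rewrite /p1 /t /first_of_class; lia.
have n_gt0 : 0 < n.
  rewrite /n /class_len; move: d_ltN; rewrite NE; case: (n0) => // ; lia.
have len : t <= n.
  rewrite leqNgt; apply/negP => ltn.
  have : n.-1.+2 * d <= t * d by rewrite leq_mul2r; lia.
  by rewrite !mulSn; lia.
have z2E : z2 = p2 + (n - t) * d.
  have : n * d = d + n.-1 * d by rewrite -mulSn prednK.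
  have : n * d = (n - t) * d + t * d by rewrite -mulnDl subnK.
  by lia.
have [||t_gt0 lp1 lz1] := start_len_split d_gt0 balC r0d NE d_ltN p1d (t := t).
- by rewrite -z1E.
- move=> u; rewrite lateE !inE (negPf (Z1 u)) orbF => /orP[]/eqP.
    by rewrite z1E => /(class_inj p1d p1d)[].
  by rewrite z2E => /(class_inj p1d p2d)[/eqP]; rewrite (negPf p12).
have [||nt_gt0 lp2 lz2] := start_len_split d_gt0 balC r0d NE d_ltN p2d (t := n
  - t).
- by rewrite -z2E.
- move=> u; rewrite lateE !inE (negPf (Z2 u)) orbF => /orP[]/eqP.
    by rewrite z1E => /(class_inj p2d p1d)[/esym/eqP]; rewrite (negPf p12).
  by rewrite z2E => /(class_inj p2d p2d)[].
by rewrite -/n -z1E np2 -z2E in lz1 lz2; split; split => //; lia.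
Qed.

(** [om] is the offset of the class before it is cut. *)
Lemma late_pair_offsets : let om := (p1%:Z - p2%:Z)%R in
  [/\ start_offset d C p1 = (om - ((n - t) * d)%N%:Z)%R,
      start_offset d C z2 = (((n - t) * d)%N%:Z - om)%R,
      start_offset d C z1 = (om + (t * d)%N%:Z)%R,
      start_offset d C p2 = (- om - (t * d)%N%:Z)%R &
      class_offset d r0 p1 = `|om|%N /\ class_offset d r0 p2 = `|om|%N].
Proof.
have [[p1d p2d tn z1E z2E] [lp1 lp2 lz1 lz2]] := late_pair.
have [_ _ eN] := class_mirrorP r0d NE d_ltN p1d.
rewrite -/p2 -/n in eN.
have nd : n.-1 * d = (n - t).-1 * d + t * d by rewrite -mulnDl; congr (_ * _);
  lia.
have td : t * d = d + t.-1 * d by rewrite -mulSn prednK //; lia.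
have ntd : (n - t) * d = d + (n - t).-1 * d by rewrite -mulSn prednK //; lia.
rewrite /start_offset lp1 lp2 lz1 lz2 -eN.
have mp2 : class_mirror d r0 p2 = p1.
  rewrite /p2 /class_mirror; case: (ltnP p1 r0) => lt.
    by rewrite ifT; lia.
  by rewrite ifF; lia.
rewrite /class_offset mp2 -/p2.
split; try lia.
Qed.

End LatePair.

(** Up to sign the sum is [2 (2 om + T - U)] if the two signs agree and
    [2 (T + U)] if they do not, and [T + U] is at least the distance of [T] and
    [U]. *)
Lemma signed_pair_bound b1 b2 (om : int) (T U R : nat) :
    (`|signed b1 (om - U%:Z) + (signed (~~ b2) (- om - T%:Z) +
       (signed b2 (om + T%:Z) + (signed (~~ b1) (U%:Z - om) + 0)))| +
     (`|om| + (`|om| + 0))%N%:Z <= R%:Z)%R ->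
  2 * ((T - U) + (U - T)) <= R + 2 * `|om|.
Proof. by case: b1; case: b2; rewrite /=; lia. Qed.

(** ** Two late starts *)

Section LateTwo.
Variables (d : nat) (C : seq chain).
Hypothesis d_gt0 : 0 < d.
Hypothesis balC : balanced d C.
Hypothesis d_ltN : d < modulus C.

(** The late starts are mirror images of each other, so a class and its mirror
    class are cut; the two cases are those of a class of the first kind, with
    [p1 < r0], and of the second kind.  The two parts of the class may be
    exchanged, and [T] below is the longer one. *)
Lemma late_two l z1 z2 : 2 <= l -> d = 4 * l - 2 ->
    modulus C = (2 * l - 2) * d + (2 * l - 1) ->
    late_starts d C = [:: z1; z2] -> z1 + z2 = modulus C + d ->
  (exists t, [/\ l <= t, 4 * t + 2 <= 5 * l &
     perm_eq (map len C) ([:: 2 * l - 1 - t; t] ++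
       nseq l (2 * l - 2) ++ nseq (l - 2) (2 * l - 1))]) \/
  (exists t, [/\ l <= t, 4 * t <= 5 * l &
     perm_eq (map len C) ([:: 2 * l - 1 - t; t - 1] ++
       nseq (l - 1) (2 * l - 2) ++ nseq (l - 1) (2 * l - 1))]).
Proof.
move=> l_ge2 dE NE lateE z12.
have r0d : 0 < 2 * l - 1 <= d by lia.
set p1 := first_of_class d z1; set p2 := class_mirror d (2 * l - 1) p1.
have p1d : 0 < p1 <= d.
  by have := ltn_pmod z1.-1 d_gt0; rewrite /p1 /first_of_class; lia.
have p12 : p1 != p2.
  by rewrite /p2 /class_mirror; case: ifP => _; apply/eqP; lia.
have noZ p u : p + u * d \notin [::] by rewrite in_nil.
have lateP : late_starts d C =i [:: z1; z2] by move=> x; rewrite lateE.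
have [] := late_pair d_gt0 balC d_ltN r0d NE lateP z12 p12 (noZ p1) (noZ p2).
have := late_pair_offsets d_gt0 balC d_ltN r0d NE lateP z12 p12 (noZ p1) (noZ
  p2).
rewrite -/p1 -/p2 /=.
set n := class_len (2 * l - 2) (2 * l - 1) p1; set t := z1.-1 %/ d.
set om := (p1%:Z - p2%:Z)%R.
move=> [op1 oz2 oz1 op2 [co1 co2]] [_ p2d tn z1E z2E] [lp1 lp2 lz1 lz2].
have [_ np2 eN] := class_mirrorP r0d NE d_ltN p1d.
rewrite -/p2 -/n in np2 eN.
have uniqSp : uniq [:: p1; p2] by rewrite /= inE p12.
have rangeSp : {in [:: p1; p2], forall p, 0 < p <= d}.
  by move=> p; rewrite !inE => /orP[]/eqP->.
have whole p : 0 < p <= d -> p \notin [:: p1; p2] ->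
    start_len C p = class_len (2 * l - 2) (2 * l - 1) p.
  rewrite !inE negb_or => pd /andP[neq1 neq2].
  apply: (start_len_whole d_gt0 balC r0d NE d_ltN pd) => u.
  rewrite lateE !inE z1E z2E negb_or; apply/andP; split; apply/eqP.
    by move/(class_inj pd p1d) => [/eqP]; rewrite (negPf neq1).
  by move/(class_inj pd p2d) => [/eqP]; rewrite (negPf neq2).
have counts P := count_lens d_gt0 balC r0d NE d_ltN uniqSp rangeSp whole P.
have p1class : n = 2 * l - 1 /\ p1 + p2 = 2 * l - 1 \/
               n = 2 * l - 2 /\ p1 + p2 = 6 * l - 3.
  by rewrite /n /p2 /class_mirror /class_len; case: (ltnP p1) => lt;
    [left|right]; move: lt p1d dE l_ge2; clear; lia.
pose X := (2 * t - n) + (n - 2 * t).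
have bound : 2 * X <= l.
  have [sg sgP] := offset_bound d_gt0 balC r0d NE d_ltN uniqSp rangeSp whole.
  rewrite sum_class_offset // lateE [[:: p1; p2] ++ _]/= !big_cons !big_nil.
  have p1s : p1 \in starts C.
    by apply: (early_startP d_gt0 balC) => //; move: p1d d_ltN; clear; lia.
  have [_ z1s] : d < z1 < modulus C /\ z1 \in starts C.
    by apply: (late_startP d_gt0 balC); rewrite lateE mem_head.
  have td : t * d = d + t.-1 * d by rewrite -mulSn prednK //; move: tn; clear;
    lia.
  have ntd : (n - t) * d = d + (n - t).-1 * d by rewrite -mulSn prednK //;
    move: tn; clear; lia.
  have -> : sg z2 = ~~ sg p1.
    by apply: (sgP p1); rewrite // lp1; move: z12 z1E td; clear; lia.
  have -> : sg p2 = ~~ sg z1.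
    by apply: (sgP z1); rewrite // lz1; move: z12 z2E ntd; clear; lia.
  rewrite op1 op2 oz1 oz2 co1 co2.
  have -> : (2 * l - 1).-1 * (2 * l - 1).-1 = (2 * ((l - 1) * (l - 1))).*2.
    have -> : (2 * l - 1).-1 = 2 * (l - 1) by clear; lia.
    by rewrite -mul2n; clear; lia.
  have -> : (d - (2 * l - 1)).+1 * (d - (2 * l - 1)).+1 = (2 * (l * l)).*2.
    have -> : (d - (2 * l - 1)).+1 = 2 * l by rewrite dE; move: l_ge2; clear;
      lia.
    by rewrite -mul2n; clear; lia.
  rewrite !doubleK => /signed_pair_bound le; rewrite leqNgt; apply/negP => ltX.
  have Xd : l.+1 * d <= 2 * (X * d) by rewrite mulnA leq_mul2r ltX orbT.
  have XE : X * d = (t * d - (n - t) * d) + ((n - t) * d - t * d).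
    by rewrite -!mulnBl -mulnDl /X; congr (_ * _); move: tn; clear; lia.
  have ld : l.+1 * d = 4 * (l * l) + 2 * l - 2 by rewrite dE; clear; lia.
  have l2 : 2 * l <= l * l by rewrite leq_mul2r l_ge2 orbT.
  have l12 : (l - 1) * (l - 1) = l * l + 1 - 2 * l.
    by move: l_ge2; clear; nia.
  have om_le : `|om| <= 2 * l - 1 by rewrite /om;
    move: p1class dE p1d p2d l_ge2; clear; lia.
  move: le Xd; rewrite -XE ld l12; move: om_le l2 l_ge2; clear; lia.
have {}counts P : 2 * count P (map len C) + 2 * P n = 2 * (P t + P (n - t)) +
    (P (2 * l - 1) * (2 * (l - 1)) + P (2 * l - 2) * (2 * l)).
  have := counts P; rewrite lateE /= lp1 lp2 lz1 lz2 np2 -/n.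
  have -> : (2 * l - 2).+1 = 2 * l - 1 by move: l_ge2; clear; lia.
  have -> : (2 * l - 1).-1 = 2 * (l - 1) by clear; lia.
  have -> : (d - (2 * l - 1)).+1 = 2 * l by rewrite dE; move: l_ge2; clear; lia.
  by clear; lia.
have [T [Tl Tn TX TP]] : exists T, [/\ n - t <= T, T < n, 2 * T = n + X &
    forall P : pred nat, P t + P (n - t) = P (n - T) + P T].
  case: (leqP (n - t) t) => [le|lt].
    by exists t; split=> //; rewrite /X; move: le tn; clear; lia.
  exists (n - t); split=> //; rewrite /X; try by move: lt tn; clear; lia.
  by move=> P; rewrite subKn //; move: tn; clear; lia.
case: p1class => -[nE _].
  left; exists T; split; try by move: TX bound nE l_ge2; clear; lia.
  apply: perm_of_double_count => P; have := counts P.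
  rewrite TP nE [count P ([:: _; _] ++ _)]/= !count_cat !count_nseq.
  move: (count P _) (P T : nat) (P (_ - T) : nat) l_ge2 => c b b'; clear.
  by case: (P (2 * l - 1)); case: (P (2 * l - 2)); rewrite ?mul1n ?mul0n; lia.
right; exists T.+1; split; try by move: TX bound nE l_ge2; clear; lia.
apply: perm_of_double_count => P; have := counts P.
have -> : 2 * l - 1 - T.+1 = n - T by rewrite nE; move: l_ge2; clear; lia.
rewrite TP nE (_ : T.+1 - 1 = T) ?subn1 // [count P ([:: _;
  _] ++ _)]/= !count_cat !count_nseq.
move: (count P _) (P T : nat) (P (_ - T) : nat) l_ge2 => c b b'; clear.
by case: (P (2 * l - 1)); case: (P (2 * l - 2)); rewrite ?mul1n ?mul0n; lia.
Qed.

End LateTwo.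

(** ** Three late starts *)

(** [V] comes from the two halves of the self-mirrored class, and [T], [U] from
    the cut class as in [signed_pair_bound].  If the signs of [T] and [U] differ
    then [T + U] has to be balanced by [V]; otherwise the distance of [T] and
    [U] has to be close to [V]. *)
Lemma signed_triple_bound b1 b2 b3 (om : int) (T U V R : nat) :
    (`|signed b1 (om - U%:Z) + (signed (~~ b2) (- om - T%:Z) +
       (signed b3 (- V%:Z) + (signed b2 (om + T%:Z) +
       (signed (~~ b1) (U%:Z - om) + (signed (~~ b3) V%:Z + 0)))))| +
     (`|om| + (`|om| + (0 + 0)))%N%:Z <= R%:Z)%R ->
  2 * (T + U) <= R + 2 * V \/
  let W := (T - U) + (U - T) in 2 * ((W - V) + (V - W)) <= R + 2 * `|om|.
Proof.
rewrite -lerBrDr ler_norml => /andP[le1 le2].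
have [w om_w ->] : exists2 w : nat, om = Posz w \/ om = (- Posz w)%R & `|om| =
  w.
  by exists `|om|; clear; lia.
case: (eqVneq b1 b2) => [eb|neb].
  right; rewrite /=; set W := (T - U) + (U - T).
  have [WT|WT] : (T = U + W)%N \/ (U = T + W)%N by rewrite /W; clear; lia.
    rewrite WT in le1 le2 *; clear WT; subst b2.
    have [?|?] := leqP W V;
      [rewrite (_ : W - V = 0) | rewrite (_ : V - W = 0)]; try lia;
    move: le1 le2; case: b1; case: b3; case: om_w => -> /=; lia.
  rewrite WT in le1 le2 *; clear WT; subst b2.
  have [?|?] := leqP W V; [rewrite (_ : W - V = 0) | rewrite (_ : V - W = 0)];
    try lia;
  move: le1 le2; case: b1; case: b3; case: om_w => -> /=; lia.
left; move: le1 le2 neb; case: b1; case: b2; case: b3; case: om_w => -> //=;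
  lia.
Qed.

(** Three bridges: the sum must vanish.  As [T], [U] and the middle offset are
    multiples of 3 while [om] is not, [om - U] and [om + T] must have opposite
    signs; but then [T + U = 9] is left, against the middle offset 3. *)
Lemma signed_triple_small b1 b2 b3 (om : int) (T U : nat) :
    `|om| = 1 -> T = 3 /\ U = 6 \/ T = 6 /\ U = 3 ->
  (`|signed b1 (om - U%:Z) + (signed (~~ b2) (- om - T%:Z) +
       (signed b3 (- 3%:Z) + (signed b2 (om + T%:Z) +
       (signed (~~ b1) (U%:Z - om) + (signed (~~ b3) 3%:Z + 0)))))| +
     (`|om| + (`|om| + (0 + 0)))%N%:Z <= 2%:Z)%R -> False.
Proof.
move=> om1; have {om1} [->|->] : om = 1%R \/ om = (- 1)%R by lia.
  by case=> -[-> ->]; case: b1; case: b2; case: b3.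
by case=> -[-> ->]; case: b1; case: b2; case: b3.
Qed.

(** A reflection of a set of three points fixes one point and exchanges the
    others. *)
Lemma sym_triple S (x : seq nat) : size x = 3 -> uniq x ->
    {in x, forall z, z < S} -> {in x, forall z, S - z \in x} ->
  exists z1 z2 z3, [/\ perm_eq x [:: z1; z2;
    z3], z1 + z2 = S, z3 + z3 = S & z1 < z3].
Proof.
case: x => [|x1 [|x2 [|x3 []]]] // _ Ux lt sym.
have := sym x1; have := sym x2; have := sym x3.
have := lt x1; have := lt x2; have := lt x3; clear lt sym.
move: Ux; rewrite /= !inE !eqxx !orbT /= negb_or => /andP[/andP[n12 n13]
  /andP[n23 _]].
move=> /(_ isT) lt3 /(_ isT) lt2 /(_ isT) lt1 /(_ isT) s3 /(_ isT) s2 /(_ isT)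
  s1.
have perms y1 y2 y3 : y1 + y2 = S -> y3 + y3 = S -> y1 != y3 ->
    perm_eq [:: x1; x2; x3] [:: y1; y2; y3] ->
  exists z1 z2 z3, [/\ perm_eq [:: x1; x2; x3] [:: z1; z2; z3],
    z1 + z2 = S, z3 + z3 = S & z1 < z3].
  move=> e12 e3 ne pm; have [lt|le] := ltnP y1 y3; first by exists y1, y2, y3.
  exists y2, y1, y3; split=> //; [|by lia|by lia].
  by apply: perm_trans pm _; rewrite (perm_catCA [:: y1] [:: y2] [:: y3]).
have [e3|[e2|e1]] : x3 + x3 = S /\ x1 + x2 = S \/
    (x2 + x2 = S /\ x1 + x3 = S \/ x1 + x1 = S /\ x2 + x3 = S).
  case/or3P: s1 => /eqP e1; case/or3P: s2 => /eqP e2;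
    move: lt1 lt2 lt3 n12 n13 n23 s3 e1 e2; clear; lia.
- by apply: (perms x1 x2 x3); rewrite ?perm_refl //; lia.
- apply: (perms x1 x3 x2); try lia.
  by rewrite perm_cons (perm_catC [:: x2] [:: x3]).
apply: (perms x2 x3 x1); try lia.
by rewrite (perm_catC [:: x1] [:: x2; x3]).
Qed.

Section LateThree.
Variables (d : nat) (C : seq chain).
Hypothesis d_gt0 : 0 < d.
Hypothesis balC : balanced d C.
Hypothesis d_ltN : d < modulus C.
Variable k : nat.
Hypothesis k_gt0 : 0 < k.
Hypothesis dE : d = 2 * k + 1.
Hypothesis NE : modulus C = 2 * k * d + d.

Let r0d : 0 < d <= d.
Proof. by rewrite leqnn d_gt0. Qed.

Variables z1 z2 z3 : nat.
Hypothesis lateP : perm_eq (late_starts d C) [:: z1; z2; z3].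
Hypothesis z12 : z1 + z2 = modulus C + d.
Hypothesis z3E : z3 + z3 = modulus C + d.
Hypothesis lt13 : z1 < z3.

Let mem_late : late_starts d C =i [:: z1; z2; z3].
Proof. exact: perm_mem. Qed.

Let p1 := first_of_class d z1.
Let p2 := class_mirror d d p1.
Let t := z1.-1 %/ d.

Let z1E : z1 = p1 + t * d.
Proof.
have : z1 \in late_starts d C by rewrite mem_late mem_head.
move=> /(late_startP d_gt0 balC)[lt _].
by have := divn_eq z1.-1 d; rewrite /p1 /t /first_of_class; lia.
Qed.

Let p1d : 0 < p1 <= d.
Proof. by have := ltn_pmod z1.-1 d_gt0; rewrite /p1 /first_of_class; lia. Qed.

Let z3k : z3 = d + k * d.
Proof. by move: z3E; rewrite NE -mulnA; lia. Qed.

Let ds : d \in starts C.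
Proof. exact: (early_startP d_gt0 balC). Qed.

Let late_s z : z \in [:: z1; z2; z3] -> d < z < modulus C /\ z \in starts C.
Proof. by rewrite -mem_late; apply: (late_startP d_gt0 balC). Qed.

(** If all three cuts were in the self-mirrored class, its four pieces would
    contribute at least [2 k d] to the balance, whatever the signs, while the
    offsets of all other classes sum to [2 k^2]. *)
Lemma middle_class_uncut : p1 <> d.
Proof.
move=> p1E; have z1e := z1E; rewrite p1E in z1e.
have [z1r z1s] : d < z1 < modulus C /\ z1 \in starts C by apply: late_s;
  rewrite mem_head.
have [z2r z2s] : d < z2 < modulus C /\ z2 \in starts C by apply: late_s;
  rewrite !inE eqxx orbT.
have [z3r z3s] : d < z3 < modulus C /\ z3 \in starts C by apply: late_s;
  rewrite !inE eqxx !orbT.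
have t_gt0 : 0 < t by move: z1r; rewrite z1e; case: (t); lia.
have ltk : t < k.
  by rewrite -(ltn_pmul2r d_gt0); move: lt13; rewrite z1e z3k; clear; lia.
have z2E : z2 = d + (2 * k - t) * d.
  move: z12; rewrite NE z1e mulnBl;
    have : t * d <= 2 * k * d by rewrite leq_mul2r; lia.
  by clear; lia.
have notl u : u != t -> u != k -> u != 2 * k - t -> d + u * d \notin
  late_starts d C.
  move=> n1 n2 n3; rewrite mem_late !inE z1e z2E z3k !eqn_add2l !eqn_pmul2r //.
  by rewrite !negb_or n1 n2 n3.
have len_d : start_len C d = t.
  have /mapP[c cO ec] := ds;
    rewrite {1}ec (start_lenE d_gt0 balC) // -[len c]addn0.
  apply: (cut_len d_gt0 balC r0d NE cO r0d (u := t)) => //.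
  - by rewrite -ec addn0.
  - by rewrite -z1e mem_late mem_head.
  by move=> v ltv; apply: notl; move: ltv ltk; clear; lia.
have len_z1 : start_len C z1 = k - t.
  have /mapP[c cO ec] := z1s; rewrite ec (start_lenE d_gt0 balC) //.
  suff : len c + t = k by lia.
  apply: (cut_len d_gt0 balC r0d NE cO r0d) => //.
  - by rewrite -ec z1e.
  - by rewrite -z3k mem_late !inE eqxx !orbT.
  by move=> v ltv; apply: notl; move: ltv ltk; clear; lia.
have len_z3 : start_len C z3 = k - t.
  have /mapP[c cO ec] := z3s; rewrite ec (start_lenE d_gt0 balC) //.
  suff : len c + k = 2 * k - t by lia.
  apply: (cut_len d_gt0 balC r0d NE cO r0d) => //.
  - by rewrite -ec z3k.
  - by lia.
  - by rewrite -z2E mem_late !inE eqxx !orbT.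
  by move=> v ltv; apply: notl; move: ltv ltk; clear; lia.
have len_z2 : start_len C z2 = t.
  have /mapP[c cO ec] := z2s; rewrite ec (start_lenE d_gt0 balC) //.
  suff : len c + (2 * k - t) = class_len (2 * k) d d by rewrite /class_len
    ltnn; lia.
  apply: (last_len d_gt0 balC r0d NE cO r0d) => //.
  - by rewrite -ec z2E.
  by move=> v ltv; apply: notl; move: ltv ltk; clear; lia.
have whole p : 0 < p <= d -> p \notin [:: d] ->
    start_len C p = class_len (2 * k) d p.
  rewrite inE => pd neq;
    apply: (start_len_whole d_gt0 balC r0d NE d_ltN pd) => u.
  rewrite mem_late !inE z1e z2E z3k !negb_or; apply/and3P; split; apply/eqP;
    by move/(class_inj pd r0d) => [/eqP]; rewrite (negPf neq).
have range : {in [:: d], forall p : nat, 0 < p <= d}.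
  by move=> p; rewrite inE => /eqP ->.
have [sg sgP] := offset_bound d_gt0 balC r0d NE d_ltN (Sp := [:: d]) isT range
  whole.
rewrite sum_class_offset // big_cat (perm_big _ lateP) !big_cons !big_nil /=.
have kd : k * d = d + k.-1 * d by rewrite -mulSn prednK.
have td : t * d = d + t.-1 * d by rewrite -mulSn prednK.
have ktd : (k - t) * d = d + (k - t).-1 * d by rewrite -mulSn prednK; lia.
have ktd' : k * d = (k - t) * d + t * d by rewrite -mulnDl; congr (_ * _); lia.
have k2d : 2 * k * d = 2 * (k * d) by rewrite mulnA.
have k2td : (2 * k - t) * d = (k - t) * d + k * d by rewrite -mulnDl;
  congr (_ * _); lia.
have -> : sg z2 = ~~ sg d.
  apply: (sgP d) => //; rewrite len_d NE z2E; move: kd td ktd' k2d k2td;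
    clear; lia.
have -> : sg z3 = ~~ sg z1.
  apply: (sgP z1) => //; rewrite len_z1 NE z1e z3k;
    move: kd td ktd' ktd k2d k2td; clear; lia.
rewrite /start_offset len_d len_z1 len_z2 len_z3 NE z1e z2E z3k.
have -> : d.-1 * d.-1 = (2 * (k * k)).*2 by rewrite dE; clear; nia.
rewrite doubleK subnn muln1 => le.
have : k * d = 2 * (k * k) + k by rewrite dE; clear; lia.
move: le kd td ktd' ktd k2d k2td k_gt0.
move: (2 * k * d) (k * d) (t * d) ((k - t) * d) ((2 * k - t) * d).
move: (t.-1 * d) (k.-1 * d) ((k - t).-1 * d) (k * k) => x1 x2 x3 x4 x5 x6 x7 x8
  x0.
move: (class_offset _ _ _) => x9.
by case: (sg _); case: (sg _); clear; rewrite /=; lia.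
Qed.

(** The fixed late start halves the self-mirrored class, and the other two cut
    another class into [t] and [d - t].  With [X] the distance of these lengths,
    the balance forces [X] to be close to [k], which bounds the shorter length
    [T] from both sides. *)
Lemma late_three : 2 <= k /\ exists T, [/\ 2 * k + 4 <= 8 * T + 3,
    8 * T + 5 <= 6 * k + 12, T <= d &
    perm_eq (map len C) ([:: T; d - T; k] ++ nseq (k - 1) d)].
Proof.
have p1nd := middle_class_uncut.
have p1lt : p1 < d by move: p1d p1nd; clear; lia.
have p2E : p2 = d - p1 by rewrite /p2 /class_mirror p1lt.
have p12 : p1 != p2 by rewrite p2E; apply/eqP; move: p1lt dE; clear; lia.
have nZ p : 0 < p < d -> forall u, p + u * d \notin [:: z3].
  move=> pd u; rewrite inE z3k; apply/eqP => /class_inj[||ep _].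
  - by move: pd; clear; lia.
  - exact: r0d.
  by move: pd; rewrite ep ltnn andbF.
have nZ1 : forall u, p1 + u * d \notin [:: z3].
  by apply: nZ; move: p1d p1lt; clear; lia.
have nZ2 : forall u, p2 + u * d \notin [:: z3].
  by apply: nZ; rewrite p2E; move: p1d p1lt; clear; lia.
have [] := late_pair d_gt0 balC d_ltN r0d NE mem_late z12 p12 nZ1 nZ2.
have := late_pair_offsets d_gt0 balC d_ltN r0d NE mem_late z12 p12 nZ1 nZ2.
have nE : class_len (2 * k) d p1 = d by rewrite /class_len p1lt -dE.
have np2 : class_len (2 * k) d p2 = d.
  by rewrite /class_len p2E (_ : d - p1 < d = true) -?dE //; move: p1d p1lt;
    clear; lia.
rewrite -/p1 -/p2 nE -/t /=; set om := (p1%:Z - p2%:Z)%R.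
move=> [op1 oz2 oz1 op2 [co1 co2]] [_ p2d tn _ z2E] [lp1 lp2 lz1 lz2].
have [||_ ld lz3] := start_len_split d_gt0 balC r0d NE d_ltN r0d (t := k).
- by rewrite -z3k mem_late !inE eqxx !orbT.
- move=> u; rewrite mem_late !inE z1E z2E z3k => /or3P[]/eqP/class_inj[]// =>
    [e|e].
    by case: p1nd.
  by move: p1lt p1d e; rewrite p2E; clear; lia.
have {}lz3 : start_len C z3 = k.
  by move: lz3; rewrite -z3k /class_len ltnn; clear; lia.
have uniqSp : uniq [:: p1; p2; d].
  rewrite /= !inE !negb_or p12 /= andbT; apply/andP; split; apply/eqP => //.
  by rewrite p2E; move: p1d p1lt; clear; lia.
have rangeSp : {in [:: p1; p2; d], forall p, 0 < p <= d}.
  by move=> p; rewrite !inE => /or3P[]/eqP->.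
have whole p : 0 < p <= d -> p \notin [:: p1; p2; d] ->
    start_len C p = class_len (2 * k) d p.
  rewrite !inE !negb_or => pd /and3P[neq1 neq2 neq3].
  apply: (start_len_whole d_gt0 balC r0d NE d_ltN pd) => u.
  rewrite mem_late !inE z1E z2E z3k !negb_or; apply/and3P; split; apply/eqP.
  - by move/(class_inj pd p1d) => [/eqP]; rewrite (negPf neq1).
  - by move/(class_inj pd p2d) => [/eqP]; rewrite (negPf neq2).
  by move/(class_inj pd r0d) => [/eqP]; rewrite (negPf neq3).
have counts P := count_lens d_gt0 balC r0d NE d_ltN uniqSp rangeSp whole P.
have {}counts P : 2 * count P (map len C) + 2 * P d =
    2 * (P t + P (d - t) + P k) + P d * (2 * k).
  have := counts P; rewrite map_cat count_cat (permP (perm_map _ lateP)) /=.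
  rewrite lp1 lp2 lz1 lz2 ld lz3 np2 nE subnn.
  have -> : (2 * k).+1 = d by rewrite dE addn1.
  have -> : d.-1 = 2 * k by rewrite dE addn1.
  rewrite /class_len ltnn /= addn0 muln1.
  by clear; lia.
pose X := (2 * t - d) + (d - 2 * t).
have XE : X * d = (t * d - (d - t) * d) + ((d - t) * d - t * d).
  by rewrite -!mulnBl -mulnDl /X; congr (_ * _); move: tn; clear; lia.
have [k_ge2 bound] : 2 <= k /\ 2 * ((X - k) + (k - X)) <= k + 1.
  have [sg sgP] := offset_bound d_gt0 balC r0d NE d_ltN uniqSp rangeSp whole.
  rewrite sum_class_offset // (perm_big ([:: p1; p2; d] ++ [:: z1; z2; z3]));
    last by rewrite perm_cat2l.
  rewrite !big_cons !big_nil.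
  have p1s : p1 \in starts C by apply: (early_startP d_gt0 balC) => //;
    move: p1d d_ltN; clear; lia.
  have [_ z1s] : d < z1 < modulus C /\ z1 \in starts C.
    by apply: late_s; rewrite mem_head.
  have td : t * d = d + t.-1 * d by rewrite -mulSn prednK //; move: tn; clear;
    lia.
  have dtd : (d - t) * d = d + (d - t).-1 * d by rewrite -mulSn prednK //;
    move: tn; clear; lia.
  have kd : k * d = d + k.-1 * d by rewrite -mulSn prednK.
  have k2d : 2 * k * d = 2 * (k * d) by rewrite mulnA.
  have -> : sg z2 = ~~ sg p1.
    by apply: (sgP p1); rewrite // lp1; move: z12 z1E td; clear; lia.
  have -> : sg p2 = ~~ sg z1.
    by apply: (sgP z1); rewrite // lz1; move: z12 z2E dtd; clear; lia.
  have -> : sg z3 = ~~ sg d.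
    by apply: (sgP d); rewrite // ld NE z3k; move: kd k2d; clear; lia.
  have od : start_offset d C d = (- (k * d)%N%:Z)%R.
    by rewrite /start_offset ld NE; move: kd k2d; clear; lia.
  have oz3 : start_offset d C z3 = (k * d)%N%:Z%R.
    by rewrite /start_offset lz3 NE z3k; move: kd k2d; clear; lia.
  rewrite op1 op2 oz1 oz2 od oz3 co1 co2.
  have -> : class_offset d d d = 0 by rewrite /class_offset /class_mirror ltnn;
    clear; lia.
  have -> : d.-1 * d.-1 = (2 * (k * k)).*2 by rewrite dE; clear; nia.
  rewrite doubleK subnn [(1 * 1)./2]/= addn0.
  have om_le : `|om| <= 2 * k - 1 by rewrite /om p2E; move: dE p1d p1lt;
    clear; lia.
  have om_ge : 0 < `|om| by rewrite /om; move: p12; clear; lia.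
  have k2d2 : k * d = 2 * (k * k) + k by rewrite dE; clear; lia.
  move=> le; have k_ge2 : 2 <= k.
    rewrite ltnNge; apply/negP => k_le1.
    have k1 : k = 1 by move: k_le1 k_gt0; clear; lia.
    have d3 : d = 3 by rewrite dE k1.
    have tTU : t * d = 3 /\ (d - t) * d = 6 \/ t * d = 6 /\ (d - t) * d = 3.
      rewrite d3; have [->|->] : t = 1 \/ t = 2; [|by left|by right].
      by move: tn; rewrite d3; clear; lia.
    have om1 : `|om| = 1 by move: om_le om_ge; rewrite k1; clear; lia.
    apply: (signed_triple_small om1 tTU); move: le.
    by rewrite k1 d3; exact.
  split=> //; case/signed_triple_bound: le => [le|/=].
    have TU : t * d + (d - t) * d = d * d by rewrite -mulnDl; congr (_ * _);
      move: tn; clear; lia.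
    have dd : d * d = 4 * (k * k) + 4 * k + 1 by rewrite dE; clear; lia.
    exfalso; move: le; rewrite TU dd k2d2.
    have : k <= k * k by rewrite leq_pmulr.
    by clear; lia.
  rewrite -XE -!mulnBl -mulnDl => le; rewrite leqNgt; apply/negP => lt.
  have Zd : k.+2 * d <= 2 * ((X - k + (k - X)) * d).
    by rewrite mulnA leq_mul2r; apply/orP; right; move: lt; clear; lia.
  have kkd : k.+2 * d = 2 * (k * k) + 5 * k + 2 by rewrite dE; clear; lia.
  by move: Zd le om_le; rewrite kkd; clear; lia.
split=> //.
have [T [TX TP Td]] : exists T, [/\ d = X + 2 * T,
    (forall P : pred nat, P t + P (d - t) = P T + P (d - T)) & T <= d].
  case: (leqP (d - t) t) => [le|lt].
    exists (d - t); split; first by rewrite /X; move: le tn; clear; lia.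
      by move=> P; rewrite subKn 1?addnC //; move: tn; clear; lia.
    by rewrite leq_subr.
  exists t; split=> //; last by move: tn; clear; lia.
  by rewrite /X; move: lt tn; clear; lia.
exists T; split=> //.
- by move: TX bound dE; clear; lia.
- by move: TX bound dE; clear; lia.
apply: perm_of_double_count => P; have := counts P.
rewrite TP [count P ([:: _; _; _] ++ _)]/= count_nseq.
move: (count P _) (P T : nat) (P (_ - T) : nat) k_ge2 => c b b'; clear.
by case: (P d); rewrite ?mul1n ?mul0n; lia.
Qed.

End LateThree.

(** ** The possible lengths *)

Lemma perm_lens_double C L : perm_eq (map len C) L ->
  perm_eq [seq 2 * len c | c <- C] (map (muln 2) L).
Proof. by move/(perm_map (muln 2)); rewrite -map_comp. Qed.

(** With [u = s - 2] and [A = M - u] the equation is [q A = u (2 u + 1)], whose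
    divisibility conditions give the parameter [l]: [u] is [4 l] for [q = 4],
    [3 j] or [3 i + 1] for [q = 3], and even for [q = 2]. *)
Lemma balanced_lens d C (s := size C) : 0 < d -> balanced d C -> 3 <= s ->
    s < sumn (map len C) -> let a := [seq 2 * len c | c <- C] in
  (exists l, 1 <= l /\
     perm_eq a (nseq (3 * l + 2) (4 * l) ++ nseq l (4 * l + 2))) \/
  (exists l, 2 <= l /\
     perm_eq a ((2 * l - 2) :: nseq (3 * l - 1) (4 * l - 2))) \/
  perm_eq a ([:: 2] ++ nseq 3 4 ++ [:: 6]) \/
  perm_eq a ([:: 4] ++ nseq 5 8 ++ nseq 2 10) \/
  perm_eq a ([:: 6] ++ nseq 7 12 ++ nseq 3 14) \/
  (exists l t, [/\ 2 <= l, l <= t, 4 * t + 2 <= 5 * l &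
     perm_eq a ([:: 4 * l - 2 - 2 * t; 2 * t]
       ++ nseq l (4 * l - 4) ++ nseq (l - 2) (4 * l - 2))]) \/
  (exists l t, [/\ 2 <= l, l <= t, 4 * t <= 5 * l &
     perm_eq a ([:: 4 * l - 2 - 2 * t; 2 * t - 2]
       ++ nseq (l - 1) (4 * l - 4) ++ nseq (l - 1) (4 * l - 2))]) \/
  (exists t, [/\ 4 <= s, 2 * s <= 8 * t + 3, 8 * t + 5 <= 6 * s &
     perm_eq a ([:: 2 * t; 4 * s - 6 - 2 * t; 2 * s - 4]
       ++ nseq (s - 3) (4 * s - 6))]).
Proof.
move=> d_gt0 balC s_ge3 ltM a.
have d_ltN := balanced_modulus_gt d_gt0 balC s_ge3 ltM.
have [q [q_gt0 dE szE Aq]] := balanced_cases d_gt0 balC s_ge3 ltM.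
have sumE := sum_late_starts d_gt0 balC d_ltN.
have NE : modulus C = 2 * sumn (map len C) + 1 by rewrite /modulus addn1.
move: (sumn _) Aq ltM NE => M Aq ltM NE; rewrite -/s in dE Aq.
have [u [su u_gt0]] : exists u, s = u + 2 /\ 0 < u.
  by exists (s - 2); move: s_ge3; clear; lia.
have [A [MA Au]] : exists A, M = A + u /\ q * A = u * (2 * u + 1).
  exists (M - u); split; first by move: ltM; rewrite su; clear; lia.
  have -> : M - u = M + 2 - s by rewrite su; clear; lia.
  by rewrite Aq su; congr (_ * _); clear; lia.
have q_le4 : q <= 4 by move: szE; clear; lia.
case: q q_gt0 q_le4 dE szE Au {Aq} => [//|[|[|[|[|//]]]]] _ _ dE szE Au.
- (* [q = 1] *)
  right; right; right; right; right; right; right.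
  have dk : d = 2 * u + 1 by move: dE; rewrite su; clear; lia.
  have NE' : modulus C = 2 * u * d + d.
    by rewrite NE MA dk; move: Au; rewrite mul1n => ->; clear; lia.
  have := sym_triple (S := modulus C + d) _ (late_starts_uniq d_gt0 balC).
  case=> [|z /(late_startP d_gt0 balC)[lt _]||z1 [z2 [z3 [lateP z12 z3E
    lt13]]]].
  - by move: szE; clear; lia.
  - by move: lt; clear; lia.
  - exact: (late_starts_sym d_gt0 balC).
  have [u_ge2 [T [T1 T2 T3]]] :=
    late_three d_gt0 balC d_ltN u_gt0 dk NE' lateP z12 z3E lt13.
  move=> /perm_lens_double; rewrite map_cat map_nseq => perm_a.
  exists T; rewrite su; split; [move: u_ge2 | move: T1 | move: T2 |];
    try by clear; lia.
  move: perm_a; rewrite /=.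
  have -> : 2 * (d - T) = 4 * (u + 2) - 6 - 2 * T by rewrite dk; clear; lia.
  have -> : 2 * u = 2 * (u + 2) - 4 by clear; lia.
  have -> : 2 * d = 4 * (u + 2) - 6 by rewrite dk; clear; lia.
  by have -> : u + 2 - 3 = u - 1 by clear; lia.
- (* [q = 2] *)
  have [j uj] : exists j, u = j * 2.
    have : 2 %| u * (2 * u + 1) by rewrite -Au dvdn_mulr.
    rewrite Gauss_dvdl; first by case/dvdnP=> j; exists j.
    by rewrite coprime2n; clear; lia.
  have j_gt0 : 0 < j by move: u_gt0; rewrite uj; clear; lia.
  have dl : d = 4 * j.+1 - 2 by move: dE; rewrite su uj; clear; lia.
  have Aj : A = j * (4 * j + 1).
    by apply/eqP; rewrite -(eqn_pmul2l (_ : 0 < 2)) // Au uj; apply/eqP;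
      clear; lia.
  have NE' : modulus C = (2 * j.+1 - 2) * d + (2 * j.+1 - 1).
    have -> : 2 * j.+1 - 2 = 2 * j by clear; lia.
    have -> : 2 * j.+1 - 1 = 2 * j + 1 by clear; lia.
    have -> : d = 4 * j + 2 by rewrite dl; clear; lia.
    by rewrite NE MA Aj uj; clear; lia.
  have [z1 [z2 lateE]] : exists z1 z2, late_starts d C = [:: z1; z2].
    case: (late_starts d C) szE => [|z1 [|z2 [|? ?]]] //=; last by clear; lia.
    by exists z1, z2.
  move: sumE; rewrite lateE !big_cons big_nil addn0 => sumE.
  have z12 : z1 + z2 = modulus C + d.
    have d2 : d * d.+1 = 2 * (modulus C + d).
      have -> : d = 4 * j + 2 by rewrite dl; clear; lia.
      by rewrite NE MA Aj uj; clear; lia.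
    by move: sumE; rewrite d2; clear; lia.
  have l_ge2 : 2 <= j.+1 by [].
  right; right; right; right; right.
  have [[t [lt1 lt2]]|[t [lt1 lt2]]] :=
    late_two d_gt0 balC d_ltN l_ge2 dl NE' lateE z12;
    move/perm_lens_double; rewrite !map_cat !map_nseq [map _ [:: _; _]]/=.
    have -> : 2 * (2 * j.+1 - 1 - t) = 4 * j.+1 - 2 - 2 * t by clear; lia.
    have -> : 2 * (2 * j.+1 - 2) = 4 * j.+1 - 4 by clear; lia.
    have -> : 2 * (2 * j.+1 - 1) = 4 * j.+1 - 2 by clear; lia.
    by left; exists j.+1, t.
  have -> : 2 * (2 * j.+1 - 1 - t) = 4 * j.+1 - 2 - 2 * t by clear; lia.
  have -> : 2 * (t - 1) = 2 * t - 2 by clear; lia.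
  have -> : 2 * (2 * j.+1 - 2) = 4 * j.+1 - 4 by clear; lia.
  have -> : 2 * (2 * j.+1 - 1) = 4 * j.+1 - 2 by clear; lia.
  by right; left; exists j.+1, t.
- (* [q = 3] *)
  have three : 3 %| u * (2 * u + 1) by rewrite -Au dvdn_mulr.
  have [z lateE] : exists z, late_starts d C = [:: z].
    by case: (late_starts d C) szE => [|z [|? ?]] //=; [exists z | clear; lia].
  move: sumE; rewrite lateE big_cons big_nil addn0 => sumE.
  move: three; rewrite Euclid_dvdM // => /orP[] /dvdnP[j uj].
    have j_gt0 : 0 < j by move: u_gt0; rewrite uj; clear; lia.
    have dl : d = 6 * j + 3 by move: dE; rewrite su uj; clear; lia.
    have Aj : A = j * (6 * j + 1).
      by apply/eqP; rewrite -(eqn_pmul2l (_ : 0 < 3)) // Au uj; apply/eqP;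
        clear; lia.
    have NE' : modulus C = 2 * j * d + (2 * j + 1).
      by rewrite NE MA Aj uj dl; clear; lia.
    have zE : z = j * d + (4 * j + 2).
      by move: sumE; rewrite NE' dl; clear; lia.
    rewrite zE in lateE.
    have [le3] := late_one_even d_gt0 balC d_ltN j_gt0 dl NE' lateE.
    move/perm_lens_double => pa; right; right.
    have [j1|[j2|j3]] : j = 1 \/ (j = 2 \/ j = 3) by move: j_gt0 le3; clear;
      lia.
    - left; rewrite j1 in pa; exact: pa.
    - right; left; rewrite j2 in pa; exact: pa.
    right; right; left; rewrite j3 in pa; exact: pa.
  have [i ui] : exists i, u = 3 * i + 1 by exists j./2; move: uj; clear; lia.
  have Ai : A = (3 * i + 1) * (2 * i + 1).
    by apply/eqP; rewrite -(eqn_pmul2l (_ : 0 < 3)) // Au ui; apply/eqP;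
      clear; lia.
  have i_gt0 : 1 < i.+1.
    rewrite ltnS lt0n; apply/eqP => i0; move: ltM.
    by rewrite MA Ai su ui i0.
  have dl : d = 6 * i.+1 - 1 by move: dE; rewrite su ui; clear; lia.
  have di : d = 6 * i + 5 by rewrite dl; clear; lia.
  have NE' : modulus C = (2 * i.+1 - 2) * d + d.
    have -> : 2 * i.+1 - 2 = 2 * i by clear; lia.
    by rewrite NE MA Ai ui di; clear; lia.
  have zE : z = i.+1 * d.
    by move: sumE; rewrite NE MA Ai ui di; clear; lia.
  rewrite zE in lateE.
  have /perm_lens_double := late_one_middle d_gt0 balC d_ltN i_gt0 dl NE' lateE.
  rewrite /= map_nseq => perm_a; right; left; exists i.+1; split=> //.
  move: perm_a; have -> : 2 * (2 * i.+1 - 1) = 4 * i.+1 - 2 by clear; lia.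
  by have -> : 2 * i = 2 * i.+1 - 2 by clear; lia.
(* [q = 4] *)
have [l ul] : exists l, u = l * 4.
  have : 4 %| u * (2 * u + 1) by rewrite -Au dvdn_mulr.
  rewrite Gauss_dvdl; first by case/dvdnP=> l; exists l.
  by rewrite -[4]/(2 ^ 2) coprime_pexpl // coprime2n; clear; lia.
left; exists l; split; first by move: u_gt0; rewrite ul; clear; lia.
have lateE : late_starts d C = [::] by apply: size0nil; move: szE; clear; lia.
have dl : d = 8 * l + 4 by move: dE; rewrite su ul; clear; lia.
have Al : A = l * (8 * l + 1).
  by apply/eqP; rewrite -(eqn_pmul2l (_ : 0 < 4)) // Au ul; apply/eqP; clear;
    lia.
have NE' : modulus C = 2 * l * d + (2 * l + 1).
  by rewrite NE MA Al ul dl; clear; lia.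
have /perm_lens_double := late_none d_gt0 balC d_ltN dl NE' lateE.
rewrite map_cat !map_nseq.
have -> : 2 * (2 * l) = 4 * l by clear; lia.
by have -> : 2 * (2 * l + 1) = 4 * l + 2 by clear; lia.
Qed.

(** * Subset sums of odd numbers *)

Definition subset_sum (w : seq nat) n :=
  exists w1 w2, perm_eq w (w1 ++ w2) /\ sumn w1 = n.

Definition all_subset_sums w := forall n, n <= sumn w -> subset_sum w n.

Lemma perm_sumn (w w' : seq nat) : perm_eq w w' -> sumn w = sumn w'.
Proof. by move=> ww'; rewrite !sumnE (perm_big _ ww'). Qed.

Lemma subset_sum_perm w w' n : perm_eq w w' -> subset_sum w n -> subset_sum w'
  n.
Proof.
move=> ww' [w1 [w2 [e s]]]; exists w1, w2; split=> //.
by apply: perm_trans e; rewrite perm_sym.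
Qed.

Lemma all_subset_sums_perm w w' :
  perm_eq w w' -> all_subset_sums w -> all_subset_sums w'.
Proof.
by move=> e all n; rewrite -(perm_sumn e) => /all; apply: subset_sum_perm.
Qed.

Lemma subset_sum0 w : subset_sum w 0.
Proof. by exists [::], w; rewrite perm_refl. Qed.

Lemma subset_sum_skip x w n : subset_sum w n -> subset_sum (x :: w) n.
Proof.
move=> [w1 [w2 [e <-]]]; exists w1, (x :: w2); split=> //.
by rewrite perm_sym -cat1s perm_catCA /= perm_cons perm_sym.
Qed.

Lemma subset_sum_take x w n : subset_sum w n -> subset_sum (x :: w) (x + n).
Proof. by move=> [w1 [w2 [e <-]]]; exists (x :: w1), w2;
  rewrite /= perm_cons. Qed.

(** A number can be left out for small sums and used for large ones; the bound
    on [x] makes the two ranges overlap or touch. *)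
Lemma all_subset_sums_cons x w :
  x <= (sumn w).+1 -> all_subset_sums w -> all_subset_sums (x :: w).
Proof.
move=> lex all n /= len; have [le|lt] := leqP n (sumn w).
  exact/subset_sum_skip/all.
have -> : n = x + (n - x) by lia.
by apply/subset_sum_take/all; lia.
Qed.

(** The largest comes first, so that [subset_sum_odds] is an induction on [k].
    *)
Fixpoint odds k := if k is k'.+1 then (2 * k').+1 :: odds k' else [::].

Lemma sumn_odds k : sumn (odds k) = k * k.
Proof. by elim: k => //= k ->; lia. Qed.

(** Only 2 and its complement are missed; this propagates because the largest
    number can be used unless the sum is small. *)
Lemma subset_sum_odds k n :
  n <= k * k -> n != 2 -> n + 2 != k * k -> subset_sum (odds k) n.
Proof.
elim: k n => [|k IH] n len n2 nk.
  by have -> : n = 0; [lia | apply: subset_sum0].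
have [k_le2|k_gt2] := leqP k 2.
  case: k k_le2 IH len nk => [|[|[|//]]] _ IH len nk.
  - have [->|->] : n = 0 \/ n = 1 by lia.
      exact: subset_sum0.
    by exists [:: 1], [::].
  - have [->|[->|[->|->]]] : n = 0 \/ (n = 1 \/ (n = 3 \/ n = 4)) by lia.
    + exact: subset_sum0.
    + by exists [:: 1], [:: 3].
    + by exists [:: 3], [:: 1].
    by exists [:: 3; 1], [::].
  have [lt|le] := ltnP n 5.
    by apply/subset_sum_skip/IH; lia.
  have -> : n = 5 + (n - 5) by lia.
  by apply/subset_sum_take/IH; lia.
have k3 : k = 3 /\ k * k = 9 \/ 4 * k <= k * k.
  move: k_gt2; rewrite leq_eqVlt => /orP[/eqP<-|k_gt3]; first by left.
  by right; rewrite leq_mul2r k_gt3 orbT.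
have kk : k.+1 * k.+1 = k * k + 2 * k + 1 by lia.
rewrite {}kk in len nk.
have [/and3P[le n2' nk']|] := boolP [&& n <= k * k, n != 2 & n + 2 != k * k].
  exact/subset_sum_skip/IH.
rewrite !negb_and n2 /= negbK => bad.
have -> : n = (2 * k).+1 + (n - (2 * k).+1) by lia.
apply/subset_sum_take/IH; move: bad len nk n2 k3 k_gt2; clear; lia.
Qed.

Lemma all_subset_sums_1odds b : 0 < b -> all_subset_sums (1 :: odds b).
Proof.
elim: b => // -[_ _|b IH _].
  by apply: all_subset_sums_cons => //;
    apply: all_subset_sums_cons => // -[|//] _; apply: subset_sum0.
apply: (@all_subset_sums_perm ((2 * b.+1).+1 :: 1 :: odds b.+1)).
  by rewrite /= (perm_catCA [:: _] [:: _] (_ :: odds b)).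
apply: all_subset_sums_cons; last exact: IH.
rewrite -[sumn _]/(1 + sumn (odds b.+1)) sumn_odds.
by move: (leq0n (b * b)); lia.
Qed.

(** The second 1 fills the gaps left by a single run of odd numbers. *)
Lemma all_subset_sums_odds2 a b : 0 < a -> 0 < b ->
  all_subset_sums (odds a ++ odds b).
Proof.
move=> a_gt0 b_gt0; elim: a a_gt0 => // -[_ _|a IH _].
  exact: all_subset_sums_1odds.
rewrite -[odds a.+2]/((2 * a.+1).+1 :: odds a.+1) cat_cons;
  apply: all_subset_sums_cons; last exact: IH.
rewrite sumn_cat !sumn_odds.
have : a.+1 * a.+1 = a * a + 2 * a + 1 by lia.
have : 0 < b * b by rewrite muln_gt0 b_gt0.
by move: (leq0n (a * a)); lia.
Qed.

(** The offsets of consecutive classes, up to the centre [c / 2]. *)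
Lemma odds_iota (c m k : nat) : c + 1 = 2 * (m + k) ->
  [seq c - p - p | p <- iota m k] = odds k.
Proof.
elim: k m => //= k IH m cE; rewrite IH; last by lia.
by congr (_ :: _); lia.
Qed.

(** * Orienting the chains *)

Lemma perm_map_lift (T U : eqType) (f : T -> U) (s : seq T) (t : seq U) :
  perm_eq (map f s) t -> exists2 s', perm_eq s s' & map f s' = t.
Proof.
case: s => [|x0 s]; rewrite perm_sym; first by move/perm_nilP ->; exists [::].
move=> /(perm_iotaP (f x0))[Is pIs ->].
exists [seq nth x0 (x0 :: s) i | i <- Is].
  by rewrite perm_sym; apply/(perm_iotaP x0); exists Is;
    rewrite // -(size_map f).
rewrite -map_comp; apply/eq_in_map => i iI.
rewrite [RHS](nth_map x0) //.
by move: iI; rewrite (perm_mem pIs) mem_iota size_map add0n.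
Qed.

(** The amount by which flipping the chain raises the sum of the starts, for a
    chain whose start is the smaller of the two. *)
Definition gap c := costart c - start c.

(** Flipping the chains that carry a subset of the gaps with half the total
    makes the two sums of starts equal, and the mirror equations then give
    their value. *)
Lemma orient_balanced d K n : let N := modulus K in
    {in K, forall c, 0 < len c} ->
    {in K, forall c, start c + costart c + (len c).-1 * d = N} ->
    {in K, forall c, start c <= costart c} ->
    (forall x, 0 < x < N ->
      exists2 c, c \in K & (x \in cells d c) || (x \in cells d (flip c))) ->
    2 * N + (sumn (map len K) + 2 - size K) * d = size K * N ->
    subset_sum (map gap K) n -> 2 * n = sumn (map gap K) ->
  exists2 C, balanced d C & perm_eq (map len C) (map len K).
Proof.
move=> N lenK mirK leK covK modK [w1 [w2 [pw sw]]] nE.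
have [K' pK gK] := perm_map_lift pw.
pose K1 := take (size w1) K'; pose K2 := drop (size w1) K'.
have eK : K' = K1 ++ K2 by rewrite cat_take_drop.
have g1 : map gap K1 = w1 by rewrite map_take gK take_size_cat.
have g2 : map gap K2 = w2 by rewrite map_drop gK drop_size_cat.
have K12 c : (c \in K) = (c \in K1) || (c \in K2).
  by rewrite (perm_mem pK) eK mem_cat.
pose C := map flip K1 ++ K2.
have lensC : perm_eq (map len C) (map len K).
  rewrite /C map_cat -map_comp -[X in perm_eq X _]map_cat -eK.
  by apply: perm_map; rewrite perm_sym.
have modC : modulus C = N by rewrite /modulus (perm_sumn lensC).
have sumK (F : chain -> nat) : \sum_(c <- K) F c = \sum_(c <- K1) F c + \sum_(c
  <- K2) F c.
  by rewrite (perm_big _ pK) eK big_cat.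
have start_costart c : c \in K -> costart c = start c + gap c.
  by move=> cK; rewrite /gap subnKC // leK.
have sumC1 : \sum_(c <- K1) costart c = \sum_(c <- K1) start c + sumn w1.
  rewrite -g1 sumnE big_map -big_split; apply: eq_big_seq => c c1.
  by rewrite start_costart // K12 c1.
have sumC2 : \sum_(c <- K2) costart c = \sum_(c <- K2) start c + sumn w2.
  rewrite -g2 sumnE big_map -big_split; apply: eq_big_seq => c c2.
  by rewrite start_costart // K12 c2 orbT.
have w12 : sumn w1 = sumn w2.
  by move: nE; rewrite (perm_sumn pw) sumn_cat sw; clear; lia.
have both : \sum_(c <- K) start c + \sum_(c <- K) costart c = 2 * (N + d).
  have : \sum_(c <- K) (start c + costart c + (len c).-1 * d) = size K * N.
    rewrite (eq_big_seq (fun=> N));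
      first by rewrite big_const_seq count_predT iter_addn_0 mulnC.
    exact: mirK.
  rewrite -modK !big_split /= -big_distrl /=.
  have -> : sumn (map len K) + 2 - size K = \sum_(c <- K) (len c).-1 + 2.
    have : \sum_(c <- K) ((len c).-1 + 1) = sumn (map len K).
      by rewrite sumnE big_map; apply: eq_big_seq => c /lenK; clear; lia.
    by rewrite big_split /= sum1_size; clear; lia.
  by rewrite mulnDl; clear; lia.
rewrite !sumK sumC1 sumC2 in both.
have flip1 : \sum_(c <- map flip K1) start c = \sum_(c <- K1) costart c.
  by rewrite big_map.
have flip2 : \sum_(c <- map flip K1) costart c = \sum_(c <- K1) start c.
  by rewrite big_map.
move: both sumC1 sumC2 flip1 flip2; set S1 := \sum_(c <- K1) start c.
set S2 := \sum_(c <- K2) start c => both sumC1 sumC2 flip1 flip2.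
exists C => //; split; rewrite ?modC.
- move=> c; rewrite mem_cat => /orP[/mapP[c' c'1 ->]|c2].
    by apply: (lenK c'); rewrite K12 c'1.
  by apply: lenK; rewrite K12 c2 orbT.
- move=> c; rewrite mem_cat => /orP[/mapP[c' c'1 ->]|c2].
    rewrite -(mirK c') ?K12 ?c'1 //; congr (_ + _).
    by rewrite [start (flip _)]/(costart _) addnC.
  by rewrite mirK // K12 c2 orbT.
- move=> x /covK[c]; rewrite K12 => /orP[c1|c2] xc.
    by exists (flip c); rewrite ?mem_cat ?map_f // flipK orbC.
  by exists c; rewrite // mem_cat c2 orbT.
- rewrite big_cat [LHS]/= flip1 sumC1 -/S2.
  by move: both w12; clear; lia.
rewrite big_cat [LHS]/= flip2 sumC2.
by move: both w12; clear; lia.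
Qed.

Lemma orient_chi_la d K n L : 0 < d -> 0 < size K -> let N := modulus K in
    {in K, forall c, 0 < len c} ->
    {in K, forall c, start c + costart c + (len c).-1 * d = N} ->
    {in K, forall c, start c <= costart c} ->
    (forall x, 0 < x < N ->
      exists2 c, c \in K & (x \in cells d c) || (x \in cells d (flip c))) ->
    2 * N + (sumn (map len K) + 2 - size K) * d = size K * N ->
    subset_sum (map gap K) n -> 2 * n = sumn (map gap K) ->
    perm_eq (map (muln 2) (map len K)) L ->
  chi_la (theta L) 2.
Proof.
move=> d_gt0 K_gt0 N h1 h2 h3 h4 h5 h6 h7 pL.
have [C balC pC] := orient_balanced h1 h2 h3 h4 h5 h6 h7.
have C_gt0 : 0 < size C by rewrite -(size_map len) (perm_size pC) size_map.
apply: chi_la_iso (balanced_chi_la d_gt0 C_gt0 balC).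
apply: theta_perm; apply: perm_trans pL.
by rewrite (map_comp (muln 2) len) perm_map.
Qed.

(** * Systems given by residue classes *)

(** The mirror classes [p] and [p'] of [n] elements each, cut after [t] and
    [n - t] elements.  The first part of either is the mirror image of the last
    part of the other, so two chains represent all four parts. *)
Definition cut_classes d p p' n t : seq chain :=
  [:: (p, p' + (n - t) * d, t); (p', p + t * d, n - t)].

Lemma cut_classes_cover d p p' n t : t <= n ->
  (forall u, u < n -> has (fun c => (p + u * d \in cells d c) ||
     (p + u * d \in cells d (flip c))) (cut_classes d p p' n t)) /\
  (forall u, u < n -> has (fun c => (p' + u * d \in cells d c) ||
     (p' + u * d \in cells d (flip c))) (cut_classes d p p' n t)).
Proof.
move=> tn; split=> u un; apply/hasP.
  have [lt|le] := ltnP u t.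
    exists (p, p' + (n - t) * d, t); rewrite ?mem_head //.
    by apply/orP; left; apply/cellsP; exists u.
  exists (p', p + t * d, n - t); rewrite ?inE ?eqxx ?orbT //.
  apply/orP; right; apply/cellsP; exists (u - t); rewrite /len /=; first by lia.
  by rewrite /start /costart /= -addnA -mulnDl; congr (_ + _ * _); lia.
have [lt|le] := ltnP u (n - t).
  exists (p', p + t * d, n - t); rewrite ?inE ?eqxx ?orbT //.
  by apply/orP; left; apply/cellsP; exists u.
exists (p, p' + (n - t) * d, t); rewrite ?mem_head //.
apply/orP; right; apply/cellsP; exists (u - (n - t)); rewrite /len /=;
  first by lia.
by rewrite /start /costart /= -addnA -mulnDl; congr (_ + _ * _); lia.
Qed.

Section Classwise.
Variables d n0 r0 N : nat.
Hypothesis r0d : 0 < r0 <= d.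
Hypothesis NE : N = n0 * d + r0.
Hypothesis d_ltN : d < N.

Definition whole_class p : chain := (p, class_mirror d r0 p, class_len n0 r0 p).

Let d_gt0 : 0 < d.
Proof. by case/andP: r0d => /leq_trans; apply. Qed.

Lemma in_class x : 0 < x < N ->
  exists p u, [/\ 0 < p <= d, u < class_len n0 r0 p & x = p + u * d].
Proof.
move=> xN; exists (x.-1 %% d).+1, (x.-1 %/ d).
have ltd := ltn_pmod x.-1 d_gt0; have xE := divn_eq x.-1 d.
split; [by lia | | by lia].
rewrite /class_len; move: (x.-1 %% d) (x.-1 %/ d) ltd xE => p u ltd xE.
have xE' : x = u * d + p.+1 by lia.
case: (ltnP p.+1 r0) => lt; rewrite /= ?addn1 ?addn0.
  rewrite ltnS leqNgt; apply/negP => ltu.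
  have : n0.+1 * d <= u * d by rewrite leq_mul2r ltu orbT.
  by rewrite mulSn; move: xE' xN NE r0d; clear; lia.
rewrite ltnNge; apply/negP => leu.
have : n0 * d <= u * d by rewrite leq_mul2r leu orbT.
by move: lt xE' xN NE; clear; lia.
Qed.

(** The uncut classes are listed by [rs], one of each mirror pair, and [sp]
    holds the chains of the cut classes. [D] stands for the truncated
    difference [M + 2 - s], and [n] is half the sum of the gaps. *)
Lemma classes_chi_la rs sp n D L (K := map (class_len n0 r0) rs ++ map len sp)
    (W := map (fun p => class_mirror d r0 p - p) rs ++ map gap sp) :
    {in rs, forall p, 0 < p <= d /\ p <= class_mirror d r0 p} ->
    {in sp, forall c, [/\ 0 < len c, start c + costart c + (len c).-1 * d = N &
                          start c <= costart c]} ->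
    (forall p, 0 < p <= d -> [\/ p \in rs, class_mirror d r0 p \in rs |
       forall u, u < class_len n0 r0 p ->
         has (fun c => (p + u * d \in cells d c) ||
                       (p + u * d \in cells d (flip c))) sp]) ->
    0 < size K -> (2 * sumn K).+1 = N ->
    sumn K + 2 = size K + D -> 2 * N + D * d = size K * N ->
    subset_sum W n -> 2 * n = sumn W -> perm_eq (map (muln 2) K) L ->
  chi_la (theta L) 2.
Proof.
move=> rsP spP covP K_gt0 NK DK eqK Wn nE pL.
pose Ch := map whole_class rs ++ sp.
have lensE : map len Ch = K by rewrite map_cat -map_comp.
have gapsE : map gap Ch = W by rewrite map_cat -map_comp.
have sizeE : size Ch = size K by rewrite -lensE size_map.
have modE : modulus Ch = N by rewrite /modulus lensE.
have ChP c : c \in Ch -> [/\ 0 < len c,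
    start c + costart c + (len c).-1 * d = N & start c <= costart c].
  rewrite mem_cat => /orP[/mapP[p /rsP[pd le] ->]|/spP //].
  have [_ _ eN] := class_mirrorP r0d NE d_ltN pd; split=> //.
  rewrite /len /= /class_len; move: d_ltN; rewrite NE.
  by case: (n0) => //; move: r0d; clear; lia.
apply: (orient_chi_la (K := Ch) (n := n) (d := d));
  rewrite ?modE ?lensE ?gapsE ?sizeE //.
- by move=> c /ChP[].
- by move=> c /ChP[].
- by move=> c /ChP[].
- move=> x /in_class[p [u [pd ltu ->]]].
  have [p'd lp' _] := class_mirrorP r0d NE d_ltN pd.
  case: (covP p pd) => [prs|prs|/(_ u ltu)/hasP[c csp cx]].
  + exists (whole_class p); first by rewrite mem_cat map_f.
    by apply/orP; left; apply/cellsP; exists u.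
  + exists (whole_class (class_mirror d r0 p)); first by rewrite mem_cat map_f.
    have mm : class_mirror d r0 (class_mirror d r0 p) = p.
      rewrite /class_mirror; case: (ltnP p r0) => lt;
        [rewrite ifT | rewrite ifF];
      by move: pd lt r0d; clear; lia.
    apply/orP; right; apply/cellsP; exists u; first by rewrite /len /= lp'.
    by rewrite -[start _]/(class_mirror d r0 (class_mirror d r0 p)) mm.
  by exists c; rewrite // mem_cat csp orbT.
by rewrite (_ : sumn K + 2 - size K = D) //; move: DK; clear; lia.
Qed.

End Classwise.

Lemma map_cst_iota (T : Type) (f : nat -> T) x m k :
  (forall p, m <= p < m + k -> f p = x) -> map f (iota m k) = nseq k x.
Proof.
elim: k m => //= k IH m fx; rewrite fx ?IH //; last by lia.
by move=> p pm; apply: fx; lia.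
Qed.

Lemma eq_map_iota (T : Type) (f g : nat -> T) m k :
  (forall p, m <= p < m + k -> f p = g p) ->
  map f (iota m k) = map g (iota m k).
Proof.
elim: k m => //= k IH m fg; rewrite fg ?(IH m.+1) //; last by lia.
by move=> p pm; apply: fg; lia.
Qed.

Lemma block_cover (m k c p : nat) : c + 1 = 2 * (m + k) -> m <= p -> p + m <= c
  ->
  (p \in iota m k) || (c - p \in iota m k).
Proof. by rewrite !mem_iota; lia. Qed.

(** ** The families of lengths *)

(** No class is cut.  The gaps are two runs of odd numbers, so half of their sum
    is a subset sum. *)
Lemma chi_la_two_lengths l : 1 <= l ->
  chi_la (theta (nseq (3 * l + 2) (4 * l) ++ nseq l (4 * l + 2))) 2.
Proof.
move=> l_ge1; pose d := 8 * l + 4; pose n0 := 2 * l; pose r0 := 2 * l + 1.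
have r0d : 0 < r0 <= d by rewrite /r0 /d; lia.
have d_ltN : d < n0 * d + r0 by rewrite /n0 /r0 /d; nia.
have lens : map (class_len n0 r0) (iota 1 l ++ iota r0 (3 * l + 2)) =
    nseq l (2 * l + 1) ++ nseq (3 * l + 2) (2 * l).
  rewrite map_cat (map_cst_iota (x := 2 * l + 1)); last first.
    by move=> p pr; rewrite /class_len /n0 /r0; lia.
  rewrite (map_cst_iota (x := 2 * l)) // => p pr.
  by rewrite /class_len /n0 /r0 in pr *; lia.
have gaps : map (fun p => class_mirror d r0 p - p) (iota 1 l ++ iota r0 (3 * l
  + 2)) =
    odds l ++ odds (3 * l + 2).
  rewrite map_cat -(@odds_iota r0 1 l) -1?(@odds_iota (r0 + d) r0 (3 * l + 2));
    try by rewrite /r0 /d; lia.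
  by congr (_ ++ _); apply: eq_map_iota => p pr; rewrite /class_mirror;
    [rewrite ifT | rewrite ifF]; rewrite // /r0 in pr *; lia.
apply: (classes_chi_la r0d erefl d_ltN (rs := iota 1 l ++ iota r0 (3 * l + 2))
  (sp := [::]) (n := 5 * (l * l) + 6 * l + 2) (D := 8 * (l * l) + l)).
- move=> p; rewrite mem_cat !mem_iota /class_mirror.
  by case: (ltnP p r0); rewrite /r0 /d; clear; lia.
- by [].
- move=> p pd; rewrite !mem_cat /class_mirror.
  case: (ltnP p r0) => lt.
    have /orP[->|->] := @block_cover 1 l r0 p ltac:(by rewrite /r0;
      lia) ltac:(lia) ltac:(lia).
      by constructor 1.
    by constructor 2.
  have /orP[->|->] := @block_cover r0 (3 * l + 2) (r0 + d) p ltac:(by rewrite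
    /r0 /d; lia) ltac:(lia) ltac:(lia).
    by rewrite orbT; constructor 1.
  by rewrite orbT; constructor 2.
- by rewrite cats0 size_map size_cat !size_iota; lia.
- by rewrite cats0 lens sumn_cat !sumn_nseq /n0 /r0 /d; clear; lia.
- by rewrite cats0 lens sumn_cat !sumn_nseq size_cat !size_nseq; clear; lia.
- by rewrite cats0 lens size_cat !size_nseq /n0 /r0 /d; clear; lia.
- rewrite cats0 gaps; apply: all_subset_sums_odds2; try lia.
  by rewrite sumn_cat !sumn_odds; clear; lia.
- by rewrite cats0 gaps sumn_cat !sumn_odds; clear; lia.
rewrite cats0 lens map_cat !map_nseq perm_catC.
have -> : 2 * (2 * l) = 4 * l by lia.
by have -> : 2 * (2 * l + 1) = 4 * l + 2 by lia.
Qed.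

(** A decidable form of the hypotheses of [classes_chi_la], used to verify
    sporadic systems by computation; [w1] and [w2] are the two halves of the
    gaps. *)
Definition classes_ok d n0 r0 rs (sp : seq chain) (w1 w2 : seq nat) : bool :=
  let N := n0 * d + r0 in
  let K := map (class_len n0 r0) rs ++ map len sp in
  let mirror := class_mirror d r0 in
  [&& [&& 0 < r0, r0 <= d & d < N],
      all (fun p => [&& 0 < p, p <= d & p <= mirror p]) rs,
      all (fun c => [&& 0 < len c,
        start c + costart c + (len c).-1 * d == N & start c <= costart c]) sp,
      all (fun p => [|| p \in rs, mirror p \in rs |
        all (fun u => has (fun c => (p + u * d \in cells d c) ||
                                    (p + u * d \in cells d (flip c))) sp)
            (iota 0 (class_len n0 r0 p))]) (iota 1 d),
      [&& 0 < size K, (2 * sumn K).+1 == N, size K <= sumn K + 2 &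
        2 * N + (sumn K + 2 - size K) * d == size K * N] &
      perm_eq (map (fun p => mirror p - p) rs ++ map gap sp) (w1 ++ w2) &&
      (sumn w1 == sumn w2)].

Lemma classes_okP d n0 r0 rs sp w1 w2 L : classes_ok d n0 r0 rs sp w1 w2 ->
    perm_eq (map (muln 2) (map (class_len n0 r0) rs ++ map len sp)) L ->
  chi_la (theta L) 2.
Proof.
case/and5P => /and3P[r0_gt0 r0d dN] /allP rsP /allP spP /allP covP.
case/andP=> /and4P[K_gt0 /eqP NK DK /eqP eqK] /andP[pW /eqP w12].
have r0d' : 0 < r0 <= d by rewrite r0_gt0.
apply: (classes_chi_la (n := sumn w1)
  (D := sumn (map (class_len n0 r0) rs ++ map len sp) + 2 -
        size (map (class_len n0 r0) rs ++ map len sp)) r0d' erefl dN) => //.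
- by move=> p /rsP/and3P[-> -> ->].
- by move=> c /spP/and3P[-> /eqP-> ->].
- move=> p pd; have /covP : p \in iota 1 d by rewrite mem_iota; lia.
  case/or3P=> [prs|prs|/allP all_u]; [by constructor 1 | by constructor 2 |].
  by constructor 3 => u ltu; apply: all_u; rewrite mem_iota.
- by rewrite subnKC.
- by exists w1, w2.
by rewrite (perm_sumn pW) sumn_cat -w12; lia.
Qed.

Lemma chi_la_theta_2_4_6 : chi_la (theta ([:: 2] ++ nseq 3 4 ++ [:: 6])) 2.
Proof.
by apply: (@classes_okP 9 2 3 [:: 1; 3; 4; 5] [:: (6, 15, 1)] [:: 9; 2]
  [:: 1; 6; 4]); vm_compute.
Qed.

Lemma chi_la_theta_4_8_10 :
  chi_la (theta ([:: 4] ++ nseq 5 8 ++ nseq 2 10)) 2.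
Proof.
by apply: (@classes_okP 15 4 5 [:: 1; 2; 5; 6; 7; 8; 9] [:: (10, 40, 2)]
  [:: 30; 2] [:: 3; 1; 10; 8; 6; 4]); vm_compute.
Qed.

Lemma chi_la_theta_6_12_14 :
  chi_la (theta ([:: 6] ++ nseq 7 12 ++ nseq 3 14)) 2.
Proof.
by apply: (@classes_okP 21 6 7 [:: 1; 2; 3; 7; 8; 9; 10; 11; 12; 13]
  [:: (14, 77, 3)] [:: 63; 1] [:: 5; 3; 14; 12; 10; 8; 6; 4; 2]); vm_compute.
Qed.

Lemma half_square l : exists h, l * l + l = 2 * h.
Proof.
exists (l * l.+1)./2; have := odd_double_half (l * l.+1).
by rewrite oddM /= andbN; lia.
Qed.

(** The halves of the self-mirrored class have the gap [(i + 1) d], which is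
    smaller than the sum of the other gaps, a run of odd numbers.  Everything is
    expressed by [i = l - 2] to avoid truncated differences. *)
Lemma chi_la_half_bridge l : 2 <= l ->
  chi_la (theta ((2 * l - 2) :: nseq (3 * l - 1) (4 * l - 2))) 2.
Proof.
move=> l_ge2; pose i := l - 2; have li : l = i + 2 by rewrite /i; lia.
clearbody i; subst l; clear l_ge2.
have -> : 2 * (i + 2) - 2 = 2 * (i + 1) by lia.
have -> : 3 * (i + 2) - 1 = 3 * i + 5 by lia.
have -> : 4 * (i + 2) - 2 = 2 * (2 * i + 3) by lia.
pose d := 6 * i + 11; pose n0 := 2 * i + 2.
have r0d : 0 < d <= d by rewrite /d; lia.
have d_ltN : d < n0 * d + d by rewrite /n0 /d; lia.
have lens : map (class_len n0 d) (iota 1 (3 * i + 5)) = nseq (3 * i + 5) (2 * i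
  + 3).
  by apply: map_cst_iota => p pr; rewrite /class_len /n0 /d; lia.
have gaps : map (fun p => class_mirror d d p - p) (iota 1 (3 * i + 5)) = odds
  (3 * i + 5).
  rewrite -(@odds_iota d 1); last by rewrite /d; lia.
  by apply: eq_map_iota => p pr; rewrite /class_mirror ifT //; rewrite /d; lia.
have [h hE] := half_square (i + 2).
apply: (classes_chi_la r0d erefl d_ltN (rs := iota 1 (3 * i + 5))
  (sp := [:: (d, (i + 2) * d, i + 1)])
  (n := (i + 1) * d + ((i + 2) * (i + 2) + h)) (D := 6 * (i * i) + 17 * i +
    12)).
- move=> p; rewrite mem_iota => pr; rewrite /class_mirror ifT; rewrite /d; lia.
- move=> c; rewrite inE => /eqP->; rewrite /start /costart /len /=.
  split; [by lia | | by rewrite leq_pmull; lia].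
  by rewrite /n0 /d addn1; lia.
- move=> p pd; have [lt|le] := ltnP p d.
    have /orP[prs|prs] := @block_cover 1 (3 * i + 5) d p ltac:(by rewrite /d;
      lia) ltac:(lia) ltac:(lia).
      by constructor 1.
    by constructor 2; rewrite /class_mirror lt.
  have -> : p = d by lia.
  constructor 3 => u; rewrite /class_len ltnn addn0 => ltu /=; rewrite orbF.
  have [lt|ge] := ltnP u (i + 1); apply/orP; [left|right]; apply/cellsP.
    by exists u.
  exists (u - (i + 1)); rewrite /start /costart /len /=;
    first by rewrite /n0 in ltu; lia.
  by rewrite -mulSn -mulnDl; congr (_ * _); lia.
- by rewrite size_cat !size_map size_iota /=; lia.
- by rewrite lens sumn_cat sumn_nseq /= /len /= /n0 /d; lia.
- by rewrite lens sumn_cat sumn_nseq size_cat size_nseq /= /len /=; lia.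
- by rewrite lens size_cat size_nseq /= /n0 /d; lia.
- rewrite gaps; apply: (@subset_sum_perm ((i + 1) * d :: odds (3 * i + 5))).
    have <- : gap (d, (i + 2) * d, i + 1) = (i + 1) * d.
      by rewrite /gap /start /costart /= !mulnDl mul1n; clear; lia.
    by rewrite perm_sym perm_catC.
  apply/subset_sum_take/subset_sum_odds; lia.
- by rewrite gaps sumn_cat sumn_odds /= /gap /start /costart /= /d; lia.
rewrite lens map_cat map_nseq /= /len /= perm_catC /=.
exact: perm_refl.
Qed.

Lemma cut_classesP d N p p' n t : 0 < t < n -> 0 < p <= d -> 0 < p' <= d ->
    p + p' + n.-1 * d = N ->
  {in cut_classes d p p' n t, forall c, [/\ 0 < len c,
     start c + costart c + (len c).-1 * d = N & start c <= costart c]}.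
Proof.
move=> tn pd p'd <- c.
have td : t * d = d + t.-1 * d by rewrite -mulSn prednK; lia.
have ntd : (n - t) * d = d + (n - t).-1 * d by rewrite -mulSn prednK; lia.
have nd1 : n.-1 * d = (n - t) * d + t.-1 * d by rewrite -mulnDl;
  congr (_ * _); lia.
have nd2 : n.-1 * d = t * d + (n - t).-1 * d by rewrite -mulnDl;
  congr (_ * _); lia.
rewrite !inE => /orP[]/eqP->; rewrite /start /costart /len /=;
  move: (t.-1 * d) ((n - t).-1 * d) td ntd nd1 nd2 => x y td ntd nd1 nd2;
  by split; lia.
Qed.

(** The outermost class of the longer kind, that of 1, is cut; its two gaps
    [(n - t) d + 2 i + 3] and [t d - (2 i + 3)] nearly cancel, and the two runs
    of odd numbers make up the difference.  For [l = 2] one of these runs is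
    empty, and that case is computed. *)
Lemma chi_la_cut_long l t : 2 <= l -> l <= t -> 4 * t + 2 <= 5 * l ->
  chi_la (theta ([:: 4 * l - 2 - 2 * t; 2 * t]
    ++ nseq l (4 * l - 4) ++ nseq (l - 2) (4 * l - 2))) 2.
Proof.
rewrite leq_eqVlt => /orP[/eqP<- lt1 lt2|l_gt2 lt1 lt2].
  have -> : t = 2 by lia.
  by apply: (@classes_okP 6 2 3 [:: 3; 4] [:: (1, 8, 2); (2, 13, 1)]
    [:: 11] [:: 3; 1; 7]); vm_compute.
have [i li] : exists i, l = i + 3 by exists (l - 3); lia.
subst l; clear l_gt2.
have [X XE] : exists X, 2 * t = 2 * i + 5 + X by exists (2 * t - (2 * i + 5));
  lia.
have X_gt0 : 0 < X by lia.
have XX : 2 * (X * (2 * i + 5)) <= (i + 3) * (2 * i + 5).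
  by rewrite mulnA leq_mul2r; apply/orP; right; lia.
have XX' : 2 * i + 5 <= X * (2 * i + 5) by rewrite leq_pmull.
pose d := 4 * i + 10; pose n0 := 2 * i + 4; pose r0 := 2 * i + 5.
have r0d : 0 < r0 <= d by rewrite /r0 /d; lia.
have d_ltN : d < n0 * d + r0 by rewrite /n0 /r0 /d; lia.
have lens : map (class_len n0 r0) (iota 2 (i + 1) ++ iota r0 (i + 3)) =
    nseq (i + 1) (2 * i + 5) ++ nseq (i + 3) (2 * i + 4).
  rewrite map_cat (map_cst_iota (x := 2 * i + 5)); last first.
    by move=> p pr; rewrite /class_len /n0 /r0; lia.
  rewrite (map_cst_iota (x := 2 * i + 4)) // => p pr.
  by rewrite /class_len /n0 /r0 in pr *; lia.
have gaps : map (fun p => class_mirror d r0 p - p) (iota 2 (i + 1) ++ iota r0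
  (i + 3)) =
    odds (i + 1) ++ odds (i + 3).
  rewrite map_cat -(@odds_iota r0 2 (i + 1)) -1?(@odds_iota (r0 + d) r0 (i +
    3));
    try by rewrite /r0 /d; lia.
  by congr (_ ++ _); apply: eq_map_iota => p pr; rewrite /class_mirror;
    [rewrite ifT | rewrite ifF]; rewrite // /r0 in pr *; lia.
pose n := 2 * i + 5; pose p' := 2 * i + 4.
have tn : 0 < t < n by rewrite /n; lia.
have TU : t * d = (n - t) * d + 2 * (X * (2 * i + 5)).
  have -> : 2 * (X * (2 * i + 5)) = X * d by rewrite /d; lia.
  by rewrite -mulnDl; congr (_ * _); rewrite /n; lia.
have Tge : d <= t * d by rewrite leq_pmull; lia.
apply: (classes_chi_la r0d erefl d_ltN (rs := iota 2 (i + 1) ++ iota r0 (i + 3))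
  (sp := cut_classes d 1 p' n t)
  (n := (n - t) * d + 2 * i + 3 +
        (i * i + 4 * i + 5 + X * (2 * i + 5) - (2 * i + 3)))
  (D := 4 * (i * i) + 17 * i + 18)).
- move=> p; rewrite mem_cat !mem_iota /class_mirror.
  by case: (ltnP p r0); rewrite /r0 /d; clear; lia.
- apply: cut_classesP => //; rewrite /p' /d /n /n0 /r0; try lia.
- move=> p pd; rewrite !mem_cat.
  have [cov1 cov2] := @cut_classes_cover d 1 p' n t ltac:(lia).
  have [p1|np1] := eqVneq p 1.
    rewrite p1; constructor 3; rewrite (_ : class_len n0 r0 1 = n) //.
    by rewrite /class_len /n0 /r0 /n; lia.
  have [pp'|npp'] := eqVneq p p'.
    rewrite pp'; constructor 3; rewrite (_ : class_len n0 r0 p' = n) //.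
    by rewrite /class_len /n0 /r0 /n /p'; lia.
  rewrite /class_mirror; case: (ltnP p r0) => lt.
    have /orP[->|->] := @block_cover 2 (i + 1) r0 p ltac:(by rewrite /r0; lia)
      ltac:(lia) ltac:(move: npp'; rewrite /p' /r0 in lt *; lia).
      by constructor 1.
    by constructor 2.
  have /orP[->|->] := @block_cover r0 (i + 3) (r0 + d) p
      ltac:(by rewrite /r0 /d; lia) ltac:(lia) ltac:(lia).
    by rewrite orbT; constructor 1.
  by rewrite orbT; constructor 2.
- by rewrite size_cat !size_map size_cat !size_iota; lia.
- rewrite lens !sumn_cat !sumn_nseq /= /len /= /n0 /r0 /d /n; clear -tn;
    rewrite /n in tn; lia.
- by rewrite lens !sumn_cat !sumn_nseq !size_cat !size_nseq /= /len /= /n;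
    rewrite /n in tn; lia.
- by rewrite lens !size_cat !size_nseq /= /n0 /r0 /d; clear; lia.
- rewrite gaps; apply: (@subset_sum_perm (((n - t) * d + 2 * i + 3) ::
     (1 + t * d - p') :: (odds (i + 1) ++ odds (i + 3)))).
    rewrite perm_sym perm_catC /= /gap /start /costart /=.
    by rewrite (_ : p' + (n - t) * d - 1 = (n - t) * d + 2 * i + 3) // /p'; lia.
  apply/subset_sum_take/subset_sum_skip/all_subset_sums_odds2; try lia.
  by rewrite sumn_cat !sumn_odds; move: XX; clear; lia.
- rewrite gaps !sumn_cat !sumn_odds /= /gap /start /costart /=.
  have -> : (i + 1) * (i + 1) = i * i + 2 * i + 1 by clear; lia.
  have -> : (i + 3) * (i + 3) = i * i + 6 * i + 9 by clear; lia.
  move: (t * d) ((n - t) * d) (X * _) (i * i) TU Tge XX'.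
  by rewrite /p' /d; clear; lia.
rewrite lens !map_cat !map_nseq /= /len /=.
have -> : 2 * (2 * i + 5) = 4 * (i + 3) - 2 by lia.
have -> : 2 * (2 * i + 4) = 4 * (i + 3) - 4 by lia.
have -> : 2 * (n - t) = 4 * (i + 3) - 2 - 2 * t by rewrite /n; lia.
rewrite perm_catC /= (perm_catCA [:: _] [:: _]) /= !perm_cons perm_catC.
by have -> : i + 3 - 2 = i + 1 by lia.
Qed.

(** The outermost class of the shorter kind, that of [2 l - 1], is cut.  For
    [l <= 3] the difference of its two gaps is too large, and another class is
    cut instead. *)
Lemma chi_la_cut_short l t : 2 <= l -> l <= t -> 4 * t <= 5 * l ->
  chi_la (theta ([:: 4 * l - 2 - 2 * t; 2 * t - 2]
    ++ nseq (l - 1) (4 * l - 4) ++ nseq (l - 1) (4 * l - 2))) 2.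
Proof.
move=> l_ge2 lt1 lt2; have [l_le3|l_gt3] := leqP l 3.
  have [[-> ->]|[-> ->]] : l = 2 /\ t = 2 \/ l = 3 /\ t = 3 by lia.
    by apply: (@classes_okP 6 2 3 [:: 1; 3] [:: (4, 11, 1); (5, 10, 1)]
      [:: 1; 7] [:: 3; 5]); vm_compute.
  by apply: (@classes_okP 10 4 5 [:: 1; 2; 5; 7] [:: (6, 29, 2); (9, 26, 2)]
    [:: 1; 1; 23] [:: 3; 5; 17]); vm_compute.
have [i li] : exists i, l = i + 4 by exists (l - 4); lia.
subst l; clear l_ge2 l_gt3.
have [X XE] : exists X, 2 * t = 2 * i + 8 + X by exists (2 * t - (2 * i + 8));
  lia.
have XX : 2 * (X * (2 * i + 7)) <= (i + 4) * (2 * i + 7).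
  by rewrite mulnA leq_mul2r; apply/orP; right; lia.
pose d := 4 * i + 14; pose n0 := 2 * i + 6; pose r0 := 2 * i + 7.
have r0d : 0 < r0 <= d by rewrite /r0 /d; lia.
have d_ltN : d < n0 * d + r0 by rewrite /n0 /r0 /d; lia.
pose rs := iota 1 (i + 3) ++ iota (2 * i + 8) (i + 3).
have lens : map (class_len n0 r0) rs =
    nseq (i + 3) (2 * i + 7) ++ nseq (i + 3) (2 * i + 6).
  rewrite map_cat (map_cst_iota (x := 2 * i + 7)); last first.
    by move=> p pr; rewrite /class_len /n0 /r0; lia.
  rewrite (map_cst_iota (x := 2 * i + 6)) // => p pr.
  by rewrite /class_len /n0 /r0; lia.
have gaps : map (fun p => class_mirror d r0 p - p) rs = odds (i + 3) ++ odds (i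
  + 3).
  rewrite map_cat -{1}(@odds_iota r0 1 (i + 3)); last by rewrite /r0; lia.
  rewrite -(@odds_iota (r0 + d) (2 * i + 8) (i + 3)); last by rewrite /r0 /d;
    lia.
  by congr (_ ++ _); apply: eq_map_iota => p pr; rewrite /class_mirror;
    [rewrite ifT | rewrite ifF]; rewrite // /r0; lia.
pose n := 2 * i + 6; pose p1 := 2 * i + 7; pose u := t - 1.
have un : 0 < u < n by rewrite /n /u; lia.
have TU : u * d = (n - u) * d + 2 * (X * (2 * i + 7)).
  have -> : 2 * (X * (2 * i + 7)) = X * d by rewrite /d; lia.
  by rewrite -mulnDl; congr (_ * _); rewrite /n /u; lia.
have Tge : d <= u * d by rewrite leq_pmull; lia.
have i3 : (i + 3) * (i + 3) = i * i + 6 * i + 9 by clear; lia.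
have i4 : (i + 4) * (2 * i + 7) = 2 * (i * i) + 15 * i + 28 by clear; lia.
apply: (classes_chi_la r0d erefl d_ltN (rs := rs) (sp := cut_classes d p1 d n u)
  (n := (n - u) * d + (2 * i + 7) +
        (i * i + 6 * i + 9 + X * (2 * i + 7) - (2 * i + 7)))
  (D := 4 * (i * i) + 25 * i + 39)).
- move=> p; rewrite mem_cat !mem_iota /class_mirror.
  by case: (ltnP p r0); rewrite /r0 /d; clear; lia.
- apply: cut_classesP => //; rewrite /p1 /n /n0 /r0 /d; try lia.
- move=> p pd; rewrite !mem_cat.
  have [cov1 cov2] := @cut_classes_cover d p1 d n u ltac:(lia).
  have [->|np1] := eqVneq p p1.
    constructor 3; rewrite (_ : class_len n0 r0 p1 = n) //.
    by rewrite /class_len /n0 /r0 /n /p1; lia.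
  have [->|npd] := eqVneq p d.
    constructor 3; rewrite (_ : class_len n0 r0 d = n) //.
    by rewrite /class_len /n0 /r0 /n /d; lia.
  rewrite /class_mirror; case: (ltnP p r0) => lt.
    have /orP[->|->] := @block_cover 1 (i + 3) r0 p ltac:(by rewrite /r0; lia)
      ltac:(lia) ltac:(lia).
      by constructor 1.
    by constructor 2.
  have /orP[->|->] := @block_cover (2 * i + 8) (i + 3) (r0 + d) p
      ltac:(by rewrite /r0 /d; lia) ltac:(move: np1 lt; rewrite /p1 /r0;
        clear; lia)
      ltac:(move: npd pd; rewrite /d /r0; clear; lia).
    by rewrite orbT; constructor 1.
  by rewrite orbT; constructor 2.
- by rewrite size_cat !size_map size_cat !size_iota; clear; lia.
- by rewrite lens !sumn_cat !sumn_nseq /= /len /= /n0 /r0 /d; move: un;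
    rewrite /n; clear; lia.
- by rewrite lens !sumn_cat !sumn_nseq !size_cat !size_nseq /= /len /=;
    move: un; rewrite /n; clear; lia.
- by rewrite lens !size_cat !size_nseq /= /n0 /r0 /d; clear; lia.
- rewrite gaps; apply: (@subset_sum_perm (((n - u) * d + (2 * i + 7)) ::
     (p1 + u * d - d) :: (odds (i + 3) ++ odds (i + 3)))).
    rewrite perm_sym perm_catC /= /gap /start /costart /=.
    have -> : d + (n - u) * d - p1 = (n - u) * d + (2 * i + 7).
      by move: ((n - u) * d) => U; rewrite /p1 /d; clear; lia.
    exact: perm_refl.
  apply/subset_sum_take/subset_sum_skip/all_subset_sums_odds2; try lia.
  by rewrite sumn_cat !sumn_odds; move: XX; rewrite i3 i4; clear; lia.
- rewrite gaps !sumn_cat !sumn_odds /= /gap /start /costart /= i3.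
  move: (u * d) ((n - u) * d) (X * _) (i * i) TU Tge.
  by rewrite /p1 /d; clear; lia.
rewrite lens !map_cat !map_nseq /= /len /=.
have -> : 2 * (2 * i + 7) = 4 * (i + 4) - 2 by lia.
have -> : 2 * (2 * i + 6) = 4 * (i + 4) - 4 by lia.
have -> : 2 * (n - u) = 4 * (i + 4) - 2 - 2 * t by rewrite /n /u; lia.
have -> : 2 * u = 2 * t - 2 by rewrite /u; lia.
rewrite perm_catC /= (perm_catCA [:: _] [:: _]) /= !perm_cons perm_catC.
by have -> : i + 4 - 1 = i + 3 by lia.
Qed.

(** The class of 1 is cut, and the self-mirrored class is halved with the gap
    [k d].  The latter is put on the side that leaves a difference of about
    [Z d] to the run of odd numbers, [Z] being the distance of [k] from the
    difference of the lengths [u] and [d - u]. *)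
Lemma chi_la_cut_outer_class k u Z n : 2 <= k ->
    let d := 2 * k + 1 in 0 < u < d ->
    2 * u = d + (k + Z) \/ 2 * u + k = d + Z /\ Z <= k ->
    2 * n + (4 * k - 2) = (k - 1) * (k - 1) + Z * d ->
    n <= (k - 1) * (k - 1) -> n != 2 -> n + 2 != (k - 1) * (k - 1) ->
  chi_la (theta ([:: 2 * u; 2 * (d - u); 2 * k] ++ nseq (k - 1) (2 * d))) 2.
Proof.
move=> k_ge2 d ud uZ nE n1 n2 n3.
pose n0 := 2 * k; have r0d : 0 < d <= d by rewrite /d; lia.
have d_ltN : d < n0 * d + d by rewrite /n0 /d; lia.
pose rs := iota 2 (k - 1).
have lens : map (class_len n0 d) rs = nseq (k - 1) d.
  by apply: map_cst_iota => p pr; rewrite /class_len /n0 /d; lia.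
have gaps : map (fun p => class_mirror d d p - p) rs = odds (k - 1).
  rewrite -(@odds_iota d 2); last by rewrite /d; lia.
  by apply: eq_map_iota => p pr; rewrite /class_mirror ifT // /d; lia.
have Tge : d <= u * d by rewrite leq_pmull; lia.
have Uge : d <= (d - u) * d by rewrite leq_pmull; lia.
have TU : u * d = (d - u) * d + k * d + Z * d \/
          u * d + k * d = (d - u) * d + Z * d.
  by rewrite -!mulnDl; case: uZ => [uZ|[uZ Zk]]; [left | right];
    congr (_ * _); lia.
pose A := (d - u) * d + 2 * k - 1; pose B := 1 + u * d - 2 * k.
have [h [hW hE]] : exists h, subset_sum (A :: B :: k * d :: odds (k - 1)) h /\
    2 * h = A + (B + (k * d + (k - 1) * (k - 1))).
  have odds_n := subset_sum_odds n1 n2 n3.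
  case: TU => TU.
    exists (A + (k * d + n)); split.
      exact/subset_sum_take/subset_sum_skip/subset_sum_take.
    rewrite /A /B; move: TU nE Tge k_ge2; rewrite /d; clear; lia.
  exists (A + n); split;
    first exact/subset_sum_take/subset_sum_skip/subset_sum_skip.
  rewrite /A /B; move: TU nE Tge k_ge2; rewrite /d; clear; lia.
apply: (classes_chi_la r0d erefl d_ltN (rs := rs)
  (sp := cut_classes d 1 (2 * k) d u ++ [:: (d, k.+1 * d, k)])
  (n := h) (D := 2 * (k * k) + k)).
- move=> p; rewrite mem_iota /class_mirror => pr.
  by rewrite ifT; move: pr k_ge2; rewrite /d; clear; lia.
- move=> c; rewrite mem_cat => /orP[|].
    by move: c; apply: cut_classesP; move: k_ge2 ud; rewrite /n0 /d; clear; lia.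
  rewrite inE => /eqP->; rewrite /start /costart /len /=; split.
  + by move: k_ge2; clear; lia.
  + have kd : k * d = d + k.-1 * d by rewrite -mulSn prednK //; move: k_ge2;
    clear; lia.
    by rewrite /n0 mulSn -mulnA; move: kd; clear; lia.
  by rewrite leq_pmull.
- move=> p pd; have [cov1 cov2] := @cut_classes_cover d 1 (2 * k) d u
    ltac:(lia).
  have cat_cov x : has (fun c => (x \in cells d c) || (x \in cells d (flip c)))
      (cut_classes d 1 (2 * k) d u) ->
    has (fun c => (x \in cells d c) || (x \in cells d (flip c)))
      (cut_classes d 1 (2 * k) d u ++ [:: (d, k.+1 * d, k)]).
    by rewrite has_cat => ->.
  have [->|npd] := eqVneq p d.
    constructor 3 => v; rewrite /class_len ltnn addn0 => ltv.
    rewrite has_cat; apply/orP; right; rewrite /= orbF.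
    have [lt|ge] := ltnP v k; apply/orP; [left|right]; apply/cellsP.
      by exists v.
    exists (v - k); rewrite /start /costart /len /=.
      by move: ltv ge; rewrite /n0; clear; lia.
    by rewrite -mulSn -mulnDl; congr (_ * _); move: ge; clear; lia.
  have lt : p < d by move: npd pd; clear; lia.
  have lp : class_len n0 d p = d by rewrite /class_len lt /n0 addn1 /d addn1.
  have [p1|np1] := eqVneq p 1.
    by rewrite lp p1; constructor 3 => v ltv; apply/cat_cov/cov1.
  have [p2|np2] := eqVneq p (2 * k).
    by rewrite lp p2; constructor 3 => v ltv; apply/cat_cov/cov2.
  rewrite /class_mirror lt.
  have /orP[->|->] := @block_cover 2 (k - 1) d p
      ltac:(move: k_ge2; rewrite /d; clear; lia) ltac:(move: np1 pd; clear; lia)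
      ltac:(move: np2 lt; rewrite /d; clear; lia).
    by constructor 1.
  by constructor 2.
- by rewrite size_cat !size_map size_iota /=; clear; lia.
- rewrite lens !map_cat !sumn_cat sumn_nseq /= /len /=.
  by move: ud k_ge2; rewrite /n0 /d; clear; nia.
- rewrite lens !map_cat !sumn_cat sumn_nseq !size_cat size_nseq /= /len /=.
  by move: ud k_ge2; rewrite /n0 /d; clear; nia.
- rewrite lens !map_cat !size_cat size_nseq /= /n0 /d.
  have -> : k - 1 + (2 + 1) = k + 2 by move: k_ge2; clear; lia.
  by clear; lia.
- rewrite gaps map_cat; apply: subset_sum_perm hW.
  rewrite perm_sym perm_catC /= /gap /start /costart /=.
  have -> : 2 * k + (d - u) * d - 1 = A by rewrite /A addnC.
  have -> : 1 + u * d - 2 * k = B by [].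
  by have -> : k.+1 * d - d = k * d by rewrite mulSn addKn.
- rewrite hE gaps map_cat !sumn_cat sumn_odds /= /gap /start /costart /=.
  have -> : 2 * k + (d - u) * d - 1 = A by rewrite /A addnC.
  have -> : 1 + u * d - 2 * k = B by [].
  have -> : k.+1 * d - d = k * d by rewrite mulSn addKn.
  by clear; lia.
rewrite lens !map_cat map_nseq /= /len /= perm_catC /=.
exact: perm_refl.
Qed.

(** The number [n] required by [chi_la_cut_outer_class] exists, and it is not
    one of the two numbers that the sums of [odds (k - 1)] miss; [n2] is [2
    n]. *)
Definition cut_outer_good k Z := let R := (k - 1) * (k - 1) in
  let n2 := R + Z * (2 * k + 1) - (4 * k - 2) in
  [&& 4 * k - 2 <= R + Z * (2 * k + 1), ~~ odd n2, n2 <= 2 * R, n2 != 4 &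
      n2 + 4 != 2 * R].

Lemma cut_outer_good_large k Z : 12 <= k -> 2 * Z <= k + 1 -> ~~ odd (Z + k +
  1) ->
  cut_outer_good k Z.
Proof.
move=> k_ge12 Zk Zodd; pose V := Z * (2 * k + 1).
have V_le : 2 * V <= 2 * (k * k) + 3 * k + 1.
  have -> : 2 * (k * k) + 3 * k + 1 = (k + 1) * (2 * k + 1) by lia.
  by rewrite /V mulnA leq_mul2r Zk orbT.
have kk : 12 * k <= k * k by rewrite leq_mul2r k_ge12 orbT.
have RE : (k - 1) * (k - 1) = k * k + 1 - 2 * k by nia.
have E_even : ~~ odd ((k - 1) * (k - 1) + V).
  have oddV : odd V = odd Z by rewrite /V oddM addn1 mul2n /= odd_double andbT.
  by rewrite oddD oddV oddM andbb; move: Zodd k_ge12; clear; lia.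
rewrite /cut_outer_good -/V RE in E_even *.
by move: E_even V_le kk k_ge12; clear; lia.
Qed.

(** The condition fails for exactly the listed pairs. *)
Lemma cut_outer_good_small k t : 2 <= k < 12 -> 2 * k + 1 <= 8 * t -> 8 * t <=
  6 * k + 7 ->
  [|| cut_outer_good k ((k + 1 - 2 * t) + (2 * t - (k + 1))) |
     (k, t) \in [:: (3, 2); (4, 2); (4, 3); (5, 3); (11, 3); (11, 9)]].
Proof.
move=> kr lt1 lt2.
have : all (fun k => all (fun t => (2 * k + 1 <= 8 * t) && (8 * t <= 6 * k + 7)
  ==>
   [|| cut_outer_good k ((k + 1 - 2 * t) + (2 * t - (k + 1))) |
     (k, t) \in [:: (3, 2); (4, 2); (4, 3); (5, 3); (11, 3); (11, 9)]])
     (iota 0 12)) (iota 2 10) by vm_compute.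
move=> /allP/(_ k); rewrite mem_iota => /(_ kr)/allP/(_ t).
by rewrite mem_iota lt1 lt2; apply; move: kr lt2; clear; lia.
Qed.

(** In each exceptional case a suitable class other than that of 1 is cut. *)
Lemma chi_la_cut_and_half s t : 4 <= s -> 2 * s <= 8 * t + 3 -> 8 * t + 5 <= 6
  * s ->
  chi_la (theta ([:: 2 * t; 4 * s - 6 - 2 * t; 2 * s - 4]
    ++ nseq (s - 3) (4 * s - 6))) 2.
Proof.
move=> s_ge4 lt1 lt2; have [k sk] : exists k, s = k + 2 by exists (s - 2); lia.
have k_ge2 : 2 <= k by lia.
have lk1 : 2 * k + 1 <= 8 * t by lia.
have lk2 : 8 * t <= 6 * k + 7 by lia.
subst s; clear s_ge4 lt1 lt2; pose Z := (k + 1 - 2 * t) + (2 * t - (k + 1)).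
have : cut_outer_good k Z || ((k, t) \in [:: (3, 2); (4, 2); (4, 3); (5, 3);
  (11, 3); (11, 9)]).
  have [lt|ge] := ltnP k 12; first by apply: cut_outer_good_small;
    rewrite ?k_ge2.
  by rewrite cut_outer_good_large //; rewrite /Z; lia.
case/orP=> [/and5P[E_ge E_even n_le n2 n3]|].
  pose d := 2 * k + 1; pose u := if 2 * t <= k + 1 then d - t else t.
  have ud : 0 < u < d by rewrite /u /d; case: ifP; lia.
  have uZ : 2 * u = d + (k + Z) \/ 2 * u + k = d + Z /\ Z <= k.
    by rewrite /u /d /Z; case: ifP => ?; [left | right]; lia.
  pose n := ((k - 1) * (k - 1) + Z * d - (4 * k - 2))./2.
  have nE : 2 * n + (4 * k - 2) = (k - 1) * (k - 1) + Z * d.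
    by rewrite mul2n /n even_halfK // subnK.
  have nn : 2 * n = (k - 1) * (k - 1) + Z * d - (4 * k - 2) by rewrite -nE
    addnK.
  rewrite -nn in n_le n2 n3.
  have := chi_la_cut_outer_class k_ge2 ud uZ nE; rewrite -/d.
  have n_le' : n <= (k - 1) * (k - 1) by rewrite -(leq_pmul2l (_ : 0 < 2)).
  have n2' : n != 2 by rewrite -(eqn_pmul2l (_ : 0 < 2)).
  have n3' : n + 2 != (k - 1) * (k - 1) by rewrite -(eqn_pmul2l (_ : 0 < 2)) //
    mulnDr.
  move=> /(_ n_le' n2' n3'); apply: chi_la_iso; apply: theta_perm.
  have -> : 4 * (k + 2) - 6 = 2 * d by rewrite /d; clear; lia.
  have -> : 2 * (k + 2) - 4 = 2 * k by clear; lia.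
  have -> : k + 2 - 3 = k - 1 by clear; lia.
  have -> : 2 * d - 2 * t = 2 * (d - t) by rewrite mulnBr.
  rewrite perm_cat2r /u; case: ifP => _; last exact: perm_refl.
  rewrite subKn; last by move: lk2; rewrite /d; clear; lia.
  by rewrite (perm_catCA [:: _] [:: _]).
rewrite !inE => /orP[/eqP[-> ->]|/orP[/eqP[-> ->]|/orP[/eqP[-> ->]|/orP[/eqP[->
  ->]|
  /orP[/eqP[-> ->]|/eqP[-> ->]]]]]].
- by apply: (@classes_okP 7 6 7 [:: 1; 3] [:: (7, 28, 3); (2, 40, 2);
    (5, 16, 5)]
    [:: 38] [:: 5; 1; 21; 11]); vm_compute.
- by apply: (@classes_okP 9 8 9 [:: 1; 2; 4] [:: (9, 45, 4); (3, 24, 7);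
    (6, 66, 2)]
    [:: 60; 5] [:: 7; 1; 36; 21]); vm_compute.
- by apply: (@classes_okP 9 8 9 [:: 1; 2; 4] [:: (9, 45, 4); (3, 60, 3);
    (6, 30, 6)]
    [:: 7; 1; 57] [:: 5; 36; 24]); vm_compute.
- by apply: (@classes_okP 11 10 11 [:: 1; 2; 3; 5]
    [:: (11, 66, 5); (4, 95, 3); (7, 37, 8)] [:: 7; 1; 91] [:: 9; 5; 55; 30]);
  vm_compute.
- by apply: (@classes_okP 23 22 23 [:: 1; 3; 4; 5; 6; 7; 8; 9; 10; 11]
    [:: (23, 276, 11); (2, 90, 20); (21, 462, 3)] [:: 441; 1]
    [:: 21; 17; 15; 13; 11; 9; 7; 5; 3; 253; 88]); vm_compute.
by apply: (@classes_okP 23 22 23 [:: 1; 3; 4; 5; 6; 7; 8; 9; 10; 11]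
  [:: (23, 276, 11); (2, 343, 9); (21, 209, 14)] [:: 253; 188; 1]
  [:: 21; 17; 15; 13; 11; 9; 7; 5; 3; 341]); vm_compute.
Qed.

(** * The characterization *)

(** The gaps of the pairs [x, 2 s + 1 - x] are the first [s] odd numbers; for
    [s = 2 h] half of their sum is [2 h^2]. *)
Lemma chi_la_theta_nseq2 s : 4 <= s -> ~~ odd s -> chi_la (theta (nseq s 2)) 2.
Proof.
move=> s_ge4 s_even; have [h sh] : exists h, s = 2 * h.
  by exists s./2; rewrite mul2n even_halfK.
pose K := [seq (p, 2 * s + 1 - p, 1) : chain | p <- iota 1 s].
have lens : map len K = nseq s 1.
  by rewrite -map_comp; apply: map_cst_iota.
have gaps : map gap K = odds s.
  by rewrite -map_comp -(@odds_iota (2 * s + 1) 1 s) //; lia.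
have modK : modulus K = 2 * s + 1 by rewrite /modulus lens sumn_nseq mul1n
  addn1.
have KP c : c \in K -> exists2 p, 0 < p <= s & c = (p, 2 * s + 1 - p, 1).
  by case/mapP=> p; rewrite mem_iota => pr ->; exists p => //; lia.
have hh : 2 * h <= h * h by rewrite leq_mul2r; lia.
have : subset_sum (odds s) (2 * (h * h)).
  by apply: subset_sum_odds; rewrite ?sh; lia.
rewrite -gaps => Kh.
apply: (orient_chi_la (K := K) (d := (h - 1) * (2 * s + 1)) _ _ _ _ _ _ _ Kh).
- by rewrite muln_gt0; lia.
- by rewrite size_map size_iota; lia.
- by move=> c /KP[p _ ->].
- by move=> c /KP[p pr ->]; rewrite modK /start /costart /len /= mul0n addn0;
    lia.
- by move=> c /KP[p pr ->]; rewrite /start /costart /=; lia.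
- move=> x; rewrite modK => xr; have [le|lt] := leqP x s.
    exists (x, 2 * s + 1 - x, 1).
      by apply: (map_f (fun p => (p, 2 * s + 1 - p, 1) : chain));
        rewrite mem_iota; lia.
    by apply/orP; left; apply/cellsP; exists 0; rewrite ?mul0n ?addn0.
  exists (2 * s + 1 - x, 2 * s + 1 - (2 * s + 1 - x), 1).
    by apply: (map_f (fun p => (p, 2 * s + 1 - p, 1) : chain));
      rewrite mem_iota; lia.
  apply/orP; right; apply/cellsP; exists 0 => //.
  by rewrite mul0n addn0 -[start _]/(2 * s + 1 - (2 * s + 1 - x)); move: xr;
    clear; lia.
- rewrite lens sumn_nseq mul1n size_map size_iota modK addKn -mulnDr -mulSn
    mulnA.
  by congr (_ * _); move: sh s_ge4; clear; lia.
- by rewrite gaps sumn_odds sh; lia.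
by rewrite lens map_nseq perm_refl.
Qed.

(** All the possible lengths have [s >= 4].  If the total length were [s + 1],
    then [(s - 2) (2 s - 3)] would be [3 q <= 12], which leaves [s = 4] with
    the value 10, not a multiple of 3. *)
Lemma balanced_size d C : 0 < d -> balanced d C -> 3 <= size C ->
  size C < sumn (map len C) -> (size C).+1 < sumn (map len C).
Proof.
move=> d_gt0 balC C_ge3 ltM.
have s_ge4 : 4 <= size C.
  have sizeE L : perm_eq [seq 2 * len c | c <- C] L -> size C = size L.
    by move/perm_size; rewrite size_map.
  case: (balanced_lens d_gt0 balC C_ge3 ltM) => [[l [l1 /sizeE ->]]|].
    by rewrite size_cat !size_nseq; lia.
  case=> [[l [l2 /sizeE ->]]|]; first by rewrite /= size_nseq; lia.
  case=> [/sizeE -> //|]; case=> [/sizeE -> //|]; case=> [/sizeE -> //|].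
  case=> [[l [t [l2 _ _ /sizeE ->]]]|];
    first by rewrite /= size_cat !size_nseq; lia.
  case=> [[l [t [l2 _ _ /sizeE ->]]]|];
    first by rewrite /= size_cat !size_nseq; lia.
  by case=> t [].
have [q [q_gt0 _ szE Aq]] := balanced_cases d_gt0 balC C_ge3 ltM.
have q_le4 : q <= 4 by lia.
rewrite ltn_neqAle ltM andbT; apply/eqP => eM; rewrite -eM in Aq.
have A3 : (size C).+1 + 2 - size C = 3 by lia.
rewrite A3 in Aq; have [s4|s_ge5] : size C = 4 \/ 5 <= size C by lia.
  by rewrite s4 in Aq; lia.
have : 3 * 7 <= (size C - 2) * (2 * size C - 3) by apply: leq_mul; lia.
by rewrite -Aq; lia.
Qed.

Theorem theorem2p3 (s : nat) (a : s.-tuple nat) (hs : 3 <= s)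
    (ha : forall i : 'I_s, 0 < tnth a i) :
  chi_la (theta a) 2 <->
  ([/\ iso (theta a) (Kbip 2 s), 4 <= s & ~~ odd s] \/
   (2 * s + 2 < #|edge (theta a)| /\
    (
     (exists l : nat, 1 <= l /\
        iso (theta a)
          (theta (nseq (3 * l + 2) (4 * l) ++ nseq l (4 * l + 2)))) \/
     (exists l : nat, 2 <= l /\
        iso (theta a)
          (theta ((2 * l - 2) :: nseq (3 * l - 1) (4 * l - 2)))) \/
     iso (theta a) (theta ([:: 2] ++ nseq 3 4 ++ [:: 6])) \/
     iso (theta a) (theta ([:: 4] ++ nseq 5 8 ++ nseq 2 10)) \/
     iso (theta a) (theta ([:: 6] ++ nseq 7 12 ++ nseq 3 14)) \/
     (* t <= (5l - 2) / 4 *)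
     (exists l t : nat, [/\ 2 <= l, l <= t, 4 * t + 2 <= 5 * l &
        iso (theta a)
          (theta ([:: 4 * l - 2 - 2 * t; 2 * t]
                  ++ nseq l (4 * l - 4) ++ nseq (l - 2) (4 * l - 2)))]) \/
     (* t <= 5l / 4 *)
     (exists l t : nat, [/\ 2 <= l, l <= t, 4 * t <= 5 * l &
        iso (theta a)
          (theta ([:: 4 * l - 2 - 2 * t; 2 * t - 2]
                  ++ nseq (l - 1) (4 * l - 4) ++ nseq (l - 1) (4 * l - 2)))]) \/
     (* (2s - 3) / 8 <= t <= (6s - 5) / 8 *)
     (exists t : nat, [/\ 4 <= s, 2 * s <= 8 * t + 3, 8 * t + 5 <= 6 * s &
        iso (theta a)
          (theta ([:: 2 * t; 4 * s - 6 - 2 * t; 2 * s - 4]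
                  ++ nseq (s - 3) (4 * s - 6)))])))).
Proof.
have sza : size a = s by rewrite size_tuple.
have a_gt0 (i : 'I_(size a)) : 0 < nth 0 a i.
  have lti : i < s by rewrite -[X in _ < X]sza.
  by have := ha (Ordinal lti); rewrite (tnth_nth 0).
have edges_gt0 : 0 < #|edge (theta a)|.
  have i0 : 'I_(size a) by exists 0; rewrite sza; lia.
  rewrite card_theta_edge; apply: leq_trans (a_gt0 i0) _.
  by rewrite sumnE (big_nth 0) big_mkord (bigD1 i0) //= leq_addr.
split.
  case/(chi_la2P edges_gt0) => f laf lab2.
  have a_ge3 : 3 <= size a by rewrite sza.
  have [d [C [d_gt0 balC aE]]] := labeling_balanced a_gt0 a_ge3 laf lab2.
  have szC : size C = s by rewrite -sza aE size_map.
  have C_ge3 : 3 <= size C by rewrite szC.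
  have leM : size C <= sumn (map len C).
    rewrite sumnE big_map -sum1_size big_seq [leqRHS]big_seq.
    by apply: leq_sum => c; apply: (balanced_len balC).
  move: leM; rewrite leq_eqVlt => /orP[/eqP eM|ltM].
    have [lens s_even] := balanced_short balC C_ge3 (esym eM).
    rewrite szC in lens s_even.
    left; split=> //; last by case: (s) hs s_even => [|[|[|[|]]]].
    have -> : tval a = nseq s 2 by rewrite aE (map_comp (muln 2)) lens map_nseq.
    exact: theta_Kbip.
  right; split.
    rewrite card_theta_edge aE sumnE big_map -big_distrr /= -(big_map len predT
      id) -sumnE.
    by have := balanced_size d_gt0 balC C_ge3 ltM; rewrite szC; lia.
  have := balanced_lens d_gt0 balC C_ge3 ltM; rewrite szC -aE.
  case=> [[l [l1 /theta_perm isoL]]|]; first by left; exists l.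
  case=> [[l [l2 /theta_perm isoL]]|]; first by right; left; exists l.
  case=> [/theta_perm isoL|]; first by do 2 right; left.
  case=> [/theta_perm isoL|]; first by do 3 right; left.
  case=> [/theta_perm isoL|]; first by do 4 right; left.
  case=> [[l [t [l1 l2 l3 /theta_perm isoL]]]|]; first by do 5 right; left;
    exists l, t.
  case=> [[l [t [l1 l2 l3 /theta_perm isoL]]]|]; first by do 6 right; left;
    exists l, t.
  by case=> t [l1 l2 l3 /theta_perm isoL]; do 7 right; exists t.
case=> [[isoK s_ge4 s_even]|[_]].
  apply: chi_la_iso (iso_sym isoK) _; apply: chi_la_iso (theta_Kbip s) _.
  exact: chi_la_theta_nseq2.
case=> [[l [l1 isoL]]|];
  first exact/(chi_la_iso (iso_sym isoL))/chi_la_two_lengths.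
case=> [[l [l2 isoL]]|];
  first exact/(chi_la_iso (iso_sym isoL))/chi_la_half_bridge.
case=> [isoL|]; first exact/(chi_la_iso (iso_sym isoL))/chi_la_theta_2_4_6.
case=> [isoL|]; first exact/(chi_la_iso (iso_sym isoL))/chi_la_theta_4_8_10.
case=> [isoL|]; first exact/(chi_la_iso (iso_sym isoL))/chi_la_theta_6_12_14.
case=> [[l [t [l1 l2 l3 isoL]]]|].
  exact/(chi_la_iso (iso_sym isoL))/chi_la_cut_long.
case=> [[l [t [l1 l2 l3 isoL]]]|].
  exact/(chi_la_iso (iso_sym isoL))/chi_la_cut_short.
by case=> t [l1 l2 l3 isoL];
  apply/(chi_la_iso (iso_sym isoL))/chi_la_cut_and_half.
Qed.
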